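(* Let $d\ge 1$, $D>0$, $m_1:=(d-1)/d$, and let $m\in(m_1,1)$. Let $v_0:\mathbb R^d\to[0,\infty)$ be an integrable function with mass $M:=\int_{\mathbb R^d}v_0\,dx\in(0,\infty)$, such that $|x|^2v_0$ and $v_0^m$ are both integrable. Let $v$ be the solution of $\partial_\tau v=D\,\Delta v^m$ on $(0,\infty)\times\mathbb R^d$ with initial datum $v_0$, let $v_\infty$ be the self-similar Barenblatt solution of mass $M$, and set $\mathsf I(\tau):=\int_{\mathbb R^d}|x|^2v(\tau,x)\,dx$, $\mathsf J(\tau):=\int_{\mathbb R^d}|x|^2v_\infty(\tau,x)\,dx=\mathsf J(1)\,\tau^{2\alpha}$. Let $\tau_0>0$ be defined by $\mathsf I(0)=\mathsf J(\tau_0)$, that is, $\tau_0^{2\alpha}=\mathsf I(0)/\mathsf J(1)$. If $v_0=v_\infty(\tau_0,\cdot)$, then $\mathsf I(\tau)=\mathsf J(\tau+\tau_0)$ for all $\tau>0$. For any other initial datum $v_0$, $$\mathsf I(\tau)<\mathsf J(\tau+\tau_0)\qquad\text{for all }\tau>0 .$$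
   Context: Notation: $m_c:=(d-2)/d$; $\alpha>0$ is defined by $1/\alpha=d\,(m-m_c)=2-d(1-m)$; $R(\tau):=(\tau/\alpha)^\alpha$. The Barenblatt self-similar solution of mass $M$ of $\partial_\tau v=D\,\Delta v^m$ is $$v_\infty(\tau,x)=\frac1{R(D\tau)^d}\Big(C+\frac{1-m}{2m}\Big|\frac{x}{R(D\tau)}\Big|^2\Big)^{\frac1{m-1}},\qquad \tau>0,\ x\in\mathbb R^d,$$ where $C>0$ is the unique constant such that $\int_{\mathbb R^d}v_\infty(\tau,x)\,dx=M$ (for all $\tau>0$). The solution $v$ with initial datum $v_0$ is the usual nonnegative, mass-preserving solution. *)

(* Defs.v *)
From HB Require Import structures.
From mathcomp Require Import all_boot all_order all_algebra.
From mathcomp Require Import all_classical all_reals all_analysis.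

Set Implicit Arguments.
Unset Strict Implicit.
Unset Printing Implicit Defensive.

Import Order.TTheory GRing.Theory Num.Theory.
Import numFieldNormedType.Exports.

Local Open Scope classical_set_scope.
Local Open Scope ring_scope.

(* R^d is 'rV[R]_d.  Its sigma-algebra is the product (= Borel) one, generated
   by the coordinates, as the library does for n.-tuple T. *)
Definition rV_display : measure_display -> measure_display.
Proof. exact. Qed.

Section measurable_rV.
Context {R : realType}.
Variable d : nat.

Let coor : 'I_d -> 'rV[R]_d -> R := fun i x => x ord0 i.

Let rV_set0 : g_sigma_preimage coor set0.
Proof. exact: sigma_algebra0. Qed.

Let rV_setC A : g_sigma_preimage coor A -> g_sigma_preimage coor (~` A).
Proof. exact: sigma_algebraC. Qed.

Let rV_bigcup (F : (set 'rV[R]_d)^nat) :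
  (forall i, g_sigma_preimage coor (F i)) ->
  g_sigma_preimage coor (\bigcup_i (F i)).
Proof. exact: sigma_algebra_bigcup. Qed.

HB.instance Definition _ := @isMeasurable.Build (rV_display default_measure_display)
  'rV[R]_d (g_sigma_preimage coor) rV_set0 rV_setC rV_bigcup.

Lemma measurable_coor (i : 'I_d) :
  measurable_fun [set: 'rV[R]_d] (fun x : 'rV[R]_d => x ord0 i).
Proof.
move=> _ Y mY; rewrite setTI; apply: sub_sigma_algebra => /=.
rewrite -bigcup_seq/=; exists i => /=; first by rewrite mem_index_enum.
by exists Y => //; rewrite setTI.
Qed.

Lemma measurable_rVP d' (T : measurableType d') (f : T -> 'rV[R]_d) :
  (forall i, measurable_fun [set: T] (fun t => f t ord0 i)) ->
  measurable_fun [set: T] f.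
Proof.
move=> mf; apply: (@measurability _ _ _ _ _ _
    (\big[setU/set0]_(i < d) preimage_set_system [set: 'rV[R]_d] (coor i)
       measurable)) => //.
move=> A [B + <-]; rewrite -bigcup_seq /= => -[i _ [C mC <-]].
by rewrite setTI; exact: mf.
Qed.

End measurable_rV.

Section lebesgue_measure_rV.
Context {R : realType}.

Definition cons_rV n (p : R * 'rV[R]_n) : 'rV[R]_n.+1 :=
  row_mx (const_mx p.1 : 'rV[R]_1) p.2.

Definition uncons_rV n (x : 'rV[R]_n.+1) : R * 'rV[R]_n :=
  (x ord0 ord0, \row_i x ord0 (lift ord0 i)).

Lemma cons_rVK n : cancel (@cons_rV n) (@uncons_rV n).
Proof.
move=> [t x]; rewrite /uncons_rV /cons_rV /=; congr pair.
- rewrite (_ : ord0 = @lshift 1 n ord0); last exact/val_inj.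
  by rewrite (@row_mxEl _ 1 1 n) mxE.
- apply/rowP => i; rewrite mxE.
  rewrite (_ : lift ord0 i = @rshift 1 n i); last exact/val_inj.
  by rewrite (@row_mxEr _ 1 1 n).
Qed.

Lemma measurable_cons_rV n : measurable_fun [set: R * 'rV[R]_n] (@cons_rV n).
Proof.
apply: measurable_rVP => i; rewrite /cons_rV.
case: (@split_ordP 1 n i) => j ->.
- rewrite (_ : (fun _ => _) = fst); first exact: measurable_fst.
  by apply/funext => p; rewrite (@row_mxEl _ 1 1 n) mxE.
- rewrite (_ : (fun _ => _) = (fun x : 'rV[R]_n => x ord0 j) \o snd).
    exact: (measurableT_comp (measurable_coor j) measurable_snd).
  by apply/funext => p; rewrite (@row_mxEr _ 1 1 n).
Qed.

Lemma measurable_uncons_rV n : measurable_fun [set: 'rV[R]_n.+1] (@uncons_rV n).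
Proof.
apply: measurable_fun_pair; first exact: measurable_coor.
apply: measurable_rVP => i.
rewrite (_ : (fun _ => _) = (fun x : 'rV[R]_n.+1 => x ord0 (lift ord0 i))).
  exact: measurable_coor.
by apply/funext => x; rewrite mxE.
Qed.

Section cons_measure.
Variables (n : nat) (mu : {sigma_finite_measure set 'rV[R]_n -> \bar R}).

Definition cons_measure : set 'rV[R]_n.+1 -> \bar R :=
  pushforward (@lebesgue_measure R \x mu)%E (@cons_rV n).

Let cons_measure0 : cons_measure set0 = 0%E.
Proof. by rewrite /cons_measure /pushforward preimage_set0 measure0. Qed.

Let cons_measure_ge0 A : (0 <= cons_measure A)%E.
Proof. by rewrite /cons_measure /pushforward measure_ge0. Qed.

Let cons_measure_sigma_additive : semi_sigma_additive cons_measure.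
Proof.
move=> F mF tF mUF; rewrite /cons_measure /pushforward preimage_bigcup.
apply: measure_semi_sigma_additive.
- by move=> k; rewrite -[X in measurable X]setTI; exact: measurable_cons_rV.
- apply/trivIsetP => /= i j _ _ ij; rewrite -preimage_setI.
  by move/trivIsetP : tF => /(_ _ _ _ _ ij) ->//; rewrite preimage_set0.
- rewrite -preimage_bigcup -[X in measurable X]setTI.
  exact: measurable_cons_rV.
Qed.

HB.instance Definition _ := isMeasure.Build _ _ _ cons_measure
  cons_measure0 cons_measure_ge0 cons_measure_sigma_additive.

Let cons_measure_sigma_finite : sigma_finite setT cons_measure.
Proof.
have /sigma_finiteP[F [FT ndF mF]] := sigma_finiteT (@lebesgue_measure R).
have /sigma_finiteP[G [GT ndG mG]] := sigma_finiteT mu.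
exists (fun k => @uncons_rV n @^-1` (F k `*` G k)).
  rewrite -preimage_bigcup (_ : \bigcup_k _ = setT) ?preimage_setT//.
  rewrite -subTset => -[t x] _.
  have [i _ Fit] : (\bigcup_k F k) t by rewrite -FT.
  have [j _ Gjx] : (\bigcup_k G k) x by rewrite -GT.
  exists (maxn i j) => //; split.
  - by move: t Fit; apply/subsetPset/ndF; rewrite leq_maxl.
  - by move: x Gjx; apply/subsetPset/ndG; rewrite leq_maxr.
move=> k; have [mFk Fky] := mF k; have [mGk Gky] := mG k.
have mFG : measurable (F k `*` G k) by exact: measurableX.
split; first by rewrite -[X in measurable X]setTI; exact: measurable_uncons_rV.
rewrite /cons_measure /pushforward -comp_preimage.
rewrite (_ : _ \o _ = id); last by apply/funext => p /=; rewrite cons_rVK.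
by rewrite preimage_id product_measure1E// lte_mul_pinfty// ge0_fin_numE.
Qed.

HB.instance Definition _ := @Measure_isSigmaFinite.Build _ _ _ cons_measure
  cons_measure_sigma_finite.

End cons_measure.

(* Lebesgue measure on R^0 is the unit mass at the origin, and Lebesgue measure
   on R^(n+1) is the product of those on R and R^n. *)
Fixpoint lebesgue_rV n : {sigma_finite_measure set 'rV[R]_n -> \bar R} :=
  if n is k.+1 then cons_measure (lebesgue_rV k) else dirac (0 : 'rV[R]_0).

End lebesgue_measure_rV.

Section fast_diffusion.
Context {R : realType}.
Variable d : nat.
Implicit Types (D m C tau : R) (f : 'rV[R]_d -> R) (v : R -> 'rV[R]_d -> R).

(* |x|^2; the library's norm on 'rV[R]_d is the sup norm. *)
Definition normsq (x : 'rV[R]_d) : R := \sum_(i < d) x ord0 i ^+ 2.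

Definition second_moment f : \bar R :=
  (\int[lebesgue_rV d]_x (normsq x * f x)%:E)%E.

Definition partial (i : 'I_d) f (x : 'rV[R]_d) : R :=
  'D_(delta_mx ord0 i) f x.

Definition laplacian f (x : 'rV[R]_d) : R :=
  \sum_(i < d) partial i (partial i f) x.

Definition continuous_pos_time v : Prop :=
  forall tau x, 0 < tau ->
    {for (tau, x), continuous (fun p : R * 'rV[R]_d => v p.1 p.2)}.

Definition powf v m : R -> 'rV[R]_d -> R := fun tau x => v tau x `^ m.

(* Nonnegative, mass-preserving solution of d_tau v = D Delta v^m on
   (0, oo) x R^d with initial datum v0 taken in L^1.  For (d-2)/d < m < 1 and
   v0 in L^1 the solution of the Cauchy problem is positive and smooth for
   tau > 0, so the equation is required pointwise; of the regularity only the
   continuity of v and of the derivatives in the equation is kept. *)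
Record fde_solution D m (v0 : 'rV[R]_d -> R) v : Prop := FdeSolution {
  fde_ge0 : forall tau x, 0 <= tau -> 0 <= v tau x ;
  fde_continuous : continuous_pos_time v ;
  fde_derivable_time : forall tau x, 0 < tau -> derivable (v ^~ x) tau 1 ;
  fde_continuous_time : continuous_pos_time (fun tau x => 'D_1 (v ^~ x) tau) ;
  fde_derivable_space : forall i tau x, 0 < tau ->
    derivable (powf v m tau) x (delta_mx ord0 i) ;
  fde_continuous_space : forall i,
    continuous_pos_time (fun tau => partial i (powf v m tau)) ;
  fde_derivable2_space : forall i tau x, 0 < tau ->
    derivable (partial i (powf v m tau)) x (delta_mx ord0 i) ;
  fde_continuous2_space : forall i,
    continuous_pos_time (fun tau => partial i (partial i (powf v m tau))) ;
  fde_equation : forall tau x, 0 < tau ->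
    'D_1 (v ^~ x) tau = D * laplacian (powf v m tau) x ;
  fde_mass : forall tau, 0 <= tau ->
    (\int[lebesgue_rV d]_x (v tau x)%:E =
     \int[lebesgue_rV d]_x (v0 x)%:E)%E ;
  fde_initial : v 0 = v0 ;
  fde_initial_L1 :
    (\int[lebesgue_rV d]_x `|v tau x - v0 x|%:E)%E @[tau --> 0^'+] --> 0%E
}.

Definition m_crit : R := (d%:R - 2) / d%:R.

Definition m_one : R := (d%:R - 1) / d%:R.

(* 1 / alpha = d (m - m_c) = 2 - d (1 - m). *)
Definition alpha m : R := (d%:R * (m - m_crit))^-1.

Definition scale m tau : R := (tau / alpha m) `^ alpha m.

Definition barenblatt D m C tau (x : 'rV[R]_d) : R :=
  (scale m (D * tau) ^+ d)^-1 *
  (C + (1 - m) / (2 * m) * normsq ((scale m (D * tau))^-1 *: x))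
    `^ (m - 1)^-1.

End fast_diffusion.

Arguments m_crit R d : clear implicits.
Arguments m_one R d : clear implicits.
Arguments alpha R d m : clear implicits.

(* Main.v *)
(** Testing the equation against |x|^2 gives I' = 2 d D int v^m.  Put
    B = v_inf(tau + tau0).  By concavity v^m <= (1-m) B^m + m B^(m-1) v, strictly
    where v <> B.  Since B^(m-1) is affine in |x|^2 and v, B have the same mass,
    z = I - J(. + tau0) satisfies z' <= p z / (tau + tau0) with p = 2 alpha - 1 and
    z(0) = 0, so I <= J; equality at a time T forces v = B on (0, T), hence
    v0 = v_inf(tau0).  That J solves the equality case amounts to a virial identity,
    which is the stationarity of the same concavity inequality under the scaling
    t |-> v_inf(t).  If v0 = v_inf(tau0), then v = B by L^1-contraction.

    Contraction and moment estimate are both instances of Kato's inequality for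
    two solutions (the second one being 0 for the moment), which is proved with
    second differences and translation invariance instead of integration by parts,
    and with left Dini derivatives in time.  Cutting off at radius r costs
    r^-2 int_{|x|<r} v^m = O(r^(d(1-m)-2)) = O(1/r). *)
From HB Require Import structures.
Require Import Defs.
From mathcomp Require Import all_boot all_order all_algebra.
From mathcomp Require Import all_classical all_reals all_analysis.
From mathcomp Require Import measurable_realfun ring lra.

Set Implicit Arguments.
Unset Strict Implicit.
Unset Printing Implicit Defensive.

Import Order.TTheory GRing.Theory Num.Theory.
Import numFieldNormedType.Exports.

Local Open Scope classical_set_scope.
Local Open Scope ring_scope.

(** * Lebesgue measure on R^d *)

(** The notion of solution gives no decay at infinity and no integrability of [v ^ m], so the moment
    can neither be differentiated under the integral nor integrated by parts over the whole space:
    every estimate is made against a compactly supported test and its loss is tracked. The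
    derivative is a left one because of the positive part: if [u > 0] at time [t], the increment of
    [max u 0] over [[t - h, t]] is at most that of [u]; if [u <= 0] at [t], it is at most 0. Nothing
    of the kind holds to the right. The assumption [m > m_1] reads [d (1 - m) < 1]; it bounds the
    integral of [v ^ m] over the cube of radius [r] by a multiple of [r]. The test for the moment
    has two parameters: [eps] makes it bounded, so that convergence in L^1 at time 0 controls its
    integral, and [r] makes its support compact. The loss is of order [1 / (eps r)]. Strictness has
    to survive the removal of the truncation. A single point with [v <> B] gives a space-time box on
    which the concavity deficit has a positive lower bound, and the resulting gain does not depend
    on [eps] and [r]. *)

Section measure_rV.
Context {R : realType}.

(** The sigma-algebra is given by the coordinates, not by open sets. [f] is the pointwise limit of
    its values at the grid points of mesh [1 / (k + 1)] obtained by rounding down, and each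
    approximation takes countably many values, one on each measurable grid cell. *)
Lemma continuous_measurable_rV d (f : 'rV[R]_d -> R) :
  continuous f -> measurable_fun [set: 'rV[R]_d] f.
Proof.
move=> cf.
pose g (k : nat) (z : 'rV[int]_d) : 'rV[R]_d := \row_i ((z ord0 i)%:~R / k.+1%:R).
pose q (k : nat) (x : 'rV[R]_d) : 'rV[int]_d := \row_i Num.floor (k.+1%:R * x ord0 i).
apply: (measurable_fun_cvg (h := fun k x => f (g k (q k x)))).
  move=> k _ Y mY; rewrite setTI.
  pose F z : set 'rV[R]_d := if pselect (Y (f (g k z))) then
    \bigcap_i [set x | Num.floor (k.+1%:R * x ord0 i) = z ord0 i] else set0.
  rewrite (_ : _ @^-1` _ = \bigcup_z F z); last first.
    apply/seteqP; split=> x /=.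
      move=> Yx; exists (q k x) => //; rewrite /F; case: pselect => //= ? i _ /=.
      by rewrite /q mxE.
    move=> [z _]; rewrite /F; case: pselect => // Yz xz.
    suff -> : q k x = z by [].
    by apply/rowP => i; rewrite mxE; exact: xz.
  apply: countable_bigcupT_measurable; first exact: countableP.
  move=> z; rewrite /F; case: pselect => ?; last exact: measurable0.
  apply: fin_bigcap_measurable; [exact: finite_finset|move=> i _].
  have mh : measurable_fun [set: 'rV[R]_d] (fun x : 'rV[R]_d => k.+1%:R * x ord0 i).
    by apply: measurable_funM => //; exact: measurable_coor.
  rewrite [X in measurable X](_ : _ = (fun x : 'rV[R]_d => k.+1%:R * x ord0 i) @^-1`
     `[(z ord0 i)%:~R, (z ord0 i)%:~R + 1[%classic).
    by rewrite -[X in measurable X]setTI; apply: mh => //; exact: measurable_itv.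
  apply/seteqP; split=> x /=; rewrite in_itv /=.
    by move=> <-; rewrite floor_le/= -intrD1 floorD1_gt.
  rewrite -intrD1 => h; exact: floor_def.
move=> x _; apply: (cvg_comp (fun k => g k (q k x)) f _ (cf x)).
apply/cvg_ballP => e e0; near=> k; split=> // i j.
rewrite /g /q !mxE (ord1 i) /ball/=.
have k0 : 0 < k.+1%:R :> R by [].
have := floor_le (k.+1%:R * x ord0 j); have := floorD1_gt (k.+1%:R * x ord0 j).
rewrite intrD1; set z := Num.floor _ => h1 h2.
have -> : x ord0 j - z%:~R / k.+1%:R = (k.+1%:R * x ord0 j - z%:~R) / k.+1%:R.
  by rewrite mulrBl mulrAC divff ?mul1r// gt_eqF.
rewrite ger0_norm; last by rewrite divr_ge0// subr_ge0.
rewrite ltr_pdivrMr//.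
apply: (@lt_le_trans _ _ 1); first by rewrite ltrBlDl.
rewrite mulrC -ler_pdivrMr//.
apply: le_trans (_ : k%:R <= _); last by rewrite ler_nat.
by near: k; apply: nbhs_infty_ger.
Unshelve. all: by end_near. Qed.

(** Half-open intervals determine Lebesgue measure on the line, and the pushforward under
    [t |-> l t + a], multiplied by [l], gives each of them its length. *)
Lemma ge0_integral_affine1 (a l : R) (g : R -> \bar R) : 0 < l ->
  measurable_fun [set: measurableTypeR R] g -> (forall t, 0 <= g t)%E ->
  (\int[@lebesgue_measure R]_t g t =
   l%:E * \int[@lebesgue_measure R]_t g (l * t + a)%R)%E.
Proof.
move=> l0 mg g0.
pose h : measurableTypeR R -> measurableTypeR R := fun t => l * t + a.
have mh : measurable_fun setT h.
  by apply: measurable_funD => //; apply: measurable_funM.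
have l0' := ltW l0.
pose ll := NngNum l0'.
pose pm : {measure set (measurableTypeR R) -> \bar R} :=
  measure_function_pushforward__canonical__measure_function_Measure
    (@lebesgue_measure R) mh.
transitivity (\int[mscale ll pm]_t g t)%E.
  apply: eq_measure_integral => A mA _.
  apply: lebesgue_measure_unique => //= _ [[x y]] _ <-.
  rewrite /mscale/= /pushforward.
  have -> : h @^-1` `]x, y]%classic = `](x - a) / l, (y - a) / l]%classic.
    apply/seteqP; split => t /=; rewrite !in_itv/= /h ltr_pdivrMr// ler_pdivlMr//;
    by rewrite ltrBlDr lerBrDr [l * t]mulrC.
  rewrite !lebesgue_measure_itv/= !lte_fin ltr_pM2r ?invr_gt0// ltrD2r.
  case: ifPn => xy; last by rewrite mule0.
  rewrite -!EFinD -EFinM; congr EFin; rewrite -mulrBl opprB addrA addrNK.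
  by rewrite mulrCA divff ?gt_eqF// mulr1.
rewrite ge0_integral_mscale//=; congr (_ * _)%E.
by rewrite (ge0_integral_pushforward mh)//= preimage_setT.
Qed.

(* [R] and [measurableTypeR R] carry the same sigma-algebra under two displays. *)
Let measurable_cons n :
  measurable_fun [set: measurableTypeR R * 'rV[R]_n] (@cons_rV R n).
Proof. exact: measurable_cons_rV. Qed.

Lemma ge0_integral_cons n (f : 'rV[R]_n.+1 -> \bar R) :
  measurable_fun setT f -> (forall x, 0 <= f x)%E ->
  (\int[lebesgue_rV n.+1]_x f x =
   \int[@lebesgue_measure R]_t \int[lebesgue_rV n]_y f (cons_rV (t, y)))%E.
Proof.
move=> mf f0.
transitivity (\int[(@lebesgue_measure R \x lebesgue_rV n)%E]_p f (cons_rV p))%E.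
  have := ge0_integral_pushforward (@measurable_cons n)
    (@lebesgue_measure R \x lebesgue_rV n)%E measurableT mf (fun x _ => f0 x).
  by rewrite preimage_setT.
rewrite fubini_tonelli1//.
exact: measurableT_comp mf (@measurable_cons n).
Qed.

Lemma measurable_affine_rV d (l : R) (a : 'rV[R]_d) :
  measurable_fun [set: 'rV[R]_d] (fun x : 'rV[R]_d => l *: x + a).
Proof.
apply: measurable_rVP => i; under eq_fun do rewrite !mxE.
by apply: measurable_funD => //; apply: measurable_funM => //; exact: measurable_coor.
Qed.

(** Induction on the dimension by Tonelli, with one factor [l] per coordinate. Translations
    ([l = 1]) serve summation by parts, dilations ([a = 0]) the self-similarity of the profile. *)
Lemma ge0_integral_affine d (l : R) (a : 'rV[R]_d) (f : 'rV[R]_d -> \bar R) :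
  0 < l -> measurable_fun setT f -> (forall x, 0 <= f x)%E ->
  (\int[lebesgue_rV d]_x f x =
   (l ^+ d)%:E * \int[lebesgue_rV d]_x f (l *: x + a)%R)%E.
Proof.
move=> l0; elim: d a f => [|n IH] a f mf f0.
  rewrite expr0 mul1e; apply: eq_integral => x _; congr f.
  by apply/rowP => -[].
have maf := @measurable_affine_rV n.+1 l a.
have mfa := measurableT_comp mf maf.
rewrite ge0_integral_cons// ge0_integral_cons//=; last first.
have mfc t : measurable_fun setT (fun y : 'rV[R]_n => f (cons_rV (t, y))).
  by apply: (measurableT_comp mf); apply: measurableT_comp => //;
    exact: measurable_cons.
pose a' : 'rV[R]_n := \row_i a ord0 (lift ord0 i).
under eq_integral => t _.
  rewrite (IH a')//.
  over.
rewrite /= ge0_integralZl//=; last 3 first.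
- apply: (@measurable_fun_fubini_tonelli_F _ _ _ _ _ (lebesgue_rV n)
    (fun p : measurableTypeR R * 'rV[R]_n => f (cons_rV (p.1, l *: p.2 + a')))) => //.
  apply: (measurableT_comp mf).
  apply: (measurableT_comp (@measurable_cons n)).
  apply: measurable_fun_pair => //=.
  exact: measurableT_comp (@measurable_affine_rV n l a') measurable_snd.
- by move=> t _; apply: integral_ge0.
- by rewrite lee_fin exprn_ge0// ltW.
rewrite (@ge0_integral_affine1 (a ord0 ord0) l)//; last 2 first.
- apply: (@measurable_fun_fubini_tonelli_F _ _ _ _ _ (lebesgue_rV n)
    (fun p : measurableTypeR R * 'rV[R]_n => f (cons_rV (p.1, l *: p.2 + a')))) => //.
  apply: (measurableT_comp mf).
  apply: (measurableT_comp (@measurable_cons n)).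
  apply: measurable_fun_pair => //=.
  exact: measurableT_comp (@measurable_affine_rV n l a') measurable_snd.
- by move=> t; apply: integral_ge0.
rewrite muleA -EFinM -exprSr; congr (_ * _)%E.
apply: eq_integral => t _; apply: eq_integral => y _; congr f.
apply/rowP => i; rewrite !mxE.
case: splitP => j ij /=; rewrite !mxE.
  by rewrite ord1 in ij; congr (_ + a _ _); apply: val_inj.
by congr (_ + a _ _); apply: val_inj.
Qed.

(** The closed ball of the sup norm: compact, of explicit volume for a product measure, and
    containing the Euclidean ball of the same centre and radius. *)
Definition cube d (x0 : 'rV[R]_d) (r : R) : set 'rV[R]_d :=
  [set x | forall i, `|x ord0 i - x0 ord0 i| <= r].

Lemma measurable_cube d (x0 : 'rV[R]_d) r : measurable (cube x0 r).
Proof.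
rewrite (_ : cube x0 r = \bigcap_i [set x | `|x ord0 i - x0 ord0 i| <= r]).
  apply: fin_bigcap_measurable; [exact: finite_finset|move=> i _].
  rewrite [X in measurable X](_ : _ =
    (fun x : 'rV[R]_d => `|x ord0 i - x0 ord0 i|) @^-1` `]-oo, r]%classic); last first.
    by apply/seteqP; split=> x /=; rewrite in_itv.
  rewrite -[X in measurable X]setTI; apply: measurableT_comp => //.
  by apply: measurable_funB => //; exact: measurable_coor.
by apply/seteqP; split=> x /= h i; [move=> _; exact: h|exact: h].
Qed.

Lemma lebesgue_cube d (x0 : 'rV[R]_d) r : 0 <= r ->
  lebesgue_rV d (cube x0 r) = ((2 * r) ^+ d)%:E.
Proof.
move=> r0; elim: d x0 => [|n IH] x0.
  rewrite /= diracE expr0.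
  by rewrite mem_set// => -[].
rewrite -[LHS]mul1e -integral_cst//; last exact: measurable_cube.
rewrite integral_mkcond ge0_integral_cons//; last 2 first.
- apply/measurable_restrict => //; exact: measurable_cube.
- by move=> x; rewrite /patch; case: ifP.
pose x' : 'rV[R]_n := \row_i x0 ord0 (lift ord0 i).
transitivity (\int[@lebesgue_measure R]_(t in `[(x0 ord0 ord0 - r)%R, (x0 ord0 ord0 + r)%R])
   ((2 * r)%R ^+ n)%:E)%E.
  rewrite [RHS]integral_mkcond; apply: eq_integral => t _.
  rewrite {2}/patch; case: ifPn => ht.
    rewrite -(IH x') -[RHS]mul1e -integral_cst//; last exact: measurable_cube.
    rewrite [RHS]integral_mkcond; apply: eq_integral => y _.
    rewrite /patch; congr (if _ then _ else _).
    apply/idP/idP => /set_mem h; apply/mem_set => i.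
      have := h (lift ord0 i); rewrite !mxE.
      case: splitP => j /= ij; first by rewrite ord1 in ij.
      by rewrite (_ : j = i)//; apply/val_inj; case: ij.
    rewrite /cons_rV mxE; case: splitP => j /= ij; rewrite ?mxE.
      rewrite (_ : i = ord0); last by apply/val_inj; rewrite /= ij ord1.
      by move: ht; rewrite inE/= in_itv/= ler_distl.
    rewrite (_ : i = lift ord0 j); last by apply/val_inj.
    by have := h j; rewrite ?mxE.
  rewrite integral0_eq// => y _.
  rewrite /patch; case: ifPn => // /set_mem /(_ ord0).
  rewrite !mxE; case: splitP => j /= ij //.
  rewrite mxE => h; move/negP: ht; case.
  by apply/mem_set; rewrite /= in_itv/= -ler_distl.
rewrite integral_cst//= lebesgue_measure_itv/= lte_fin -EFinD.
have -> : x0 ord0 ord0 + r - (x0 ord0 ord0 - r) = 2 * r by ring.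
rewrite exprSr; case: ltP => h; first by rewrite -EFinM.
by rewrite (_ : 2 * r = 0); [rewrite mule0 mulr0|lra].
Qed.

Lemma compact_cube d (x0 : 'rV[R]_d) r : compact (cube x0 r).
Proof.
rewrite (_ : cube x0 r = [set v | forall i : 'I_d,
   `[x0 ord0 i - r, x0 ord0 i + r]%classic (v ord0 i)]).
  apply: (@rV_compact _ _
    (fun i => `[x0 ord0 i - r, x0 ord0 i + r]%classic)) => i.
  exact: segment_compact.
by apply/seteqP; split=> x /= h i; have := h i; rewrite /= in_itv/= ler_distl.
Qed.

End measure_rV.

(** * Real-valued integrals on R^d and uniform estimates on cubes *)

Section real_integral.
Context {R : realType}.
Variable d : nat.
Implicit Types f g : 'rV[R]_d -> R.

Definition rint f : R := \int[lebesgue_rV d]_x f x.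

Definition rintegrable f := (lebesgue_rV d).-integrable setT (EFin \o f).

Lemma rintegrableD f g : rintegrable f -> rintegrable g ->
  rintegrable (fun x => f x + g x).
Proof. by move=> hf hg; exact: (integrableD measurableT hf hg). Qed.

Lemma rintegrableB f g : rintegrable f -> rintegrable g ->
  rintegrable (fun x => f x - g x).
Proof. by move=> hf hg; exact: (integrableB measurableT hf hg). Qed.

Lemma rintegrableZ k f : rintegrable f -> rintegrable (fun x => k * f x).
Proof. by move=> hf; exact: (integrableZl measurableT k hf). Qed.

Lemma rintD f g : rintegrable f -> rintegrable g ->
  rint (fun x => f x + g x) = rint f + rint g.
Proof. exact: RintegralD. Qed.

Lemma rintB f g : rintegrable f -> rintegrable g ->
  rint (fun x => f x - g x) = rint f - rint g.
Proof. exact: RintegralB. Qed.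

Lemma rintZ k f : rintegrable f -> rint (fun x => k * f x) = k * rint f.
Proof. exact: RintegralZl. Qed.

Lemma eq_rint f g : f =1 g -> rint f = rint g.
Proof. by move=> fg; apply: eq_Rintegral => x _; exact: fg. Qed.

Lemma le_rint f g : rintegrable f -> rintegrable g ->
  (forall x, f x <= g x) -> rint f <= rint g.
Proof. by move=> hf hg fg; exact: le_Rintegral. Qed.

Lemma rint_ge0 f : (forall x, 0 <= f x) -> 0 <= rint f.
Proof. by move=> f0; exact: Rintegral_ge0. Qed.

Lemma rintegrable_sum (n : nat) (F : 'I_n -> 'rV[R]_d -> R) :
  (forall i, rintegrable (F i)) -> rintegrable (fun x => \sum_i F i x).
Proof.
elim: n F => [|n IH] F hF.
  by under eq_fun do rewrite big_ord0; exact: integrable0.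
under eq_fun do rewrite big_ord_recl.
by apply: rintegrableD => //; apply: IH.
Qed.

Lemma rint_sum (n : nat) (F : 'I_n -> 'rV[R]_d -> R) :
  (forall i, rintegrable (F i)) ->
  rint (fun x => \sum_i F i x) = \sum_i rint (F i).
Proof.
elim: n F => [|n IH] F hF.
  rewrite big_ord0 -[RHS](@Rintegral_set0 _ _ _ (lebesgue_rV d) (fun=> 0)).
  under eq_rint do rewrite big_ord0.
  by rewrite /rint /Rintegral !integral0.
under eq_rint do rewrite big_ord_recl.
rewrite rintD//; last by apply: rintegrable_sum.
by rewrite IH// big_ord_recl.
Qed.

Lemma rintegrable_le f g : measurable_fun setT f -> rintegrable g ->
  (forall x, `|f x| <= g x) -> rintegrable f.
Proof.
move=> mf hg fg; apply: (le_integrable _ _ _ hg) => //.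
  exact/measurable_EFinP.
move=> x _; rewrite /= lee_fin (le_trans (fg x))//.
exact: ler_norm.
Qed.

Lemma rintegrable_measurable f : rintegrable f -> measurable_fun setT f.
Proof. by move=> /integrableP[/measurable_EFinP]. Qed.

Lemma rintegrable_cube x0 r : 0 <= r ->
  rintegrable (\1_(cube x0 r) : 'rV[R]_d -> R).
Proof.
have mc := measurable_cube x0 r.
move=> r0; apply/integrableP; split; first exact/measurable_EFinP/measurable_indic.
rewrite (eq_integral (fun x => (\1_(cube x0 r) x)%:E)); last first.
  by move=> x _; rewrite gee0_abs// lee_fin.
rewrite integral_indic// setIT.
rewrite [X in (X < _)%E](_ : _ = ((2 * r) ^+ d)%:E) ?ltry//.
exact: lebesgue_cube.
Qed.

Lemma rint_cube x0 r : 0 <= r ->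
  rint (\1_(cube x0 r) : 'rV[R]_d -> R) = (2 * r) ^+ d.
Proof.
move=> r0; rewrite /rint /Rintegral integral_indic//; last exact: measurable_cube.
rewrite setIT [X in fine X](_ : _ = ((2 * r) ^+ d)%:E)//.
exact: lebesgue_cube.
Qed.

Definition vanish r f := forall x, ~ cube 0 r x -> f x = 0.

Lemma rintegrable_vanish r K f : 0 <= r -> measurable_fun setT f ->
  vanish r f -> (forall x, cube 0 r x -> `|f x| <= K) -> rintegrable f.
Proof.
move=> r0 mf vf fK.
apply: (rintegrable_le mf (rintegrableZ K (rintegrable_cube 0 r0))) => x.
rewrite indicE; case: (pselect (cube 0 r x)) => hx.
  by rewrite mem_set// mulr1 fK.
by rewrite memNset// mulr0 vf// normr0.
Qed.

Lemma le_rint_cube r e f : 0 <= r -> rintegrable f -> vanish r f ->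
  (forall x, cube 0 r x -> f x <= e) -> rint f <= e * (2 * r) ^+ d.
Proof.
move=> r0 hf vf fe; rewrite -(rint_cube 0 r0) -rintZ; last exact: rintegrable_cube.
apply: le_rint => //; first by apply: rintegrableZ; exact: rintegrable_cube.
move=> x; rewrite indicE; case: (pselect (cube 0 r x)) => hx.
  by rewrite mem_set// mulr1 fe.
by rewrite memNset// mulr0 vf.
Qed.

Lemma ge_rint_cube x0 r e f : 0 <= r -> rintegrable f -> (forall x, 0 <= f x) ->
  (forall x, cube x0 r x -> e <= f x) -> e * (2 * r) ^+ d <= rint f.
Proof.
move=> r0 hf f0 fe; rewrite -(rint_cube x0 r0) -rintZ; last exact: rintegrable_cube.
apply: le_rint => //; first by apply: rintegrableZ; exact: rintegrable_cube.
move=> x; rewrite indicE; case: (pselect (cube x0 r x)) => hx.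
  by rewrite mem_set// mulr1 fe.
by rewrite memNset// mulr0 f0.
Qed.

Lemma ge0_rint_shift a f : measurable_fun setT f -> (forall x, 0 <= f x) ->
  rint (fun x => f (x + a)) = rint f.
Proof.
move=> mf f0; rewrite /rint /Rintegral; congr fine.
have mf' : measurable_fun setT (EFin \o f) by exact/measurable_EFinP.
rewrite (@ge0_integral_affine _ d 1 a (EFin \o f))//.
by rewrite expr1n mul1e; apply: eq_integral => x _; rewrite scale1r.
Qed.

Lemma EFin_rint f : rintegrable f ->
  (\int[lebesgue_rV d]_x (f x)%:E)%E = (rint f)%:E.
Proof.
move=> hf; rewrite /rint /Rintegral fineK//.
exact: integrable_fin_num.
Qed.

Lemma rintegrable_ge0 f M : measurable_fun setT f -> (forall x, 0 <= f x) ->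
  (\int[lebesgue_rV d]_x (f x)%:E)%E = M%:E -> rintegrable f.
Proof.
move=> mf f0 fM; apply/integrableP; split; first exact/measurable_EFinP.
under eq_integral => x _ do rewrite /= ger0_norm//.
by rewrite fM ltry.
Qed.

(** Uniform continuity around the slice [{t0} x K]: one [dl] serves all [x] in [K], and the nearby
    point [y] may leave [K]. *)
Lemma compact_unif (G : R -> 'rV[R]_d -> R) (t0 : R) (K : set 'rV[R]_d) (e : R) :
  compact K ->
  (forall x, K x -> {for (t0, x), continuous (fun p : R * 'rV[R]_d => G p.1 p.2)}) ->
  0 < e ->
  exists2 dl, 0 < dl & forall x, K x -> forall t (y : 'rV[R]_d), `|t - t0| < dl ->
    (forall i, `|y ord0 i - x ord0 i| < dl) -> `|G t y - G t0 x| < e.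
Proof.
move=> cK cG e0.
pose P (dl : R) (x : 'rV[R]_d) := forall t (y : 'rV[R]_d), `|t - t0| < dl ->
    (forall i, `|y ord0 i - x ord0 i| < dl) -> `|G t y - G t0 x| < e.
have : \forall dl \near (0:R)^'+, K `<=` P dl.
  move/compact_near_coveringP : cK; apply => x Kx.
  have e20 : 0 < e / 2 by rewrite divr_gt0.
  have /cvg_ballP/(_ _ e20)/nbhs_ballP[n /= n0 hn] := cG x Kx.
  have key t (y : 'rV[R]_d) : `|t - t0| < n -> (forall i, `|y ord0 i - x ord0 i| < n) ->
     `|G t0 x - G t y| < e / 2.
    move=> ht hy; have /= := hn (t, y); rewrite /ball/=; apply.
    by split; rewrite /ball/= 1?distrC//; split => // i j; rewrite ord1 /ball/= distrC.
  have n20 : 0 < n / 2 by rewrite divr_gt0.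
  (* Half the modulus at [x]: [x'] is within [n / 2] of [x], and [y] within [n / 2] of [x']. *)
  exists (ball x (n / 2), [set dl | 0 < dl < n / 2]) => /=.
    split; first exact: nbhsx_ballx.
    near=> dl; rewrite /=; apply/andP; split; near: dl;
      [exact: nbhs_right_gt|exact: nbhs_right_lt].
  move=> [x' dl] /= [[_ xx'] /andP[dl0 dln]] t y ht hy.
  have h1 : `|G t0 x - G t y| < e / 2.
    apply: key => [|i]; first by apply: (lt_trans ht); apply: (lt_trans dln); lra.
    have := xx' ord0 i; rewrite /ball/= => h.
    rewrite -[y ord0 i](subrK (x' ord0 i)) -addrA.
    rewrite (le_lt_trans (ler_normD _ _))// (splitr n) ltrD//.
      by rewrite (lt_trans (hy i)).
    by rewrite distrC.
  have h2 : `|G t0 x - G t0 x'| < e / 2.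
    apply: key => [|i]; first by rewrite subrr normr0.
    have := xx' ord0 i; rewrite /ball/= distrC => h.
    by apply: (lt_trans h); lra.
  rewrite -[G t y](subrK (G t0 x)) -addrA (splitr e).
  by rewrite (le_lt_trans (ler_normD _ _))// ltrD// distrC.
move=> H; have : \forall dl \near (0:R)^'+, 0 < dl /\ K `<=` P dl.
  by near=> dl; split; near: dl => //; exact: nbhs_right_gt.
by case/filter_ex => dl [dl0 hdl]; exists dl.
Unshelve. all: by end_near. Qed.

Lemma continuous_bounded_cube f x0 r : continuous f ->
  exists2 K, 0 <= K & forall x, cube x0 r x -> `|f x| <= K.
Proof.
move=> cf.
have /compact_bounded[M [Mr hM]] : compact (f @` cube x0 r).
  apply: continuous_compact; last exact: compact_cube.
  exact: continuous_subspaceT.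
exists (`|M| + 1); first by rewrite addr_ge0.
move=> x hx; apply: hM; last by exists x.
by rewrite (le_lt_trans (ler_norm M))// ltrDl.
Qed.

Lemma cube_shift (x y a : 'rV[R]_d) r s : cube y r x -> (forall i, `|a ord0 i| <= s) ->
  cube y (r + s) (x + a).
Proof.
move=> hx ha i; rewrite !mxE addrAC.
by rewrite (le_trans (ler_normD _ _))// lerD//; exact: hx.
Qed.

Lemma le_cube (x : 'rV[R]_d) r s : r <= s -> cube x r `<=` cube x s.
Proof. by move=> rs y hy i; exact: le_trans (hy i) rs. Qed.

End real_integral.

(** * Differentiation rules for pointwise expressions *)

Section is_derive_pointwise.
Context {R : realType}.
Implicit Types f g : R -> R.

Lemma is_derive1_add f g (x a b : R) : is_derive x 1 f a -> is_derive x 1 g b ->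
  is_derive x 1 (fun t => f t + g t) (a + b).
Proof. exact: is_deriveD. Qed.

Lemma is_derive1_sub f g (x a b : R) : is_derive x 1 f a -> is_derive x 1 g b ->
  is_derive x 1 (fun t => f t - g t) (a - b).
Proof. exact: is_deriveB. Qed.

Lemma is_derive1_mul f g (x a b : R) : is_derive x 1 f a -> is_derive x 1 g b ->
  is_derive x 1 (fun t => f t * g t) (a * g x + f x * b).
Proof.
move=> df dg; have := is_deriveM df dg => dfg.
by apply: is_derive_eq; rewrite /GRing.scale/= addrC mulrC.
Qed.

Lemma is_derive1_cst (k x : R) : is_derive x 1 (fun=> k) 0.
Proof. exact: is_derive_cst. Qed.

Lemma is_derive1_scale f (k x a : R) : is_derive x 1 f a ->
  is_derive x 1 (fun t => k * f t) (k * a).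
Proof. exact: is_deriveZ. Qed.

Lemma is_derive1_id (x : R) : is_derive x 1 (fun t => t) 1.
Proof. exact: is_derive_id. Qed.

Lemma is_derive1_exp f n (x a : R) : is_derive x 1 f a ->
  is_derive x 1 (fun t => f t ^+ n) (n%:R * f x ^+ n.-1 * a).
Proof.
move=> df; rewrite (_ : (fun t => _) = f ^+ n); first exact: is_deriveX.
by apply/funext => t; rewrite exprfctE.
Qed.

Lemma is_derive1_chain f g (x a b : R) : is_derive (g x) 1 f a ->
  is_derive x 1 g b -> is_derive x 1 (fun t => f (g t)) (a * b).
Proof. exact: is_derive1_comp. Qed.

Lemma is_derive1_shift f (c x a : R) : is_derive (c + x) 1 f a ->
  is_derive x 1 (fun t => f (c + t)) a.
Proof.
move=> df; rewrite -(mulr1 a).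
apply: (is_derive1_chain (g := fun t => c + t)) => //.
by rewrite -[X in is_derive _ _ _ X]add0r;
  exact: (is_derive1_add (is_derive1_cst _ _) (is_derive1_id _)).
Qed.

Lemma is_derive1_reflect f (c x a : R) : is_derive (c - x) 1 f a ->
  is_derive x 1 (fun t => f (c - t)) (- a).
Proof.
move=> df; rewrite -(mulrN1 a).
apply: (is_derive1_chain (g := fun t => c - t)) => //.
by rewrite -[X in is_derive _ _ _ X]sub0r;
  exact: (is_derive1_sub (is_derive1_cst _ _) (is_derive1_id _)).
Qed.

Lemma is_derive1_continuous f (x a : R) : is_derive x 1 f a ->
  {for x, continuous f}.
Proof.
by move=> [df _]; exact/differentiable_continuous/derivable1_diffP.
Qed.

End is_derive_pointwise.

(** * Second differences *)

Section second_difference.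
Context {R : realType}.

(** Cauchy's mean value theorem compares the symmetric difference in [k] with [k ^+ 2] and yields
    [c]. The mean value theorem for [f'] on [[x - c, x + c]] then produces [f''], and the length
    [2 c] cancels the derivative of the square. *)
Lemma second_difference (f f' f'' : R -> R) (x h : R) :
  (forall t : R, is_derive t 1 f (f' t)) -> (forall t : R, is_derive t 1 f' (f'' t)) ->
  0 < h -> exists2 xi, `|xi - x| <= h & f (x + h) + f (x - h) - 2 * f x = h ^+ 2 * f'' xi.
Proof.
move=> df df' h0.
pose g k := f (x + k) + f (x - k) - 2 * f x.
have dg (k : R) : is_derive k 1 g (f' (x + k) - f' (x - k)).
  have := is_derive1_sub (is_derive1_add (is_derive1_shift (df (x + k)))
    (is_derive1_reflect (df (x - k)))) (is_derive1_cst (2 * f x) k).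
  by rewrite subr0.
have dsq (k : R) : is_derive k 1 (fun k : R => k ^+ 2) (2 * k).
  have := is_derive1_exp 2 (is_derive1_id k).
  by rewrite expr1 mulr1.
have cont (u u' : R -> R) a b : (forall t : R, is_derive t 1 u (u' t)) ->
    {within `[a, b], continuous u}.
  move=> du; apply: derivable_within_continuous => t _.
  exact: (@ex_derive _ _ _ _ _ _ _ (du t)).
have [c] := cauchy_MVT h0 (cont g _ 0 h dg) (cont _ _ 0 h dsq)
  (fun k _ => dg k) (fun k _ => dsq k)
  (fun k (hk : k \in `]0, h[) => ltac:(by rewrite mulf_neq0 ?gt_eqF ?(itvP hk))).
rewrite in_itv/= => /andP[c0 ch] hc.
have xcxc : x - c < x + c by rewrite ltrD2l gtrN.
have [xi] := MVT xcxc (fun t _ => df' t) (cont _ _ _ _ df').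
rewrite in_itv/= => /andP[xi1 xi2] hxi.
exists xi; first by rewrite ler_distl; apply/andP; split; lra.
have : g h - g 0 = h ^+ 2 * f'' xi.
  have h20 : h ^+ 2 - 0 ^+ 2 != 0 by rewrite expr0n subr0 expf_neq0// gt_eqF.
  have c20 : 2 * c != 0 by rewrite mulf_neq0// gt_eqF.
  move/eqP: hc; rewrite eqr_div// hxi => /eqP.
  rewrite expr0n/= subr0 => hh.
  apply: (mulIf c20); rewrite -hh; ring.
by rewrite /g addr0 subr0 => <-; ring.
Qed.

Variable d : nat.
Implicit Types f : 'rV[R]_d -> R.

Notation ev i := (delta_mx ord0 i : 'rV[R]_d).

Lemma is_derive_line f (x v : 'rV[R]_d) t : derivable f (x + t *: v) v ->
  is_derive t 1 (fun s => f (x + s *: v)) ('D_v f (x + t *: v)).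
Proof.
move=> df.
have E : (fun h : R => h^-1 *: ((f (x + (h *: 1 + t) *: v)) - f (x + t *: v))) =
         (fun h : R => h^-1 *: (f (h *: v + (x + t *: v)) - f (x + t *: v))).
  apply/funext => h; congr (_ *: (f _ - _)).
  by rewrite [h *: 1]mulr1 scalerDl addrCA.
apply: DeriveDef; first by rewrite /derivable/= E.
by rewrite /derive/= E.
Qed.

(** Only pure second derivatives occur, because the Laplacian is reached through second differences
    along the axes. *)
Definition C2 f := [/\ forall i x, derivable f x (ev i),
  forall i x, derivable (partial i f) x (ev i) &
  forall i, continuous (partial i (partial i f))].

Lemma C2_laplacian f : C2 f -> measurable_fun setT (laplacian f).
Proof.
move=> [_ _ cf]; apply: measurable_sum => i.
by apply: continuous_measurable_rV; exact: cf.
Qed.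

Lemma C2_second_difference f i x h : C2 f -> 0 < h ->
  exists2 xi, `|xi| <= h & f (x + h *: ev i) + f (x - h *: ev i) - 2 * f x
     = h ^+ 2 * partial i (partial i f) (x + xi *: ev i).
Proof.
move=> [d1 d2 _] h0.
have [xi] := @second_difference (fun s => f (x + s *: ev i))
  (fun s => partial i f (x + s *: ev i))
  (fun s => partial i (partial i f) (x + s *: ev i)) 0 h
  (fun t => is_derive_line (d1 i _)) (fun t => is_derive_line (d2 i _)) h0.
rewrite subr0 add0r sub0r scale0r addr0 scaleNr => ? ?.
by exists xi.
Qed.

Lemma ev_le i j (t : R) : `|(t *: ev i) ord0 j| <= `|t|.
Proof.
rewrite !mxE /=; case: eqP => _; first by rewrite mulr1.
by rewrite mulr0 normr0.
Qed.

Lemma C2_second_difference_unif f i r e : C2 f -> 0 < e ->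
  exists2 dl, 0 < dl & forall h x, 0 < h -> h < dl -> cube 0 r x ->
  `|f (x + h *: ev i) + f (x - h *: ev i) - 2 * f x
     - h ^+ 2 * partial i (partial i f) x| <= h ^+ 2 * e.
Proof.
move=> hf e0; have [_ _ cf] := hf.
have [x _|dl dl0 hdl] := @compact_unif R d (fun=> partial i (partial i f)) 0
   (cube 0 r) e (@compact_cube R d 0 r) _ e0.
  apply: (cvg_comp snd (partial i (partial i f)) _ (cf i x)).
  exact: cvg_snd.
exists dl => // h x h0 hdl' hx.
have [xi hxi ->] := @C2_second_difference f i x h hf h0.
rewrite -mulrBr normrM ger0_norm ?sqr_ge0// ler_wpM2l ?sqr_ge0// ltW//.
apply: (hdl x hx 0); first by rewrite subrr normr0.
move=> j; rewrite mxE addrAC subrr add0r.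
by rewrite (le_lt_trans (ev_le _ _ _))// (le_lt_trans hxi).
Qed.

End second_difference.

(** * Kato's inequality *)

Section kato_space.
Context {R : realType}.
Variable d : nat.
Implicit Types f g w phi : 'rV[R]_d -> R.

Notation ev i := (delta_mx ord0 i : 'rV[R]_d).

Record test_function (r : R) phi : Prop := TestFunction {
  test_ge0 : forall x, 0 <= phi x ;
  test_continuous : continuous phi ;
  test_C2 : C2 phi ;
  test_vanish : vanish r phi ;
  test_vanish2 : forall i, vanish r (partial i (partial i phi)) }.

(** Local boundedness: with measurability it makes the product with a test function integrable,
    whatever happens at infinity. *)
Definition bounded_cubes f := forall r, exists2 K, 0 <= K &
  forall x, cube 0 r x -> `|f x| <= K.

Lemma test_bounded r phi : test_function r phi ->
  exists2 K, 0 <= K & forall x, `|phi x| <= K.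
Proof.
move=> tphi.
have [K K0 hK] := @continuous_bounded_cube R d phi 0 r (test_continuous tphi).
exists K => // x; case: (pselect (cube 0 r x)) => hx; first exact: hK.
by rewrite (test_vanish tphi)// normr0.
Qed.

Lemma measurable_shift f (a : 'rV[R]_d) : measurable_fun setT f ->
  measurable_fun setT (fun x : 'rV[R]_d => f (x + a)).
Proof.
move=> mf; have := measurableT_comp mf (measurable_affine_rV 1 a).
by under eq_fun do rewrite scale1r.
Qed.

Lemma rintegrable_test r phi f : 0 <= r -> test_function r phi ->
  measurable_fun setT f -> bounded_cubes f -> rintegrable (fun x => phi x * f x).
Proof.
move=> r0 tphi mf bf; have [K K0 hK] := test_bounded tphi.
have [L L0 hL] := bf r.
apply: (@rintegrable_vanish R d r (K * L)) => //.
- apply: measurable_funM => //.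
  exact: continuous_measurable_rV (test_continuous tphi).
- by move=> x hx; rewrite (test_vanish tphi)// mul0r.
- by move=> x hx; rewrite normrM ler_pM// hL.
Qed.

Lemma rintegrable_test2 r phi f i : 0 <= r -> test_function r phi ->
  measurable_fun setT f -> bounded_cubes f ->
  rintegrable (fun x => f x * partial i (partial i phi) x).
Proof.
move=> r0 tphi mf bf.
have [_ _ c2] := test_C2 tphi.
have [K K0 hK] := @continuous_bounded_cube R d _ 0 r (c2 i).
have [L L0 hL] := bf r.
apply: (@rintegrable_vanish R d r (L * K)) => //.
- by apply: measurable_funM => //; exact: continuous_measurable_rV.
- by move=> x hx; rewrite (test_vanish2 tphi)// mulr0.
- by move=> x hx; rewrite normrM ler_pM// ?hL ?hK.
Qed.

Lemma bounded_cubes_shift f (a : 'rV[R]_d) : bounded_cubes f ->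
  bounded_cubes (fun x => f (x + a)).
Proof.
move=> bf r.
have [s hs] : exists s : R, forall i, `|a ord0 i| <= s.
  exists (\sum_i `|a ord0 i|) => i.
  by rewrite (bigD1 i)//= lerDl sumr_ge0.
have [K K0 hK] := bf (r + s).
by exists K => // x hx; apply: hK; exact: cube_shift.
Qed.

Lemma bounded_cubesB f g : bounded_cubes f -> bounded_cubes g ->
  bounded_cubes (fun x => f x - g x).
Proof.
move=> bf bg r; have [K K0 hK] := bf r; have [L L0 hL] := bg r.
exists (K + L); first exact: addr_ge0.
by move=> x hx; rewrite (le_trans (ler_normB _ _))// lerD// ?hK ?hL.
Qed.

Lemma bounded_cubes_le f g : bounded_cubes f -> (forall x, `|g x| <= `|f x|) ->
  bounded_cubes g.
Proof.
move=> bf fg r; have [K K0 hK] := bf r.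
by exists K => // x hx; rewrite (le_trans (fg x))// hK.
Qed.

Lemma continuous_bounded_cubes f : continuous f -> bounded_cubes f.
Proof. by move=> cf r; exact: continuous_bounded_cube. Qed.

Lemma maxr0_le (t : R) : `|Num.max t 0| <= `|t|.
Proof.
by case: (leP t 0) => h; rewrite ?normr0.
Qed.

Lemma measurable_maxr0 f : measurable_fun setT f ->
  measurable_fun setT (fun x => Num.max (f x) 0).
Proof. by move=> mf; exact: measurable_maxr. Qed.

Lemma measurable_if_pos f g : measurable_fun setT f -> measurable_fun setT g ->
  measurable_fun setT (fun x => if 0 < f x then g x else 0).
Proof.
by move=> mf mg; apply: measurable_fun_ifT => //; exact: measurable_fun_ltr.
Qed.

Let rint_test_shift r phi f (a : 'rV[R]_d) : 0 <= r -> test_function r phi ->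
  measurable_fun setT f -> (forall x, 0 <= f x) ->
  rint (fun x => phi x * f (x + a)) = rint (fun x => f x * phi (x - a)).
Proof.
move=> r0 tphi mf f0.
have mphi := continuous_measurable_rV (test_continuous tphi).
rewrite -(@ge0_rint_shift _ _ a (fun x => f x * phi (x - a))); last 2 first.
- by apply: measurable_funM => //; exact: measurable_shift.
- by move=> x; rewrite mulr_ge0// (test_ge0 tphi).
by apply: eq_rint => x; rewrite addrK mulrC.
Qed.

(* Summation by parts replaces integration by parts: with [W] the positive part
   of [w1 - w2], the second difference of [W] dominates that of [w1 - w2] where
   [w1 - w2 > 0], and it is moved onto [phi] by translation invariance. *)
Lemma kato_direction r phi w1 w2 i : 0 <= r -> test_function r phi ->
  C2 w1 -> C2 w2 -> measurable_fun setT w1 -> measurable_fun setT w2 ->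
  bounded_cubes w1 -> bounded_cubes w2 ->
  rint (fun x => phi x * (if 0 < w1 x - w2 x then
    partial i (partial i w1) x - partial i (partial i w2) x else 0)) <=
  rint (fun x => Num.max (w1 x - w2 x) 0 * partial i (partial i phi) x).
Proof.
move=> r0 tphi c1 c2 m1 m2 b1 b2.
have [K K0 hK] := test_bounded tphi.
have mphi := continuous_measurable_rV (test_continuous tphi).
pose W x := Num.max (w1 x - w2 x) 0.
have W0 x : 0 <= W x by rewrite /W le_max lexx orbT.
have mw : measurable_fun setT (fun x => w1 x - w2 x) by exact: measurable_funB.
have mW : measurable_fun setT W by exact: measurable_maxr0.
have bw : bounded_cubes (fun x => w1 x - w2 x) by exact: bounded_cubesB.
have bW : bounded_cubes W by apply: bounded_cubes_le bw _ => x; exact: maxr0_le.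
have r10 : 0 <= r + 1 by rewrite addr_ge0.
have [L L0 hL] := bW (r + 1).
set V : R := (2 * (r + 1)) ^+ d.
have V0 : 0 <= V by rewrite exprn_ge0// mulr_ge0.
apply/ler_addgt0Pr => e e0.
(* Error budget on the cube of radius [r + 1] and volume [V]: the second differences of [w1] and
   [w2] cost [e'] each against [phi <= K], that of [phi] costs [e'] against [W <= L]. The radius
   grows by 1 because a step [h <= 1] moves the support of [phi] by at most 1. *)
pose c := (2 * K + L) * V.
have c0 : 0 <= c by rewrite mulr_ge0// addr_ge0// mulr_ge0.
pose e' := e / (c + 1).
have c10 : 0 < c + 1 by rewrite ltr_wpDl.
have e'0 : 0 < e' by rewrite divr_gt0.
have [d1 d10 hd1] := @C2_second_difference_unif R d w1 i (r + 1) e' c1 e'0.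
have [d2 d20 hd2] := @C2_second_difference_unif R d w2 i (r + 1) e' c2 e'0.
have [d3 d30 hd3] :=
  @C2_second_difference_unif R d phi i (r + 1) e' (test_C2 tphi) e'0.
have [h [h0 hh1 hh2 hh3 h1]] : exists h, [/\ 0 < h, h < d1, h < d2, h < d3 & h <= 1].
  exists (Num.min (Num.min d1 d2) (Num.min d3 1) / 2).
  have : 0 < Num.min (Num.min d1 d2) (Num.min d3 1) by rewrite !lt_min d10 d20 d30 ltr01.
  set mn := Num.min _ _ => mn0.
  have [l1 l2 l3 l4] : [/\ mn <= d1, mn <= d2, mn <= d3 & mn <= 1].
    by rewrite /mn !ge_min !lexx ?orbT.
  by split; lra.
have hc : forall x, ~ cube 0 (r + 1) x -> forall s, `|s| <= 1 -> phi (x + s *: ev i) = 0.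
  move=> x hx s hs; apply: (test_vanish tphi) => hc; apply: hx.
  rewrite -[x](addrK (s *: ev i)).
  by apply: cube_shift => // j; rewrite mxE normrN (le_trans (ev_le _ _ _)).
pose a := h *: ev i.
have nh : `|h| <= 1 by rewrite ger0_norm// ltW.
have nhN : `|- h| <= 1 by rewrite normrN.
have h20 : 0 < h ^+ 2 by rewrite exprn_gt0.
pose DW x := W (x + a) + W (x - a) - 2 * W x.
pose Dp x := phi (x + a) + phi (x - a) - 2 * phi x.
have iQ : rintegrable (\1_(cube 0 (r + 1)) : 'rV[R]_d -> R) by exact: rintegrable_cube.
have it f : measurable_fun setT f -> bounded_cubes f -> rintegrable (fun x => phi x * f x).
  exact: (rintegrable_test r0 tphi).
have i1 := it _ (measurable_shift a mW) (bounded_cubes_shift a bW).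
have i2 := it _ (measurable_shift (- a) mW) (bounded_cubes_shift (- a) bW).
have i3 := it _ mW bW.
have bp : bounded_cubes phi by move=> s; exists K.
have jt s : `|s| <= 1 -> rintegrable (fun x => W x * phi (x + s *: ev i)).
  move=> s1; apply: (@rintegrable_vanish R d (r + 1) (L * K)) => //.
  - by apply: measurable_funM => //; exact: measurable_shift.
  - by move=> x hx; rewrite hc// mulr0.
  - by move=> x hx; rewrite normrM ler_pM// hL.
have j1 := jt _ nh.
have j2 := jt _ nhN.
have j3 : rintegrable (fun x => W x * phi x).
  by move: i3; apply: eq_integrable => // x _; rewrite /= mulrC.
have iDW : rintegrable (fun x => phi x * DW x).
  have := rintegrableB (rintegrableD i1 i2) (rintegrableZ 2 i3).
  by apply: eq_integrable => // x _; rewrite /= /DW; congr EFin; ring.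
have iDp : rintegrable (fun x => W x * Dp x).
  have := rintegrableB (rintegrableD j1 j2) (rintegrableZ 2 j3).
  by apply: eq_integrable => // x _; rewrite /= /Dp scaleNr; congr EFin; ring.
have parts : rint (fun x => phi x * DW x) = rint (fun x => W x * Dp x).
  have EW x : phi x * DW x =
      phi x * W (x + a) + phi x * W (x - a) - 2 * (phi x * W x) by rewrite /DW; ring.
  have Ep x : W x * Dp x = W x * phi (x + h *: ev i) + W x * phi (x + - h *: ev i)
      - 2 * (W x * phi x) by rewrite /Dp /a scaleNr; ring.
  rewrite (eq_rint EW) (eq_rint Ep).
  rewrite (rintB (rintegrableD i1 i2) (rintegrableZ 2 i3)) (rintD i1 i2) (rintZ 2 i3).
  rewrite (rintB (rintegrableD j1 j2) (rintegrableZ 2 j3)) (rintD j1 j2) (rintZ 2 j3).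
  rewrite !(rint_test_shift _ r0 tphi)// opprK.
  rewrite (@eq_rint _ _ (fun x => phi x * W x) (fun x => W x * phi x)); last first.
    by move=> x; rewrite mulrC.
  by rewrite /a -scaleNr [X in X - _ = _]addrC.
have [_ _ cp1] := c1; have [_ _ cp2] := c2.
apply: (@le_trans _ _ ((h ^+ 2)^-1 * rint (fun x => phi x * DW x) + 2 * K * e' * V)).
  rewrite -rintZ// /V -(rint_cube (0 : 'rV[R]_d) r10) -rintZ// -rintD//; last 2 first.
  - exact: rintegrableZ.
  - exact: rintegrableZ.
  apply: le_rint.
  - apply: it.
      apply: measurable_if_pos => //.
      by apply: measurable_funB; apply: continuous_measurable_rV.
    apply: (bounded_cubes_le (bounded_cubesB (continuous_bounded_cubes (cp1 i))
      (continuous_bounded_cubes (cp2 i)))) => x.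
    by case: ifP => // _; rewrite normr0.
  - by apply: rintegrableD; exact: rintegrableZ.
  move=> x; case: (pselect (cube 0 r x)) => hx; last first.
    rewrite (test_vanish tphi)// !mul0r mulr0 add0r.
    by rewrite indicE mulr_ge0// mulr_ge0 ?(ltW e'0)// mulr_ge0.
  have hx1 : cube 0 (r + 1) x by apply: le_cube hx; rewrite lerDl.
  rewrite indicE mem_set// mulr1.
  have p0 := test_ge0 tphi x.
  have pK : phi x <= K by rewrite (le_trans (ler_norm _)).
  have Wle y : w1 y - w2 y <= W y by rewrite /W le_max lexx.
  (* Where [w1 <= w2], [W x = 0], so that the second difference of [W] is a sum of two nonnegative
     values. *)
  case: ltP => hw; last first.
    rewrite mulr0 addr_ge0//; last by rewrite mulr_ge0 ?(ltW e'0)// mulr_ge0.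
    apply: mulr_ge0; first by rewrite invr_ge0 ltW.
    apply: mulr_ge0 => //; rewrite /DW.
    have -> : W x = 0 by rewrite /W; apply/max_idPr.
    by rewrite mulr0 subr0 addr_ge0.
  have Wx : W x = w1 x - w2 x by rewrite /W; apply/max_idPl/ltW.
  have gen p1 p2 : `|w1 (x + a) + w1 (x - a) - 2 * w1 x - h ^+ 2 * p1| <= h ^+ 2 * e' ->
      `|w2 (x + a) + w2 (x - a) - 2 * w2 x - h ^+ 2 * p2| <= h ^+ 2 * e' ->
      p1 - p2 <= (h ^+ 2)^-1 * DW x + 2 * e'.
    rewrite !ler_norml => /andP[E1 _] /andP[_ E2].
    rewrite -(ler_pM2l h20) [leRHS]mulrDr mulVKf ?gt_eqF//.
    rewrite /DW Wx; have := Wle (x + a); have := Wle (x - a); move: E1 E2.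
    by move: (h ^+ 2) => q; lra.
  have key2 := gen _ _ (hd1 h x h0 hh1 hx1) (hd2 h x h0 hh2 hx1).
  apply: le_trans (ler_wpM2l p0 key2) _.
  rewrite mulrDr mulrCA lerD2l mulrCA -mulrA ler_wpM2l// ler_wpM2r//.
  exact: ltW.
apply: (@le_trans _ _ (rint (fun x => W x * partial i (partial i phi) x) +
    L * e' * V + 2 * K * e' * V)).
  rewrite lerD2r parts -rintZ// -[L * e' * V]/(_ * (2 * (r + 1)) ^+ d)
    -(rint_cube (0 : 'rV[R]_d) r10) -rintZ// -rintD//; last 2 first.
  - exact: rintegrable_test2 tphi mW bW.
  - exact: rintegrableZ.
  apply: le_rint.
  - exact: rintegrableZ.
  - apply: rintegrableD; last exact: rintegrableZ.
    exact: rintegrable_test2 tphi mW bW.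
  move=> x; case: (pselect (cube 0 (r + 1) x)) => hx; last first.
    have hpx : phi x = 0 by have := hc _ hx 0; rewrite scale0r addr0 normr0; apply.
    rewrite /Dp /a hc// -scaleNr hc// hpx addr0 mulr0 subr0 !mulr0.
    rewrite (test_vanish2 tphi); last by move=> h'; apply: hx; apply: le_cube h'; rewrite lerDl.
    by rewrite mulr0 add0r indicE memNset// mulr0.
  rewrite indicE mem_set// mulr1.
  have := hd3 h x h0 hh3 hx; rewrite -/a ler_norml => /andP[_].
  rewrite -/(Dp x) lerBlDr => E.
  rewrite mulrCA.
  have WL : W x <= L by rewrite (le_trans (ler_norm _))// hL.
  have : (h ^+ 2)^-1 * Dp x <= partial i (partial i phi) x + e'.
    by rewrite -(ler_pM2l h20) mulVKf ?gt_eqF// mulrDr addrC.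
  move/(ler_wpM2l (W0 x))/le_trans; apply.
  by rewrite mulrDr lerD2l ler_wpM2r// ltW.
rewrite -addrA lerD2l.
have -> : L * e' * V + 2 * K * e' * V = c * e' by rewrite /c; ring.
rewrite /e' mulrCA ler_piMr ?(ltW e0)// ler_pdivrMr// mul1r.
by rewrite lerDl.
Qed.

Lemma kato_space r phi w1 w2 : 0 <= r -> test_function r phi ->
  C2 w1 -> C2 w2 -> measurable_fun setT w1 -> measurable_fun setT w2 ->
  bounded_cubes w1 -> bounded_cubes w2 ->
  rint (fun x => phi x *
    (if 0 < w1 x - w2 x then laplacian w1 x - laplacian w2 x else 0)) <=
  rint (fun x => Num.max (w1 x - w2 x) 0 * laplacian phi x).
Proof.
move=> r0 tphi c1 c2 m1 m2 b1 b2.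
have mw : measurable_fun setT (fun x => w1 x - w2 x) by exact: measurable_funB.
have bw : bounded_cubes (fun x => w1 x - w2 x) by exact: bounded_cubesB.
have [_ _ cp1] := c1; have [_ _ cp2] := c2.
under [leRHS]eq_rint => x do rewrite mulr_sumr.
rewrite rint_sum; last first.
  move=> i; apply: (rintegrable_test2 _ r0 tphi (measurable_maxr0 mw)).
  by apply: bounded_cubes_le bw _ => x; exact: maxr0_le.
have iL i : rintegrable (fun x => phi x * (if 0 < w1 x - w2 x then
    partial i (partial i w1) x - partial i (partial i w2) x else 0)).
  apply: (rintegrable_test r0 tphi).
    apply: measurable_if_pos => //.
    by apply: measurable_funB; apply: continuous_measurable_rV.
  apply: (bounded_cubes_le (bounded_cubesB (continuous_bounded_cubes (cp1 i))
    (continuous_bounded_cubes (cp2 i)))) => x.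
  by case: ifP => // _; rewrite normr0.
rewrite (_ : rint _ = rint (fun x => \sum_i (phi x * (if 0 < w1 x - w2 x then
    partial i (partial i w1) x - partial i (partial i w2) x else 0)))); last first.
  apply: eq_rint => x; rewrite -mulr_sumr; congr (_ * _).
  by case: ifP => _; [rewrite sumrB|rewrite big1].
rewrite rint_sum//; apply: ler_sum => i _.
exact: (kato_direction i r0 tphi c1 c2 m1 m2 b1 b2).
Qed.

End kato_space.

(** * Left Dini derivatives *)

Section dini.
Context {R : realType}.
Implicit Types U V : R -> R.

(* The upper left Dini derivative of [U] at [t] is at most [c]. *)
Definition dini_le U (t c : R) := forall e, 0 < e -> exists2 dl, 0 < dl &
  forall h, 0 < h -> h < dl -> U t - U (t - h) <= (c + e) * h.

(** Let [S] be the set of times in [[a, b]] from which the bound with slope [c + e] holds up to [b].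
    Continuity puts [inf S] into [S]; if it exceeded [a], the Dini bound there would extend the
    estimate further to the left. *)
Lemma dini_le_bound U a b c : a <= b ->
  (forall t, a < t -> t <= b -> dini_le U t c) ->
  (forall t, a <= t -> t <= b -> {for t, continuous U}) ->
  U b - U a <= c * (b - a).
Proof.
move=> ab dU cU; apply/ler_addgt0Pr => e0 e00.
pose e := e0 / (b - a + 1).
have ba1 : 0 < b - a + 1 by rewrite ltr_wpDl// subr_ge0.
have ep : 0 < e by rewrite divr_gt0.
suff H : U b - U a <= (c + e) * (b - a).
  apply: (le_trans H); rewrite mulrDl lerD2l /e -mulrA ler_piMr ?ltW//.
  by rewrite mulrC ltr_pdivrMr// mul1r ltrDl.
pose S := [set t | a <= t <= b /\ U b - U t <= (c + e) * (b - t)].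
have Sb : S b by rewrite /S/= lexx ab !subrr mulr0.
have hS : has_inf S by split; [exists b|exists a => t [/andP[]]].
have aI : a <= inf S by apply: lb_le_inf; [exists b|move=> t [/andP[]]].
have Ib : inf S <= b by apply: ge_inf => //; case: hS.
(* The set [S] is closed: failure at [inf S] would persist nearby, against points of [S] arbitrarily
   close to it. *)
have SI : U b - U (inf S) <= (c + e) * (b - inf S).
  rewrite leNgt; apply/negP => hlt.
  pose g t := U b - U t - (c + e) * (b - t).
  have cg : {for inf S, continuous g}.
    apply: cvgB; first by apply: cvgB; [exact: cvg_cst|exact: cU].
    apply: cvgM; first exact: cvg_cst.
    by apply: cvgB; [exact: cvg_cst|exact: cvg_id].
  have g0 : 0 < g (inf S) by rewrite subr_gt0.
  have /cvg_ballP/(_ _ g0)/nbhs_ballP[n /= n0 hn] := cg.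
  have [s Ss sI] := inf_adherent n0 hS.
  have Is : inf S <= s by apply: ge_inf => //; case: hS.
  have := hn s; rewrite /ball/= => /(_ _)/wrap[].
    by rewrite distrC ger0_norm ?subr_ge0// ltrBlDl.
  have : g s <= 0 by case: Ss => _; rewrite /g subr_le0.
  move=> gs; rewrite ger0_norm; last by rewrite subr_ge0 (le_trans gs)// ltW.
  by rewrite ltrBlDr ltrDl ltNge gs.
have [aI'|Ia] := ltP a (inf S); last first.
  by have -> : a = inf S by apply/eqP; rewrite eq_le aI Ia.
have [dl dl0 hd] := dU _ aI' Ib _ ep.
pose h := Num.min dl (inf S - a) / 2.
have mn0 : 0 < Num.min dl (inf S - a) by rewrite lt_min dl0 subr_gt0.
have [l1 l2] : Num.min dl (inf S - a) <= dl /\ Num.min dl (inf S - a) <= inf S - a.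
  by rewrite !ge_min !lexx orbT.
have h0 : 0 < h by rewrite divr_gt0.
have hh := hd h h0 ltac:(rewrite /h; lra).
have : S (inf S - h).
  split; first by apply/andP; split; rewrite /h; lra.
  have -> : (c + e) * (b - (inf S - h)) = (c + e) * (b - inf S) + (c + e) * h by ring.
  by move: SI hh; lra.
move=> /(ge_inf (proj2 hS)); lra.
Qed.

Lemma dini_le_mono U t c c' : c <= c' -> dini_le U t c -> dini_le U t c'.
Proof.
move=> cc' dU e e0; have [dl dl0 hd] := dU e e0; exists dl => // h h0 hdl.
by rewrite (le_trans (hd h h0 hdl))// ler_wpM2r ?(ltW h0)// lerD2r.
Qed.

Lemma is_derive_left (q : R -> R) (t q' e : R) : is_derive t 1 q q' -> 0 < e ->
  exists2 dl, 0 < dl & forall h, 0 < h -> h < dl ->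
    `|q t - q (t - h) - q' * h| <= e * h.
Proof.
move=> /is_derive1_caratheodory[g [hg cg gt]] e0.
have /cvg_ballP/(_ _ e0)/nbhs_ballP[n /= n0 hn] := cg.
exists n => // h h0 hlt.
have := hn (t - h); rewrite /ball/= opprB addrCA subrr addr0 => /(_ _)/wrap[].
  by rewrite ger0_norm// ltW.
have := hg (t - h); rewrite gt addrAC subrr add0r => E.
have -> : q t - q (t - h) - q' * h = (g (t - h) - q') * h.
  by rewrite -[q t - _]opprB E; ring.
by rewrite normrM (ger0_norm (ltW h0)) distrC => /ltW; apply: ler_wpM2r; exact: ltW.
Qed.

Lemma dini_leB U V (t c v' : R) : dini_le U t c -> is_derive t 1 V v' ->
  dini_le (fun s => U s - V s) t (c - v').
Proof.
move=> dU dV e e0; have e20 : 0 < e / 2 by rewrite divr_gt0.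
have [d1 d10 h1] := dU _ e20; have [d2 d20 h2] := is_derive_left dV e20.
exists (Num.min d1 d2); first by rewrite lt_min d10.
move=> h h0; rewrite lt_min => /andP[hd1 hd2].
have := h1 h h0 hd1; have := h2 h h0 hd2; rewrite ler_norml => /andP[+ _].
by lra.
Qed.

(** The Dini bound is one-sided, so it may be multiplied by [q t] because [0 <= q t]; the increment
    of [q] is controlled on both sides. [A] collects the coefficients of the error [e'], and
    [e' <= 1] gives [|U (t - h)| <= |U t| + 1]. *)
Lemma dini_leM U (q : R -> R) (t c q' : R) : dini_le U t c -> is_derive t 1 q q' ->
  {for t, continuous U} -> 0 <= q t ->
  dini_le (fun s => q s * U s) t (q t * c + q' * U t).
Proof.
move=> dU dq cU q0 e e0.
pose A := q t + `|U t| + `|q'| + 2.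
have A0 : 0 < A by rewrite ltr_wpDl// !addr_ge0.
pose e' := Num.min (e / A) 1.
have e'0 : 0 < e' by rewrite lt_min ltr01 divr_gt0.
have e'1 : e' <= 1 by rewrite /e' ge_min lexx orbT.
have e'A : e' * A <= e by rewrite -ler_pdivlMr// /e' ge_min lexx.
have [d1 d10 h1] := dU _ e'0; have [d2 d20 h2] := is_derive_left dq e'0.
have /cvg_ballP/(_ _ e'0)/nbhs_ballP[d3 /= d30 h3] := cU.
exists (Num.min d1 (Num.min d2 d3)); first by rewrite !lt_min d10 d20.
move=> h h0; rewrite !lt_min => /andP[hd1 /andP[hd2 hd3]].
have E1 := h1 h h0 hd1; have E2 := h2 h h0 hd2.
have E3 : `|U t - U (t - h)| < e'.
  have := h3 (t - h); rewrite /ball/= opprB addrCA subrr addr0; apply.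
  by rewrite ger0_norm// ltW.
have -> : q t * U t - q (t - h) * U (t - h) = q t * (U t - U (t - h)) +
  (q t - q (t - h) - q' * h) * U (t - h) + q' * h * (U (t - h) - U t) + q' * h * U t by ring.
have hh := ltW h0.
have T1 : q t * (U t - U (t - h)) <= q t * ((c + e') * h) by exact: ler_wpM2l.
have T2 : (q t - q (t - h) - q' * h) * U (t - h) <= e' * h * (`|U t| + 1).
  rewrite (le_trans (ler_norm _))// normrM ler_pM//.
  rewrite -[U (t - h)](subrK (U t)) addrC (le_trans (ler_normD _ _))// lerD2l.
  by rewrite distrC (le_trans (ltW E3)).
have T3 : q' * h * (U (t - h) - U t) <= `|q'| * h * e'.
  rewrite (le_trans (ler_norm _))// !normrM (ger0_norm hh) ler_wpM2l ?mulr_ge0//.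
  by rewrite distrC ltW.
have T4 : e' * A * h <= e * h by exact: ler_wpM2r.
have T5 : 0 <= e' * h by rewrite mulr_ge0// ltW.
rewrite /A in T4.
have -> : (q t * c + q' * U t + e) * h = q t * (c * h) + q' * h * U t + e * h by ring.
have : q t * ((c + e') * h) + e' * h * (`|U t| + 1) + `|q'| * h * e' =
  q t * (c * h) + e' * (q t + `|U t| + `|q'| + 2) * h - e' * h by ring.
move: T1 T2 T3 T4 T5; lra.
Qed.

End dini.

(** * Kato's inequality in time *)

Section kato_time.
Context {R : realType}.
Variable d : nat.
Variables (D m : R).
Hypotheses (D0 : 0 < D) (m0 : 0 < m).
Implicit Types (v : R -> 'rV[R]_d -> R) (phi : 'rV[R]_d -> R).

(** What [v], the zero function and a Barenblatt profile shifted in time have in common: the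
    equation at positive times, without mass or initial datum. Kato's inequality is stated for any
    two of these. *)
Record classical_solution v : Prop := ClassicalSolution {
  cls_ge0 : forall tau x, 0 < tau -> 0 <= v tau x ;
  cls_continuous : continuous_pos_time v ;
  cls_derivable_time : forall tau x, 0 < tau -> derivable (v ^~ x) tau 1 ;
  cls_continuous_time : continuous_pos_time (fun tau x => 'D_1 (v ^~ x) tau) ;
  cls_C2 : forall tau, 0 < tau -> C2 (powf v m tau) ;
  cls_equation : forall tau x, 0 < tau ->
    'D_1 (v ^~ x) tau = D * laplacian (powf v m tau) x }.

Lemma continuous_pos_time_slice v tau : 0 < tau -> continuous_pos_time v ->
  continuous (v tau).
Proof.
move=> t0 cv.
have H : continuous (fun y : 'rV[R]_d => (tau, y)).
  move=> x P /nbhs_ballP[e /= e0 hP]; apply/nbhs_ballP; exists e => //= y xy.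
  by apply: hP; split => //; exact: ballxx.
by move=> x; exact: (continuous_comp (H x) (cv tau x t0)).
Qed.

Lemma fde_classical (v0 : 'rV[R]_d -> R) v : fde_solution D m v0 v -> classical_solution v.
Proof.
move=> h; split.
- by move=> t x t0; apply: (fde_ge0 h); exact: ltW.
- exact: (fde_continuous h).
- by move=> t x; exact: (fde_derivable_time h).
- exact: (fde_continuous_time h).
- move=> t t0; split.
  + by move=> i x; exact: (fde_derivable_space h).
  + by move=> i x; exact: (fde_derivable2_space h).
  + by move=> i; exact: (@continuous_pos_time_slice (fun tau => partial i (partial i (powf v m tau)))
      t t0 (@fde_continuous2_space _ _ _ _ _ _ h i)).
- by move=> t x; exact: (fde_equation h).
Qed.

Lemma derive_cst0 (V W : normedModType R) (w : W) (a u : V) :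
  'D_u (fun _ : V => w) a = 0.
Proof. exact: derive_val. Qed.

(** With 0 as second solution the excess is [v] itself, so Kato's inequality becomes a bound on the
    growth of weighted integrals of [v]. *)
Lemma classical_solution0 : classical_solution (fun _ _ => 0).
Proof.
have pE tau : powf (fun _ (_ : 'rV[R]_d) => 0) m tau = fun=> 0.
  by apply/funext => x; rewrite /powf powR0// gt_eqF.
have p0 i : partial i (fun _ : 'rV[R]_d => 0 : R) = fun=> 0.
  by apply/funext => x; exact: derive_cst0.
split=> //.
- by move=> t x t0; exact: cvg_cst.
- move=> t x t0.
  rewrite (_ : (fun p => _) = fun=> 0); first exact: cvg_cst.
  by apply/funext => p; exact: derive_cst0.
- move=> t t0; rewrite pE; split=> [i x|i x|i]; rewrite ?p0.
  + exact: derivable_cst.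
  + exact: derivable_cst.
  + exact: cst_continuous.
- move=> t x t0; rewrite pE derive_cst0 /laplacian big1 ?mulr0// => i _.
  by rewrite !p0.
Qed.

Section slices.
Variable v : R -> 'rV[R]_d -> R.
Hypothesis cv : classical_solution v.

Lemma cls_slice tau : 0 < tau -> continuous (v tau).
Proof. by move=> t0; exact: continuous_pos_time_slice t0 (cls_continuous cv). Qed.

Lemma cls_measurable tau : 0 < tau -> measurable_fun setT (v tau).
Proof. by move=> t0; apply: continuous_measurable_rV; exact: cls_slice. Qed.

Lemma cls_bounded tau : 0 < tau -> bounded_cubes (v tau).
Proof. by move=> t0; apply: continuous_bounded_cubes; exact: cls_slice. Qed.

Lemma cls_pow_measurable tau : 0 < tau -> measurable_fun setT (powf v m tau).
Proof.
move=> t0; apply: (measurableT_comp (measurable_powR m)).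
exact: cls_measurable.
Qed.

Lemma cls_pow_bounded tau : 0 < tau -> bounded_cubes (powf v m tau).
Proof.
move=> t0 r; have [K K0 hK] := cls_bounded t0 r.
exists (K `^ m); first exact: powR_ge0.
move=> x hx; rewrite /powf ger0_norm ?powR_ge0//.
have v0 := cls_ge0 cv x t0.
apply: ge0_ler_powR; rewrite ?nnegrE//; first exact: ltW.
by rewrite (le_trans (ler_norm _))// hK.
Qed.

Lemma cls_MVT tau h x : 0 < h -> h < tau -> exists2 xi, `|xi - tau| <= h &
  v tau x - v (tau - h) x = h * 'D_1 (v ^~ x) xi.
Proof.
move=> h0 ht.
have tt : tau - h < tau by rewrite gtrBl.
have dv s : tau - h <= s -> is_derive s 1 (v ^~ x) ('D_1 (v ^~ x) s).
  move=> hs; apply/derivableP/(cls_derivable_time cv).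
  by apply: lt_le_trans hs; rewrite subr_gt0.
have [|| xi] := @MVT R (v ^~ x) (fun s => 'D_1 (v ^~ x) s) _ _ tt.
- by move=> s; rewrite in_itv/= => /andP[/ltW hs _]; exact: dv.
- apply: derivable_within_continuous => s; rewrite in_itv/= => /andP[hs _].
  exact: (@ex_derive _ _ _ _ _ _ _ (dv s hs)).
rewrite in_itv/= => /andP[x1 x2] ->.
exists xi; last by rewrite opprB addrCA subrr addr0 mulrC.
by rewrite ler_distl; apply/andP; split; lra.
Qed.

End slices.

Section two_solutions.
Variables (v1 v2 : R -> 'rV[R]_d -> R) (r : R) (phi : 'rV[R]_d -> R).
Hypotheses (cv1 : classical_solution v1) (cv2 : classical_solution v2).
Hypotheses (r0 : 0 <= r) (tphi : test_function r phi).

Definition excess tau x : R := Num.max (v1 tau x - v2 tau x) 0.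

Lemma excess_measurable tau : 0 < tau -> measurable_fun setT (excess tau).
Proof.
move=> t0; apply: measurable_maxr0.
by apply: measurable_funB; exact: cls_measurable.
Qed.

Lemma excess_bounded tau : 0 < tau -> bounded_cubes (excess tau).
Proof.
move=> t0; apply: (bounded_cubes_le
  (bounded_cubesB (cls_bounded cv1 t0) (cls_bounded cv2 t0))) => x.
exact: maxr0_le.
Qed.

Lemma rintegrable_excess tau : 0 < tau ->
  rintegrable (fun x => phi x * excess tau x).
Proof.
move=> t0; apply: (rintegrable_test r0 tphi); first exact: excess_measurable.
exact: excess_bounded.
Qed.

Lemma excess_dist s t x :
  `|excess s x - excess t x| <= `|v1 s x - v1 t x| + `|v2 s x - v2 t x|.
Proof.
apply: (@le_trans _ _ `|(v1 s x - v2 s x) - (v1 t x - v2 t x)|).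
  rewrite /excess; move: (v1 s x - v2 s x) (v1 t x - v2 t x) => a b.
  by case: (leP a 0) => ha; case: (leP b 0) => hb;
    rewrite ler_norml; apply/andP; split; case: (ger0P (a - b)); lra.
rewrite (_ : _ - _ - _ = (v1 s x - v1 t x) - (v2 s x - v2 t x)); last by ring.
exact: ler_normB.
Qed.

Lemma excess_continuous tau : 0 < tau ->
  {for tau, continuous (fun t => rint (fun x => phi x * excess t x))}.
Proof.
move=> t0; apply/cvg_ballP => e e0.
have [K K0 hK] := test_bounded tphi.
set V : R := (2 * r) ^+ d.
have V0 : 0 <= V by rewrite exprn_ge0// mulr_ge0.
pose e' := e / (K * 2 * V + 1).
have c0 : 0 < K * 2 * V + 1 by rewrite ltr_wpDl// !mulr_ge0.
have e'0 : 0 < e' by rewrite divr_gt0.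
have cK := @compact_cube R d 0 r.
have [d1 d10 h1] := compact_unif cK (fun x _ => @cls_continuous _ cv1 tau x t0) e'0.
have [d2 d20 h2] := compact_unif cK (fun x _ => @cls_continuous _ cv2 tau x t0) e'0.
apply/nbhs_ballP; exists (Num.min (Num.min d1 d2) tau) => /=.
  by rewrite !lt_min d10 d20.
move=> t; rewrite /ball/= !lt_min => /andP[/andP[ht1 ht2] ht3].
have tp : 0 < t by move: ht3; rewrite ltr_distl => /andP[]; lra.
rewrite distrC -rintB; [|exact: rintegrable_excess..].
have i1 := rintegrableB (rintegrable_excess tp) (rintegrable_excess t0).
apply: (le_lt_trans (le_normr_Rintegral _ i1)) => //.
have i2 : rintegrable (fun x => `|phi x * excess t x - phi x * excess tau x|).
  exact: (integrable_norm i1).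
have -> : e = e' * (K * 2 * V + 1) by rewrite /e' divfK// gt_eqF.
apply: (@le_lt_trans _ _ (K * (2 * e') * V)); last by rewrite -subr_gt0; lra.
apply: (le_rint_cube r0 i2) => x hx.
  by rewrite (test_vanish tphi)// !mul0r subr0 normr0.
rewrite -mulrBr normrM ler_pM// (le_trans (excess_dist _ _ _))//.
have z i : `|x ord0 i - x ord0 i| < d1 by rewrite subrr normr0.
have z' i : `|x ord0 i - x ord0 i| < d2 by rewrite subrr normr0.
have := h1 x hx t x ltac:(by rewrite distrC) z.
have := h2 x hx t x ltac:(by rewrite distrC) z'.
by lra.
Qed.

(** Where [v1 > v2] at [tau], the increment of the excess over [[tau - h, tau]] is at most that of
    [v1 - v2], which the mean value theorem and the equation compare with [h D] times the difference
    of the Laplacians, uniformly on the cube. Elsewhere the increment is at most 0. [kato_space] for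
    the powers then moves the Laplacian onto [phi]. *)
Lemma kato_time tau : 0 < tau ->
  dini_le (fun t => rint (fun x => phi x * excess t x)) tau
   (D * rint (fun x =>
     Num.max (powf v1 m tau x - powf v2 m tau x) 0 * laplacian phi x)).
Proof.
move=> t0 e e0.
have [K K0 hK] := test_bounded tphi.
set V : R := (2 * r) ^+ d.
have V0 : 0 <= V by rewrite exprn_ge0// mulr_ge0.
pose e' := e / (K * 2 * V + 1).
have c0 : 0 < K * 2 * V + 1 by rewrite ltr_wpDl// !mulr_ge0.
have e'0 : 0 < e' by rewrite divr_gt0.
have cK := @compact_cube R d 0 r.
have [d1 d10 h1] := compact_unif cK (fun x _ => @cls_continuous_time _ cv1 tau x t0) e'0.
have [d2 d20 h2] := compact_unif cK (fun x _ => @cls_continuous_time _ cv2 tau x t0) e'0.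
exists (Num.min (Num.min d1 d2) tau); first by rewrite !lt_min d10 d20.
move=> h h0; rewrite !lt_min => /andP[/andP[hd1 hd2] hd3].
have tp : 0 < tau - h by rewrite subr_gt0.
have he : 0 <= h * (2 * e') by apply: mulr_ge0; rewrite ltW// mulr_gt0.
have gen (a1 a2 b1 b2 D1 D2 l1 l2 : R) : a1 - b1 = h * D1 -> a2 - b2 = h * D2 ->
    `|D1 - D * l1| < e' -> `|D2 - D * l2| < e' ->
    a1 - a2 - Num.max (b1 - b2) 0 <= h * (D * (l1 - l2)) + h * (2 * e').
  rewrite !ltr_norml => E1 E2 /andP[_ G1] /andP[G2 _].
  have : b1 - b2 <= Num.max (b1 - b2) 0 by rewrite le_max lexx.
  have : h * (D1 - D2) <= h * (D * (l1 - l2) + 2 * e') by rewrite ler_pM2l//; lra.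
  by lra.
set w1 := powf v1 m tau; set w2 := powf v2 m tau.
have mw1 := cls_pow_measurable cv1 t0; have mw2 := cls_pow_measurable cv2 t0.
have bw1 := cls_pow_bounded cv1 t0; have bw2 := cls_pow_bounded cv2 t0.
have [_ _ cw1] := cls_C2 cv1 t0; have [_ _ cw2] := cls_C2 cv2 t0.
have KS := kato_space r0 tphi (cls_C2 cv1 t0) (cls_C2 cv2 t0) mw1 mw2 bw1 bw2.
rewrite -/w1 -/w2 in KS cw1 cw2 mw1 mw2 bw1 bw2.
pose P x := phi x * (if 0 < w1 x - w2 x then laplacian w1 x - laplacian w2 x else 0).
have iP : rintegrable P.
  apply: (rintegrable_test r0 tphi).
    apply: measurable_if_pos; first exact: measurable_funB.
    by apply: measurable_funB; apply: C2_laplacian; exact: cls_C2.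
  have blap (w : 'rV[R]_d -> R) : (forall i, continuous (partial i (partial i w))) ->
      bounded_cubes (laplacian w).
    move=> cw s.
    have /all_sig2[B B0 hB] := fun i => cid2 (continuous_bounded_cubes (cw i) s).
    exists (\sum_i B i); first by apply: sumr_ge0.
    move=> x hx; rewrite /laplacian (le_trans (ler_norm_sum _ _ _))// ler_sum// => i _.
    exact: hB.
  apply: (bounded_cubes_le (bounded_cubesB (blap w1 cw1) (blap w2 cw2))) => x.
  by case: ifP => // _; rewrite normr0.
rewrite -rintB; [|exact: rintegrable_excess..].
apply: (@le_trans _ _ (h * D * rint P + h * (2 * e') * K * V)).
  rewrite -rintZ// /V -(rint_cube (0 : 'rV[R]_d) r0).
  have ic := @rintegrable_cube R d 0 r r0.
  rewrite -rintZ// -rintD; [|exact: rintegrableZ..].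
  apply: le_rint.
  - by apply: rintegrableB; exact: rintegrable_excess.
  - by apply: rintegrableD; exact: rintegrableZ.
  move=> x; case: (pselect (cube 0 r x)) => hx; last first.
    rewrite /P (test_vanish tphi)// !mul0r subr0 mulr0 add0r.
    by rewrite indicE mulr_ge0// mulr_ge0.
  rewrite indicE mem_set// mulr1 /P.
  have p0 := test_ge0 tphi x.
  have pK : phi x <= K by rewrite (le_trans (ler_norm _)).
  (* [s |-> s ^ m] is strictly increasing, so the set selected by [kato_space] for the powers is the
     set where the excess is positive. *)
  have pw : (0 < w1 x - w2 x) = (0 < v1 tau x - v2 tau x).
    rewrite !subr_gt0 /w1 /w2 /powf.
    have a1 := cls_ge0 cv1 x t0; have a2 := cls_ge0 cv2 x t0.
    apply/idP/idP => [|hlt]; last by apply: gt0_ltr_powR; rewrite ?nnegrE.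
    rewrite !ltNge; apply: contra => hle.
    by apply: ge0_ler_powR; rewrite ?nnegrE ?(ltW m0).
  rewrite pw -mulrBr.
  have : excess tau x - excess (tau - h) x <=
    h * (D * (if 0 < v1 tau x - v2 tau x then laplacian w1 x - laplacian w2 x else 0))
    + h * (2 * e').
    rewrite /excess; case: ltP => hu; last first.
      by rewrite !mulr0 [leRHS]add0r (le_trans _ he)// sub0r oppr_le0 le_max lexx orbT.
    have [x1 hx1 E1] := cls_MVT cv1 x h0 hd3.
    have [x2 hx2 E2] := cls_MVT cv2 x h0 hd3.
    have z i : `|x ord0 i - x ord0 i| < d1 by rewrite subrr normr0.
    have z' i : `|x ord0 i - x ord0 i| < d2 by rewrite subrr normr0.
    have G1 := h1 x hx x1 x (le_lt_trans hx1 hd1) z.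
    have G2 := h2 x hx x2 x (le_lt_trans hx2 hd2) z'.
    rewrite (cls_equation cv1 x t0) -/w1 in G1.
    rewrite (cls_equation cv2 x t0) -/w2 in G2.
    exact: (gen _ _ _ _ _ _ _ _ E1 E2 G1 G2).
  move=> /(ler_wpM2l p0)/le_trans; apply.
  rewrite mulrDr; apply: lerD.
    by rewrite le_eqVlt; apply/orP; left; apply/eqP; ring.
  by rewrite mulrC ler_wpM2l// !mulr_ge0// ltW.
have -> : h * (2 * e') * K * V = h * (e' * (K * 2 * V)) by ring.
rewrite -mulrA -mulrDr mulrC ler_wpM2r ?(ltW h0)//; apply: lerD.
  by rewrite ler_pM2l.
rewrite /e' mulrAC ler_pdivrMr// ler_wpM2l ?(ltW e0)//.
by rewrite lerDl.
Qed.

End two_solutions.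
End kato_time.

(** * Radial test functions *)

Section continuity_pointwise.
Context {R : realType} {T : topologicalType}.
Implicit Types (f g : T -> R) (x : T).

Lemma continuous_at_add f g x : continuous_at x f -> continuous_at x g ->
  continuous_at x (fun y => f y + g y).
Proof. by move=> cf cg; exact: (@continuousD R R^o). Qed.

Lemma continuous_at_mul f g x : continuous_at x f -> continuous_at x g ->
  continuous_at x (fun y => f y * g y).
Proof. by move=> cf cg; exact: continuousM. Qed.

Lemma continuous_at_cst (k : R) x : continuous_at x (fun=> k).
Proof. exact: cst_continuous. Qed.

Lemma continuous_at_scale k f x : continuous_at x f ->
  continuous_at x (fun y => k * f y).
Proof. by move=> cf; apply: continuous_at_mul => //; exact: continuous_at_cst. Qed.

Lemma continuous_at_exp n f x : continuous_at x f ->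
  continuous_at x (fun y => f y ^+ n).
Proof.
move=> cf; elim: n => [|n IH].
  by under eq_fun do rewrite expr0; exact: continuous_at_cst.
by under eq_fun do rewrite exprS; exact: continuous_at_mul.
Qed.

Lemma continuous_at_comp (h : R -> R) f x : continuous_at (f x) h ->
  continuous_at x f -> continuous_at x (fun y => h (f y)).
Proof. by move=> ch cf; exact: (continuous_comp cf ch). Qed.

Lemma continuous_at_sum n (F : 'I_n -> T -> R) x :
  (forall i, continuous_at x (F i)) -> continuous_at x (fun y => \sum_i F i y).
Proof.
elim: n F => [|n IH] F hF.
  by under eq_fun do rewrite big_ord0; exact: continuous_at_cst.
under eq_fun do rewrite big_ord_recl.
by apply: continuous_at_add => //; apply: IH.
Qed.

End continuity_pointwise.

Section radial.
Context {R : realType}.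
Variable d : nat.

Notation ev i := (delta_mx ord0 i : 'rV[R]_d).

Lemma is_derive_of_line (f : 'rV[R]_d -> R) (x v : 'rV[R]_d) (a : R) :
  is_derive (0 : R) 1 (fun t : R => f (x + t *: v)) a -> is_derive x v f a.
Proof.
have E : (fun h : R => h^-1 *: ((f (x + (h *: 1 + 0) *: v)) - f (x + 0 *: v))) =
         (fun h : R => h^-1 *: (f (h *: v + x) - f x)).
  apply/funext => h; congr (_ *: (f _ - f _)); last by rewrite scale0r addr0.
  by rewrite addr0 [h *: 1]mulr1 addrC.
move=> [df <-]; apply: DeriveDef.
  by move: df; rewrite /derivable/= E.
by rewrite /derive/= E.
Qed.

Lemma normsq_ge0 (x : 'rV[R]_d) : 0 <= normsq x.
Proof. by apply: sumr_ge0 => i _; exact: sqr_ge0. Qed.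

Lemma normsq_line (x : 'rV[R]_d) i t :
  normsq (x + t *: ev i) = normsq x + (2 * x ord0 i) * t + t ^+ 2.
Proof.
rewrite /normsq (bigD1 i)//= [in RHS](bigD1 i)//= !mxE !eqxx mulr1.
rewrite (eq_bigr (fun j => x ord0 j ^+ 2)); first by ring.
by move=> j ji; rewrite !mxE (negbTE ji) andbF mulr0 addr0.
Qed.

Lemma normsqZ (k : R) (x : 'rV[R]_d) : normsq (k *: x) = k ^+ 2 * normsq x.
Proof. by rewrite /normsq mulr_sumr; apply: eq_bigr => i _; rewrite mxE exprMn. Qed.

Lemma continuous_normsq : continuous (@normsq R d).
Proof.
move=> x; apply: continuous_at_sum => i; apply: continuous_at_exp.
exact: coord_continuous.
Qed.

Lemma normsq_cube (x : 'rV[R]_d) r : 0 <= r -> normsq x <= r ^+ 2 -> cube 0 r x.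
Proof.
move=> r0 h i; rewrite mxE subr0.
rewrite -(ler_pXn2r (ltn0Sn 1)) ?nnegrE// real_normK ?num_real//.
by apply: le_trans h; rewrite /normsq (bigD1 i)//= lerDl sumr_ge0// => j _; exact: sqr_ge0.
Qed.

Lemma is_derive_normsq_line (x : 'rV[R]_d) i :
  is_derive (0 : R) 1 (fun t : R => normsq (x + t *: ev i)) (2 * x ord0 i).
Proof.
rewrite (_ : (fun _ => _) = fun t => normsq x + (2 * x ord0 i) * t + t ^+ 2); last first.
  by apply/funext => t; exact: normsq_line.
have := is_derive1_add (is_derive1_add (is_derive1_cst (normsq x) 0)
  (is_derive1_scale (2 * x ord0 i) (is_derive1_id 0))) (is_derive1_exp 2 (is_derive1_id 0)).
by rewrite mulr1 add0r expr1 mulr0 mul0r addr0.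
Qed.

Lemma is_derive_radial (g g' : R -> R) (x : 'rV[R]_d) i :
  is_derive (normsq x) 1 g (g' (normsq x)) ->
  is_derive x (ev i) (fun y => g (normsq y)) (g' (normsq x) * (2 * x ord0 i)).
Proof.
move=> dg; apply: is_derive_of_line.
apply: (is_derive1_chain (f := g) (g := fun t => normsq (x + t *: ev i))).
  by rewrite scale0r addr0.
exact: is_derive_normsq_line.
Qed.

Section radial_C2.
Variables (g g' g'' : R -> R).
Hypotheses (dg : forall s : R, 0 <= s -> is_derive s 1 g (g' s))
           (dg' : forall s : R, 0 <= s -> is_derive s 1 g' (g'' s))
           (cg'' : forall s : R, 0 <= s -> {for s, continuous g''}).

Let phi (x : 'rV[R]_d) := g (normsq x).

Lemma partial_radial i : partial i phi = fun x => g' (normsq x) * (2 * x ord0 i).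
Proof.
apply/funext => x.
by have := is_derive_radial i (dg (normsq_ge0 x)) => ?; exact: derive_val.
Qed.

Lemma is_derive2_radial i x : is_derive x (ev i) (partial i phi)
  (2 * g' (normsq x) + 4 * x ord0 i ^+ 2 * g'' (normsq x)).
Proof.
rewrite partial_radial; apply: is_derive_of_line.
have h1 : is_derive (0 : R) 1 (fun t : R => g' (normsq (x + t *: ev i)))
    (g'' (normsq x) * (2 * x ord0 i)).
  apply: (is_derive1_chain (f := g') (g := fun t => normsq (x + t *: ev i))).
    by rewrite scale0r addr0; apply: dg'; exact: normsq_ge0.
  exact: is_derive_normsq_line.
have h2 : is_derive (0 : R) 1 (fun t : R => 2 * (x + t *: ev i) ord0 i) (2 * (0 + 1)).
  rewrite (_ : (fun _ => _) = fun t : R => 2 * (x ord0 i + t)).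
    exact: (is_derive1_scale 2 (is_derive1_add (is_derive1_cst _ _) (is_derive1_id _))).
  by apply/funext => t; rewrite !mxE !eqxx mulr1.
have := is_derive1_mul h1 h2; rewrite scale0r addr0 add0r mulr1 => h.
by apply: is_derive_eq; ring.
Qed.

Lemma partial2_radial i : partial i (partial i phi) =
  fun x => 2 * g' (normsq x) + 4 * x ord0 i ^+ 2 * g'' (normsq x).
Proof.
by apply/funext => x; have := is_derive2_radial i x => ?; exact: derive_val.
Qed.

Lemma radial_C2 : C2 phi.
Proof.
split.
- by move=> i x; have [] := is_derive_radial i (dg (normsq_ge0 x)).
- by move=> i x; have [] := is_derive2_radial i x.
- move=> i; rewrite partial2_radial => x.
  have cn := @continuous_normsq x.
  apply: continuous_at_add.
    apply/continuous_at_scale/continuous_at_comp => //.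
    exact: is_derive1_continuous (dg' (normsq_ge0 x)).
  apply: continuous_at_mul.
    by apply/continuous_at_scale/continuous_at_exp; exact: coord_continuous.
  by apply: continuous_at_comp => //; apply: cg''; exact: normsq_ge0.
Qed.

Lemma laplacian_radial x :
  laplacian phi x = 2 * d%:R * g' (normsq x) + 4 * normsq x * g'' (normsq x).
Proof.
rewrite /laplacian; under eq_bigr do rewrite partial2_radial.
rewrite big_split/= sumr_const card_ord -mulr_suml -mulr_sumr.
by rewrite -[_ *+ d]mulr_natr mulrAC.
Qed.

Lemma radial_continuous : continuous phi.
Proof.
move=> x; apply: continuous_at_comp; last exact: continuous_normsq.
exact: is_derive1_continuous (dg (normsq_ge0 x)).
Qed.

Lemma radial_test r : 0 < r -> (forall s, 0 <= s -> 0 <= g s) ->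
  (forall s, r ^+ 2 <= s -> [/\ g s = 0, g' s = 0 & g'' s = 0]) ->
  test_function r phi.
Proof.
move=> r0 g0 gr.
have out (x : 'rV[R]_d) : ~ cube 0 r x -> r ^+ 2 <= normsq x.
  move=> hx; rewrite leNgt; apply/negP => h; apply: hx.
  by apply: normsq_cube; exact: ltW.
split.
- by move=> x; apply: g0; exact: normsq_ge0.
- exact: radial_continuous.
- exact: radial_C2.
- by move=> x /out/gr[].
- by move=> i x /out/gr[_ h1 h2]; rewrite partial2_radial h1 h2 !mulr0 addr0.
Qed.

End radial_C2.

End radial.

(** * The cutoff and the truncated moment *)

Section cutoff.
Context {R : realType}.
Variable d : nat.

Definition ramp (L s : R) : R := Num.max (1 - s / L) 0.

Lemma ramp_ge0 L s : 0 <= ramp L s.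
Proof. by rewrite le_max lexx orbT. Qed.

Lemma ramp_le1 L s : 0 < L -> 0 <= s -> ramp L s <= 1.
Proof.
by move=> L0 s0; rewrite ge_max ler01 andbT gerBl divr_ge0// ltW.
Qed.

Lemma ramp_out L s : 0 < L -> L <= s -> ramp L s = 0.
Proof.
by move=> L0 Ls; apply/max_idPr; rewrite subr_le0 ler_pdivlMr// mul1r.
Qed.

Lemma continuous_ramp L : continuous (ramp L).
Proof.
move=> s; have c1 : continuous_at s (fun s : R => 1 - s / L).
  apply: continuous_at_add; first exact: continuous_at_cst.
  have := @continuous_at_scale R R (- L^-1) id s (@cvg_id _ _).
  by under eq_fun do rewrite mulNr mulrC.
exact: (continuous_max c1 (@continuous_at_cst R R 0 s)).
Qed.

Lemma is_derive_maxX n (s : R) :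
  is_derive s 1 (fun s => Num.max s 0 ^+ n.+2) (n.+2%:R * Num.max s 0 ^+ n.+1).
Proof.
have [s0|s0|<-] := ltgtP 0 s.
- apply: (@near_eq_is_derive R R^o R^o (fun s => s ^+ n.+2)).
    apply/nbhs_ballP; exists s => //= t; rewrite /ball/= ltr_distlC => /andP[h _].
    by rewrite max_l//; move: h; rewrite subrr; exact: ltW.
  by have := is_derive1_exp n.+2 (is_derive1_id s); rewrite mulr1.
- apply: (@near_eq_is_derive R R^o R^o (fun s => 0)).
    apply/nbhs_ballP; exists (- s) => /= [|t]; first by rewrite oppr_gt0.
    rewrite /ball/= ltr_distlC => /andP[_ h].
    by rewrite max_r ?expr0n//; move: h; rewrite subrr; exact: ltW.
  by rewrite expr0n/= mulr0; exact: is_derive1_cst.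
(* At the kink the difference quotient is [max z 0 ^ (n + 1)], which is continuous with value 0: the
   Caratheodory slope. *)
- rewrite expr0n/= mulr0; apply/is_derive1_caratheodory.
  exists (fun z => Num.max z 0 ^+ n.+1); split.
  + move=> z; rewrite maxxx expr0n/= !subr0.
    by case: (leP z 0) => z0; rewrite ?expr0n/= ?mul0r// exprSr.
  + apply: continuous_at_exp.
    exact: (continuous_max (@cvg_id _ _) (@continuous_at_cst R R 0 0)).
  + by rewrite maxxx expr0n.
Qed.

Lemma is_derive_ramp L n (s : R) :
  is_derive s 1 (fun s => ramp L s ^+ n.+2) (- (n.+2%:R / L) * ramp L s ^+ n.+1).
Proof.
have h1 : is_derive s 1 (fun s => 1 - s / L) (0 - L^-1 * 1).
  rewrite (_ : (fun _ => _) = fun s => 1 - L^-1 * s); last first.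
    by apply/funext => t; rewrite mulrC.
  exact: (is_derive1_sub (is_derive1_cst _ _) (is_derive1_scale _ (is_derive1_id _))).
have := is_derive1_chain (g := fun s => 1 - s / L) (is_derive_maxX n (1 - s / L)) h1.
move=> h; apply: is_derive_eq.
by rewrite /ramp; ring.
Qed.

Let cut L s : R := ramp L s ^+ 3.
Let cut' L s : R := - (3 / L) * ramp L s ^+ 2.
Let cut'' L s : R := 6 / L ^+ 2 * ramp L s.

Let dcut L (s : R) : is_derive s 1 (cut L) (cut' L s).
Proof. exact: is_derive_ramp. Qed.

Let dcut' L (s : R) : is_derive s 1 (cut' L) (cut'' L s).
Proof.
have := is_derive1_scale (- (3 / L)) (is_derive_ramp L 0 s).
move=> h; apply: is_derive_eq; rewrite /cut'' expr1 -exprVn; ring.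
Qed.

Let ccut'' L (s : R) : {for s, continuous (cut'' L)}.
Proof. by apply: continuous_at_scale; exact: continuous_ramp. Qed.

(** The third power is the least natural power of the ramp that is twice continuously
    differentiable. Being a function of [|x|^2], it is also smooth enough at the origin. *)
Definition cutoff r (x : 'rV[R]_d) : R := ramp (r ^+ 2) (normsq x) ^+ 3.

Lemma cutoff_test r : 0 < r -> test_function r (cutoff r).
Proof.
move=> r0; apply: (@radial_test R d (cut (r ^+ 2)) (cut' (r ^+ 2)) (cut'' (r ^+ 2))) => //.
- by move=> s _; rewrite exprn_ge0 ?ramp_ge0.
- by move=> s rs; rewrite /cut /cut' /cut'' ramp_out ?exprn_gt0// !expr0n/= !mulr0.
Qed.

Lemma cutoff_le1 r x : 0 < r -> cutoff r x <= 1.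
Proof.
by move=> r0; rewrite exprn_ile1 ?ramp_ge0// ramp_le1 ?exprn_gt0// normsq_ge0.
Qed.

Let ramp_bound L s : 0 < L -> 0 <= s -> s < L -> 4 * s * (6 / L ^+ 2 * ramp L s) <= 24 / L.
Proof.
move=> L0 s0 sL.
have -> : 4 * s * (6 / L ^+ 2 * ramp L s) = 24 / L * ((s / L) * ramp L s).
  by rewrite expr2 invfM; ring.
have i0 : 0 <= L^-1 by rewrite invr_ge0 ltW.
apply: ler_piMr; first exact: mulr_ge0.
rewrite -[leRHS]mulr1; apply: ler_pM; rewrite ?ramp_ge0 ?ramp_le1//.
  exact: mulr_ge0.
by rewrite ler_pdivrMr// mul1r ltW.
Qed.

(** In [2 d g' + 4 s g''] the first term is nonpositive since the cutoff decreases. The second is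
    [4 s * 6 / r^4] times the ramp, with [s < r^2]: hence the 24. *)
Lemma laplacian_cutoff_le r x : 0 < r ->
  laplacian (cutoff r) x <= 24 / r ^+ 2 * \1_(cube 0 r) x.
Proof.
move=> r0; have r20 : 0 < r ^+ 2 by rewrite exprn_gt0.
rewrite (@laplacian_radial R d _ _ _ (fun s _ => dcut (r ^+ 2) s) (fun s _ => dcut' (r ^+ 2) s)).
have s0 := normsq_ge0 x.
have [rs|sr] := leP (r ^+ 2) (normsq x).
  rewrite /cut' /cut'' ramp_out// expr0n/= !mulr0 addr0.
  by apply: mulr_ge0; [rewrite divr_ge0// ltW|rewrite indicE].
rewrite indicE mem_set; last by apply: normsq_cube; exact: ltW.
rewrite mulr1 -[leRHS]add0r; apply: lerD; last exact: ramp_bound.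
rewrite /cut' mulNr mulrN oppr_le0 !mulr_ge0// ?exprn_ge0 ?ramp_ge0//.
by rewrite invr_ge0 ltW.
Qed.

(* A compactly supported truncation of |x|^2: its Laplacian stays below
   [2 d * moment_weight] up to an error vanishing as [r] tends to infinity. *)
Definition moment_test eps r (x : 'rV[R]_d) : R :=
  normsq x / (1 + eps * normsq x) * ramp (r ^+ 2) (normsq x) ^+ 3.

(** With [psi s = s / (1 + eps s)], this is [psi'] at [|x|^2] times the cutoff, the one term of the
    Laplacian of [moment_test] that has to be kept. *)
Definition moment_weight eps r (x : 'rV[R]_d) : R :=
  ramp (r ^+ 2) (normsq x) ^+ 3 / (1 + eps * normsq x) ^+ 2.

Section moment.
Variables (eps r : R).
Hypotheses (eps0 : 0 < eps) (r0 : 0 < r).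

Let q s : R := 1 + eps * s.
Let q0 s : 0 <= s -> 0 < q s.
Proof. by move=> s0; rewrite ltr_pwDl// mulr_ge0// ltW. Qed.
Let psi s : R := s / q s.
Let psi' s : R := (q s)^-1 ^+ 2.
Let psi'' s : R := - 2 * eps * (q s)^-1 ^+ 3.

Let dqV (s : R) : 0 <= s -> is_derive s 1 (fun s => (q s)^-1) (- eps * (q s)^-1 ^+ 2).
Proof.
move=> s0.
have dq : is_derive s 1 q eps.
  have := is_derive1_add (is_derive1_cst 1 s) (is_derive1_scale eps (is_derive1_id s)).
  by rewrite add0r mulr1.
have := is_deriveV (lt0r_neq0 (q0 s0)) dq => h.
by apply: is_derive_eq; rewrite /GRing.scale/= exprVn; ring.
Qed.

Let dpsi (s : R) : 0 <= s -> is_derive s 1 psi (psi' s).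
Proof.
move=> s0; have := is_derive1_mul (is_derive1_id s) (dqV s0) => h.
apply: is_derive_eq; rewrite /psi' /q.
field.
by rewrite lt0r_neq0// q0.
Qed.

Let dpsi' (s : R) : 0 <= s -> is_derive s 1 psi' (psi'' s).
Proof.
move=> s0; have := is_derive1_exp 2 (dqV s0) => h.
by apply: is_derive_eq; rewrite /psi''/= expr1; ring.
Qed.

Let cpsi'' (s : R) : 0 <= s -> {for s, continuous psi''}.
Proof.
move=> s0; apply/continuous_at_scale/continuous_at_exp.
exact: is_derive1_continuous (dqV s0).
Qed.

Let L := r ^+ 2.
Let L0 : 0 < L. Proof. by rewrite exprn_gt0. Qed.

Let g s := psi s * cut L s.
Let g' s := psi' s * cut L s + psi s * cut' L s.
Let g'' s := (psi'' s * cut L s + psi' s * cut' L s) + (psi' s * cut' L s + psi s * cut'' L s).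

Let dg (s : R) : 0 <= s -> is_derive s 1 g (g' s).
Proof. by move=> s0; exact: (is_derive1_mul (dpsi s0) (dcut L s)). Qed.

Let dg' (s : R) : 0 <= s -> is_derive s 1 g' (g'' s).
Proof.
move=> s0; exact: (is_derive1_add (is_derive1_mul (dpsi' s0) (dcut L s))
  (is_derive1_mul (dpsi s0) (dcut' L s))).
Qed.

Let cg'' (s : R) : 0 <= s -> {for s, continuous g''}.
Proof.
move=> s0.
have c1 := cpsi'' s0; have c2 := is_derive1_continuous (dpsi' s0).
have c3 := is_derive1_continuous (dpsi s0).
have c4 := is_derive1_continuous (dcut L s).
have c5 := is_derive1_continuous (dcut' L s).
have c6 := @ccut'' L s.
by apply: continuous_at_add; apply: continuous_at_add; apply: continuous_at_mul.
Qed.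

Lemma moment_test_test : test_function r (moment_test eps r).
Proof.
apply: (@radial_test R d g g' g'') => //.
- move=> s s0; rewrite mulr_ge0 ?exprn_ge0 ?ramp_ge0//.
  by rewrite divr_ge0// ltW// q0.
- move=> s rs; rewrite /g /g' /g'' /cut /cut' /cut'' ramp_out// !expr0n/= !mulr0.
  by rewrite !addr0.
Qed.

Lemma moment_weight_ge0 x : 0 <= moment_weight eps r x.
Proof.
by rewrite divr_ge0 ?exprn_ge0 ?ramp_ge0// ltW// q0// normsq_ge0.
Qed.

Let q1 (x : 'rV[R]_d) : 1 <= q (normsq x).
Proof. by rewrite lerDl mulr_ge0 ?normsq_ge0// ltW. Qed.

Lemma moment_weight_le1 x : moment_weight eps r x <= 1.
Proof.
have := q1 x; have := cutoff_le1 x r0; rewrite /cutoff /moment_weight -/(q _) => h1 h2.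
rewrite ler_pdivrMr ?exprn_gt0 ?q0 ?normsq_ge0// mul1r (le_trans h1)//.
by rewrite exprn_ege1.
Qed.

(** Concavity of [psi], as [s psi'(s) <= psi(s)]. It bounds the term in [|x|^2 v] of the tangent
    inequality by the truncated moment itself, which closes the Gronwall argument. *)
Lemma moment_weight_normsq x :
  moment_weight eps r x * normsq x <= moment_test eps r x.
Proof.
rewrite /moment_weight /moment_test -!/(q _).
rewrite mulrAC [leRHS]mulrAC [normsq x * _]mulrC ler_wpM2l//.
  by rewrite mulr_ge0 ?exprn_ge0 ?ramp_ge0// normsq_ge0.
rewrite lef_pV2 ?posrE ?exprn_gt0 ?q0 ?normsq_ge0//.
by rewrite expr2 ler_peMl ?q1// ltW// q0// normsq_ge0.
Qed.

Lemma moment_test_le x : moment_test eps r x <= normsq x.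
Proof.
rewrite /moment_test -/(q _) -mulrA ler_piMr ?normsq_ge0//.
rewrite mulrC ler_pdivrMr ?q0 ?normsq_ge0// mul1r.
exact: le_trans (cutoff_le1 x r0) (q1 x).
Qed.

(** This bound turns convergence in L^1 at time 0 into control of the truncated moment at small
    times. *)
Lemma moment_test_bound x : moment_test eps r x <= eps^-1.
Proof.
rewrite /moment_test -/(q _) -[leRHS]mulr1 ler_pM// ?exprn_ge0 ?ramp_ge0 ?cutoff_le1//.
  by rewrite divr_ge0 ?normsq_ge0// ltW// q0// normsq_ge0.
rewrite ler_pdivrMr ?q0 ?normsq_ge0// mulrDr mulr1 mulrA mulVf ?gt_eqF// mul1r.
by rewrite lerDr invr_ge0 ltW.
Qed.

(** Expand [2 d g' + 4 s g''] for [g] the product of [psi] and the cutoff. As [psi] is increasing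
    and concave and the cutoff decreasing, every term is nonpositive except [2 d psi' cut], which is
    kept, and [4 s psi cut''], where [psi <= eps^-1]. *)
Lemma laplacian_moment_le x : laplacian (moment_test eps r) x <=
  2 * d%:R * moment_weight eps r x + 24 / (eps * r ^+ 2) * \1_(cube 0 r) x.
Proof.
rewrite (@laplacian_radial R d _ _ _ dg dg').
have s0 := normsq_ge0 x; set s := normsq x in s0 *.
have [rs|sr] := leP (r ^+ 2) s.
  rewrite /g' /g'' /cut /cut' /cut'' /moment_weight -/s ramp_out// !expr0n/= !mulr0.
  rewrite !addr0 !mulr0 mul0r mulr0 !add0r.
  apply: mulr_ge0; last by rewrite indicE.
  by rewrite divr_ge0// mulr_ge0// ltW// exprn_gt0.
rewrite indicE mem_set; last by apply: normsq_cube; exact: ltW.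
rewrite mulr1 /moment_weight -/s -/(q s) -/(cut L s).
have M0 := ramp_ge0 L s.
have qs := q0 s0.
have i0 : 0 <= (q s)^-1 by rewrite invr_ge0 ltW.
have a1 : 0 <= cut L s by exact: exprn_ge0.
have a2 : cut' L s <= 0.
  by rewrite /cut' mulNr oppr_le0 mulr_ge0 ?exprn_ge0// divr_ge0// ltW.
have a3 : 0 <= psi s by rewrite divr_ge0// ltW.
have a4 : 0 <= psi' s by rewrite exprn_ge0.
have a5 : psi'' s <= 0.
  by rewrite /psi'' !mulNr oppr_le0 !mulr_ge0 ?exprn_ge0// ltW.
have a6 : psi s <= eps^-1.
  rewrite ler_pdivrMr// mulrDr mulr1 mulrA mulVf ?gt_eqF// mul1r.
  by rewrite lerDr invr_ge0 ltW.
have a7 : 4 * s * (psi s * cut'' L s) <= 24 / (eps * r ^+ 2).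
  have -> : 4 * s * (psi s * cut'' L s) = psi s * (4 * s * cut'' L s) by ring.
  have -> : 24 / (eps * r ^+ 2) = eps^-1 * (24 / L) by rewrite invfM mulrCA.
  apply: ler_pM => //; last exact: ramp_bound.
  apply: mulr_ge0; first exact: mulr_ge0.
  by rewrite mulr_ge0// divr_ge0// ltW// exprn_gt0.
have -> : cut L s / q s ^+ 2 = psi' s * cut L s by rewrite /psi' exprVn mulrC.
have b1 : psi s * cut' L s <= 0 by rewrite mulr_ge0_le0.
have b2 : psi'' s * cut L s <= 0 by rewrite mulr_le0_ge0.
have b3 : psi' s * cut' L s <= 0 by rewrite mulr_ge0_le0.
rewrite /g' /g''.
have c1 : 2 * d%:R * (psi s * cut' L s) <= 0 by rewrite mulr_ge0_le0.
have s40 : 0 <= 4 * s by rewrite mulr_ge0.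
have c2 : 4 * s * (psi'' s * cut L s) <= 0 by rewrite mulr_ge0_le0.
have c3 : 4 * s * (psi' s * cut' L s) <= 0 by rewrite mulr_ge0_le0.
by lra.
Qed.

End moment.

End cutoff.

(** * Barenblatt profiles *)

Section powR_pos.
Context {R : realType}.

Lemma gt0_powRD (x r s : R) : 0 < x -> x `^ (r + s) = x `^ r * x `^ s.
Proof. by move=> x0; rewrite powRD// (lt0r_neq0 x0) implybT. Qed.

Lemma gt0_powRB1 (x r : R) : 0 < x -> x `^ (r - 1) = x `^ r / x.
Proof. by move=> x0; rewrite gt0_powRD// powR_inv1// ltW. Qed.

End powR_pos.

(** * The tangent inequality for the concave power *)

Section tangent.
Context {R : realType}.
Variable m : R.
Hypotheses (m0 : 0 < m) (m1 : m < 1).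

(** Squaring [1 + x / 2 <= expR (x / 2)] leaves the surplus [(x / 2)^2], positive for [x != 0]. If
    [1 + x / 2 < 0], the left side is already negative. *)
Lemma expR_gt1D (x : R) : x != 0 -> 1 + x < expR x.
Proof.
move=> x0.
have e1 := expR_ge1Dx (x / 2).
have E : expR x = expR (x / 2) ^+ 2.
  by rewrite -expRM_natl; congr expR; lra.
have x20 : 0 < (x / 2) ^+ 2 by rewrite exprn_even_gt0// mulf_neq0// invr_neq0.
have [h|h] := leP 0 (1 + x / 2).
  rewrite E; apply: (@lt_le_trans _ _ ((1 + x / 2) ^+ 2)).
    by move: x20; rewrite !expr2; lra.
  by rewrite ler_pXn2r ?nnegrE// expR_ge0.
by apply: (@lt_trans _ _ 0); [lra|exact: expR_gt0].
Qed.

(* e^y >= e^x (1 + y - x) at y = x / m and y = 0, averaged with weights m, 1 - m *)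
Lemma powR_tangent1 (t : R) : 0 <= t -> t != 1 -> t `^ m < 1 - m + m * t.
Proof.
move=> t0 t1; have [->|tn0] := eqVneq t 0.
  by rewrite powR0 ?gt_eqF// mulr0 addr0 subr_gt0.
have tp : 0 < t by rewrite lt_neqAle eq_sym tn0.
pose x := m * ln t.
have lt0 : ln t != 0 by rewrite ln_eq0.
have x0 : x != 0 by rewrite mulf_neq0// gt_eqF.
have -> : t `^ m = expR x by rewrite /powR (negbTE tn0).
have tE : t = expR x * expR (ln t - x) by rewrite -expRD addrC subrK lnK.
have oE : 1 = expR x * expR (- x) by rewrite -expRD subrr expR0.
have h1 : 1 + (ln t - x) <= expR (ln t - x) by exact: expR_ge1Dx.
have h2 : 1 + (- x) < expR (- x) by apply: expR_gt1D; rewrite oppr_eq0.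
have e0 := expR_gt0 x.
suff : 1 < m * expR (ln t - x) + (1 - m) * expR (- x).
  rewrite -(ltr_pM2l e0) mulr1 => /lt_le_trans; apply.
  have -> : 1 - m + m * t = (1 - m) * (expR x * expR (- x)) + m * (expR x * expR (ln t - x)).
    by rewrite -tE -oE; ring.
  by rewrite le_eqVlt; apply/orP; left; apply/eqP; ring.
have a1 : m * (1 + (ln t - x)) <= m * expR (ln t - x) by rewrite ler_pM2l.
have a2 : (1 - m) * (1 + - x) < (1 - m) * expR (- x) by rewrite ltr_pM2l// subr_gt0.
have : m * (1 + (ln t - x)) + (1 - m) * (1 + - x) = 1 by rewrite /x; ring.
by lra.
Qed.

(** The height of the tangent at [B] above the graph of [s |-> s ^ m] at [v]: the Bregman distance
    of the concave power. *)
Definition gap (v B : R) : R := (1 - m) * B `^ m + m * B `^ (m - 1) * v - v `^ m.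

Lemma gap_gt0 v B : 0 <= v -> 0 < B -> v != B -> 0 < gap v B.
Proof.
move=> v0 B0 vB.
have Bm : 0 < B `^ m by exact: powR_gt0.
have t0 : 0 <= v / B by rewrite divr_ge0// ltW.
have t1 : v / B != 1 by rewrite -(inj_eq (mulIf (lt0r_neq0 B0))) divfK ?mul1r// gt_eqF.
have := powR_tangent1 t0 t1.
rewrite -(ltr_pM2l Bm) -powRM ?(ltW B0)//.
rewrite mulrC divfK ?gt_eqF// => h; rewrite /gap subr_gt0.
apply: (lt_le_trans h); rewrite mulrDr [B `^ m * (1 - m)]mulrC lerD2l.
rewrite gt0_powRB1//.
by rewrite le_eqVlt; apply/orP; left; apply/eqP; ring.
Qed.

Lemma gap_ge0 v B : 0 <= v -> 0 < B -> 0 <= gap v B.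
Proof.
move=> v0 B0; have [->|vB] := eqVneq v B; last exact/ltW/gap_gt0.
rewrite /gap subr_ge0 le_eqVlt; apply/orP; left; apply/eqP.
rewrite gt0_powRB1//.
by field; rewrite gt_eqF.
Qed.

Lemma powR_le_tangent v B : 0 <= v -> 0 < B ->
  v `^ m <= (1 - m) * B `^ m + m * B `^ (m - 1) * v.
Proof. by move=> v0 B0; have := gap_ge0 v0 B0; rewrite /gap subr_ge0. Qed.

(** When [g ^ (m - 1)] is affine in [|x|^2], the integrated tangent sees [f] only through its mass
    and its second moment. *)
Lemma rint_tangent d (f g : 'rV[R]_d -> R) (A a M J e e' : R) :
  (forall x, 0 <= f x) -> (forall x, 0 < g x) ->
  (forall x, g x `^ (m - 1) = A + a * normsq x) ->
  rintegrable f -> rintegrable (fun x => normsq x * f x) ->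
  rintegrable (fun x => f x `^ m) -> rintegrable (fun x => g x `^ m) ->
  rint f = M -> rint (fun x => normsq x * f x) = J ->
  rint (fun x => f x `^ m) = e -> rint (fun x => g x `^ m) = e' ->
  e <= (1 - m) * e' + m * (A * M + a * J).
Proof.
move=> f0 g0 gE i1 i2 j1 j2 <- <- <- <-.
have i3 := rintegrableZ A i1; have i4 := rintegrableZ a i2.
have i5 := rintegrableD i3 i4.
have p1 := rintegrableZ (1 - m) j2; have p2 := rintegrableZ m i5.
rewrite -(rintZ A i1) -(rintZ a i2) -(rintD i3 i4) -(rintZ m i5) -(rintZ (1 - m) j2).
rewrite -(rintD p1 p2); apply: (le_rint j1 (rintegrableD p1 p2)) => x.
apply: (le_trans (powR_le_tangent (f0 x) (g0 x))); rewrite lerD2l gE.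
by rewrite le_eqVlt; apply/orP; left; apply/eqP; ring.
Qed.

End tangent.

Lemma continuous_at_near_eq (R : realType) (T : topologicalType) (f g : T -> R) (x : T) :
  (\forall y \near x, f y = g y) -> continuous_at x f -> continuous_at x g.
Proof.
move=> fg cf; rewrite /continuous_at -(nbhs_singleton fg).
by apply: cvg_trans cf; exact: near_eq_cvg.
Qed.

(** * The Barenblatt profile solves the equation *)

Section barenblatt_solution.
Context {R : realType}.
Variable d : nat.
Variables (D m C : R).
Hypotheses (d1 : (1 <= d)%N) (D0 : 0 < D) (hm1 : m_one R d < m) (hm : m < 1).
Hypothesis C0 : 0 < C.

Notation al := (alpha R d m).
Notation B := (barenblatt D m C : R -> 'rV[R]_d -> R).

Let dR0 : 0 < d%:R :> R. Proof. by rewrite ltr0n. Qed.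

Lemma m_gt0 : 0 < m.
Proof.
apply: le_lt_trans hm1; rewrite /m_one divr_ge0// ?ler0n// subr_ge0.
by rewrite ler1n.
Qed.

Lemma dm_lt1 : d%:R * (1 - m) < 1.
Proof.
have : (d%:R - 1) < m * d%:R by rewrite -ltr_pdivrMr.
by lra.
Qed.

Lemma alphaV : al^-1 = 2 - d%:R * (1 - m).
Proof.
rewrite /alpha invrK /m_crit mulrBr mulrCA divff ?gt_eqF// mulr1; ring.
Qed.

Lemma alphaV_gt0 : 0 < al^-1.
Proof. by rewrite alphaV; have := dm_lt1; lra. Qed.

Lemma alpha_gt0 : 0 < al.
Proof. by rewrite -invr_gt0 alphaV_gt0. Qed.

Lemma alpha_eq : al * (2 - d%:R * (1 - m)) = 1.
Proof. by rewrite -alphaV divff// gt_eqF// alpha_gt0. Qed.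

Lemma alpha_eq2 : 2 * al - 1 = d%:R * (1 - m) * al.
Proof. by have := alpha_eq; lra. Qed.

Let m0 := m_gt0.
Let al0 := alpha_gt0.

Let c : R := (1 - m) / (2 * m).
Let c0 : 0 < c.
Proof. by rewrite divr_gt0 ?mulr_gt0 ?subr_gt0. Qed.

Let k : R := (m - 1)^-1.

Let theta t := D * t / al.
Let theta0 t : 0 < t -> 0 < theta t.
Proof. by move=> t0; rewrite divr_gt0// mulr_gt0. Qed.

Let rho t := scale d m (D * t).
Let rhoE t : rho t = theta t `^ al. Proof. by []. Qed.
Let rho0 t : 0 < t -> 0 < rho t.
Proof. by move=> t0; rewrite rhoE powR_gt0// theta0. Qed.

Let base t s := C + c * ((rho t)^-1 ^+ 2 * s).

Let base0 t s : 0 <= s -> 0 < base t s.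
Proof.
move=> s0; rewrite ltr_pwDl// mulr_ge0 ?(ltW c0)// mulr_ge0//.
exact: sqr_ge0.
Qed.

Let BE t x : B t x = (rho t ^+ d)^-1 * base t (normsq x) `^ k.
Proof. by rewrite /barenblatt normsqZ. Qed.

Lemma barenblatt_gt0 t x : 0 < t -> 0 < B t x.
Proof.
move=> t0; rewrite BE mulr_gt0 ?invr_gt0 ?exprn_gt0 ?rho0//.
by rewrite powR_gt0// base0// normsq_ge0.
Qed.

Let rho_pow t x : 0 < t -> rho t `^ x = theta t `^ (al * x).
Proof. by move=> t0; rewrite rhoE -powRrM. Qed.

Let rho_expn t n : 0 < t -> rho t ^+ n = theta t `^ (al * n%:R).
Proof. by move=> t0; rewrite -powR_mulrn ?rho_pow// ltW// rho0. Qed.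

Let rho_expV t n : 0 < t -> (rho t ^+ n)^-1 = theta t `^ (- (al * n%:R)).
Proof. by move=> t0; rewrite rho_expn// powRN. Qed.

Let thetaV t : 0 < t -> theta t `^ (-1) = al / (D * t).
Proof. by move=> t0; rewrite powR_inv1 ?ltW ?theta0// invf_div. Qed.

(** Both sides are powers of [theta t]; the exponents agree by [alpha (2 - d (1 - m)) = 1], the
    condition that fixes [alpha]. *)
Let pflux t : 0 < t ->
  ((rho t ^+ d)^-1) `^ m * (rho t)^-1 ^+ 2 = (rho t ^+ d)^-1 * (al / (D * t)).
Proof.
move=> t0; have th := theta0 t0.
rewrite exprVn !rho_expV// -powRrM -thetaV// -!gt0_powRD//.
congr (_ `^ _); have := alpha_eq; lra.
Qed.

Let kN0 : m - 1 != 0.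
Proof. by rewrite subr_eq0 lt_eqF. Qed.

Let km : k * m - 1 = k.
Proof. by rewrite /k; field. Qed.

Let kmc : k * m * c = - 2^-1.
Proof. by rewrite /k /c; field; rewrite kN0 gt_eqF. Qed.

Let pB t s := ((rho t ^+ d)^-1) `^ m * base t s `^ (k * m).
Let pB' t s := - 2^-1 * (((rho t ^+ d)^-1) `^ m * (rho t)^-1 ^+ 2) * base t s `^ k.
Let pB'' t s := - 2^-1 * (((rho t ^+ d)^-1) `^ m * (rho t)^-1 ^+ 2) *
  (k * base t s `^ (k - 1) * (c * (rho t)^-1 ^+ 2)).

Let powB t : 0 < t -> powf B m t = fun x => pB t (normsq x).
Proof.
move=> t0; apply/funext => x; rewrite /powf BE /pB powRM ?powR_ge0//.
  by rewrite -powRrM.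
by rewrite invr_ge0 exprn_ge0// ltW// rho0.
Qed.

Let dbase t (s : R) : is_derive s 1 (base t) (c * (rho t)^-1 ^+ 2).
Proof.
have := is_derive1_add (is_derive1_cst C s)
  (is_derive1_scale c (is_derive1_scale ((rho t)^-1 ^+ 2) (is_derive1_id s))).
by rewrite add0r mulr1.
Qed.

Let dpow_base t a (s : R) : 0 <= s ->
  is_derive s 1 (fun s => base t s `^ a) (a * base t s `^ (a - 1) * (c * (rho t)^-1 ^+ 2)).
Proof.
move=> s0; apply: (is_derive1_chain (f := fun y => y `^ a) _ (dbase t s)).
exact: is_derive1_powR (base0 t s0).
Qed.

Let dpB t (s : R) : 0 <= s -> is_derive s 1 (pB t) (pB' t s).
Proof.
move=> s0; have := is_derive1_scale ((rho t ^+ d)^-1 `^ m) (dpow_base t (k * m) s0).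
rewrite km => h; apply: is_derive_eq; rewrite /pB'.
by rewrite -kmc; ring.
Qed.

Let dpB' t (s : R) : 0 <= s -> is_derive s 1 (pB' t) (pB'' t s).
Proof. by move=> s0; exact: is_derive1_scale (dpow_base t k s0). Qed.

Let cpow_base t a (s : R) : 0 <= s -> continuous_at s (fun s => base t s `^ a).
Proof. by move=> s0; exact: is_derive1_continuous (dpow_base t a s0). Qed.

Let cpB'' t (s : R) : 0 <= s -> {for s, continuous (pB'' t)}.
Proof.
move=> s0; apply: continuous_at_scale; apply: continuous_at_mul.
  by apply: continuous_at_scale; exact: cpow_base.
exact: continuous_at_cst.
Qed.

(** This is [- (alpha / t) div (x B)], the common value of the time derivative of [B] and of [D]
    times the Laplacian of [B ^ m]. *)
Let flow t s := - (al / t) * (rho t ^+ d)^-1 *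
  (d%:R * base t s `^ k + 2 * s * (k * base t s `^ (k - 1) * (c * (rho t)^-1 ^+ 2))).

Let laplacian_powB t x : 0 < t -> D * laplacian (powf B m t) x = flow t (normsq x).
Proof.
move=> t0; rewrite powB// (@laplacian_radial R d _ _ _ (dpB t) (dpB' t)).
rewrite /pB' /pB'' pflux// /flow; field.
by rewrite !gt_eqF// ?exprn_gt0 ?rho0.
Qed.

Let drho (t : R) : 0 < t -> is_derive t 1 rho (rho t * (al / t)).
Proof.
move=> t0.
have h1 : is_derive t 1 theta (D / al).
  rewrite (_ : theta = fun t => D / al * t); last first.
    by apply/funext => s; rewrite /theta mulrAC.
  by have := is_derive1_scale (D / al) (is_derive1_id t); rewrite mulr1.
have := is_derive1_chain (f := fun y => y `^ al) (is_derive1_powR al (theta0 t0)) h1.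
move=> h; apply: is_derive_eq.
rewrite rhoE (gt0_powRB1 _ (theta0 t0)) /theta.
by field; rewrite !gt_eqF.
Qed.

Let drhoV (t : R) n : 0 < t ->
  is_derive t 1 (fun t => (rho t)^-1 ^+ n) (- n%:R * (al / t) * (rho t)^-1 ^+ n).
Proof.
move=> t0; have rn0 : rho t != 0 by rewrite gt_eqF// rho0.
have h := is_derive1_exp n (is_deriveV rn0 (drho t0)).
apply: is_derive_eq; case: n h => [|n] _.
  by rewrite !mulr0n !mul0r oppr0 !mul0r.
rewrite /= [in RHS]exprS /GRing.scale/= exprVn; field.
by rewrite expf_neq0 ?rn0 ?gt_eqF.
Qed.

Let dB (t : R) x : 0 < t -> is_derive t 1 (B ^~ x) (flow t (normsq x)).
Proof.
move=> t0; set s := normsq x.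
have s0 : 0 <= s by exact: normsq_ge0.
rewrite (_ : B ^~ x = fun t => (rho t)^-1 ^+ d * base t s `^ k); last first.
  by apply/funext => u; rewrite BE exprVn.
have h1 : is_derive t 1 (fun t => base t s) (0 + c * (- 2 * (al / t) * (rho t)^-1 ^+ 2 * s + (rho t)^-1 ^+ 2 * 0)).
  exact: (is_derive1_add (is_derive1_cst C t) (is_derive1_scale c
    (is_derive1_mul (drhoV 2 t0) (is_derive1_cst s t)))).
have h2 := is_derive1_chain (f := fun y => y `^ k) (g := fun t => base t s) (is_derive1_powR k (base0 t s0)) h1.
have h := is_derive1_mul (drhoV d t0) h2.
by apply: is_derive_eq; rewrite /flow -exprVn; ring.
Qed.

Let ct_rho (p : R * 'rV[R]_d) : 0 < p.1 -> continuous_at p (fun p => (rho p.1)^-1).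
Proof.
move=> t0; have rn0 : rho p.1 != 0 by rewrite gt_eqF// rho0.
have h := is_derive1_continuous (is_deriveV rn0 (drho t0)).
exact: (continuous_at_comp h (@cvg_fst _ _ _ _ _)).
Qed.

Let ct_base (p : R * 'rV[R]_d) : 0 < p.1 ->
  continuous_at p (fun p => base p.1 (normsq p.2)).
Proof.
move=> t0; apply: continuous_at_add; first exact: continuous_at_cst.
apply: continuous_at_scale; apply: continuous_at_mul.
  by apply: continuous_at_exp; exact: ct_rho.
apply: (@continuous_comp _ _ _ snd (@normsq R d)); first exact: cvg_snd.
exact: continuous_normsq.
Qed.

Let ct_pow_base a (p : R * 'rV[R]_d) : 0 < p.1 ->
  continuous_at p (fun p => base p.1 (normsq p.2) `^ a).
Proof.
move=> t0; apply: (continuous_at_comp (h := fun y => y `^ a)); last exact: ct_base.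
exact: is_derive1_continuous (is_derive1_powR a (base0 p.1 (normsq_ge0 p.2))).
Qed.

Let ct_snd (p : R * 'rV[R]_d) : continuous_at p (fun p => normsq p.2).
Proof.
apply: (@continuous_comp _ _ _ snd (@normsq R d)); first exact: cvg_snd.
exact: continuous_normsq.
Qed.

Lemma barenblatt_continuous t x : 0 < t ->
  {for (t, x), continuous (fun p : R * 'rV[R]_d => B p.1 p.2)}.
Proof.
move=> t0.
rewrite (_ : (fun p : R * 'rV[R]_d => _) =
   fun p => (rho p.1)^-1 ^+ d * base p.1 (normsq p.2) `^ k); last first.
  by apply/funext => p; rewrite BE exprVn.
apply: continuous_at_mul; last exact: ct_pow_base.
by apply: continuous_at_exp; exact: ct_rho.
Qed.

Let flow_continuous t x : 0 < t ->
  {for (t, x), continuous (fun p : R * 'rV[R]_d => flow p.1 (normsq p.2))}.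
Proof.
move=> t0.
rewrite (_ : (fun p : R * 'rV[R]_d => _) =
   fun p => (- al * p.1^-1 * (rho p.1)^-1 ^+ d) *
  (d%:R * base p.1 (normsq p.2) `^ k + (2 * normsq p.2) *
   (k * base p.1 (normsq p.2) `^ (k - 1) * (c * (rho p.1)^-1 ^+ 2)))); last first.
  by apply/funext => p; rewrite /flow -exprVn; ring.
have cV : continuous_at (t, x) (fun p : R * 'rV[R]_d => p.1^-1).
  apply: (continuous_at_comp (h := GRing.inv)); last exact: cvg_fst.
  by apply: inv_continuous; rewrite /= gt_eqF.
have c1 := @ct_rho (t, x) t0.
apply: continuous_at_mul; first apply: continuous_at_mul.
- exact: continuous_at_scale.
- exact: continuous_at_exp.
apply: continuous_at_add; first by apply: continuous_at_scale; exact: ct_pow_base.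
apply: continuous_at_mul; first by apply: continuous_at_scale; exact: ct_snd.
apply: continuous_at_mul; first by apply: continuous_at_scale; exact: ct_pow_base.
by apply: continuous_at_scale; exact: continuous_at_exp.
Qed.

Lemma continuous_shift_time (F : R -> 'rV[R]_d -> R) t0 t x :
  {for (t + t0, x), continuous (fun p : R * 'rV[R]_d => F p.1 p.2)} ->
  {for (t, x), continuous (fun p : R * 'rV[R]_d => F (p.1 + t0) p.2)}.
Proof.
move=> cF.
apply: (@continuous_comp _ _ _ (fun p : R * 'rV[R]_d => (p.1 + t0, p.2))
  (fun p => F p.1 p.2)) => //.
move=> P /nbhs_ballP[e /= e0 hP]; apply/nbhs_ballP; exists e => //= -[s y] [/= h1 h2].
apply: hP; split => //=; move: h1; rewrite /ball/=.
by rewrite opprD addrACA subrr addr0.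
Qed.

Lemma barenblatt_classical t0 : 0 <= t0 ->
  classical_solution D m (fun t => B (t + t0)).
Proof.
move=> t00.
have pos (t : R) : 0 < t -> 0 < t + t0 by move=> t_; rewrite ltr_pwDl.
have dBt (t : R) (x : 'rV[R]_d) : 0 < t -> is_derive t 1 (fun s => B (s + t0) x) (flow (t + t0) (normsq x)).
  move=> /pos t_; rewrite (_ : (fun s => _) = fun s => B (t0 + s) x); last first.
    by apply/funext => s; rewrite addrC.
  by apply: (@is_derive1_shift R (B ^~ x)); rewrite addrC; exact: dB.
split.
- by move=> t x t_; rewrite ltW// barenblatt_gt0// pos.
- by move=> t x t_; apply: continuous_shift_time; apply: barenblatt_continuous; exact: pos.
- by move=> t x t_; have [] := dBt t x t_.
- move=> t x t_.
  apply: (@continuous_at_near_eq _ _ (fun p : R * 'rV[R]_d => flow (p.1 + t0) (normsq p.2))).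
    apply/nbhs_ballP; exists t => //= -[s y] [/= h1 _].
    have hs : 0 < s by move: h1; rewrite /ball/= ltr_distlC => /andP[]; rewrite subrr.
    by have [_ ->] := dBt s y hs.
  exact: (continuous_shift_time (F := fun t x => flow t (normsq x))
    (@flow_continuous (t + t0) x (pos _ t_))).
- move=> t t_; rewrite [powf _ _ _](_ : _ = powf B m (t + t0))// powB ?pos//.
  exact: radial_C2 (dpB _) (dpB' _) (@cpB'' _).
- move=> t x t_; have [_ ->] := dBt t x t_.
  by rewrite -laplacian_powB// pos.
Qed.

Lemma barenblatt_measurable t : 0 < t -> measurable_fun setT (B t).
Proof.
move=> t0; have := cls_measurable (barenblatt_classical (lexx 0)) t0.
by rewrite addr0.
Qed.

(** [bar_const] and [bar_slope] are the two coefficients of the pressure [B ^ (m - 1)], which is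
    affine in [|x|^2]. *)
Definition bar_const t := C * theta t `^ (2 * al - 1).
Definition bar_slope t := c * (al / (D * t)).

Lemma barenblatt_pow t x : 0 < t ->
  B t x `^ (m - 1) = bar_const t + bar_slope t * normsq x.
Proof.
move=> t0; have th := theta0 t0; rewrite BE powRM ?powR_ge0//; last first.
  by rewrite invr_ge0 exprn_ge0// ltW// rho0.
rewrite -powRrM mulVf// powRr1; last by rewrite ltW// base0// normsq_ge0.
rewrite rho_expV// -powRrM /base mulrDr mulrC /bar_const /bar_slope; congr (_ + _).
  by congr (_ * _ `^ _); rewrite alpha_eq2; ring.
rewrite -thetaV// exprVn rho_expV//.
rewrite mulrCA -mulrA; congr (_ * _); rewrite mulrA -gt0_powRD//.
by congr (_ `^ _ * _); have := alpha_eq; lra.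
Qed.

Lemma barenblatt_powm t x : 0 < t ->
  B t x `^ m = bar_const t * B t x + bar_slope t * (normsq x * B t x).
Proof.
move=> t0; have B0 := barenblatt_gt0 x t0.
have -> : B t x `^ m = B t x `^ (m - 1) * B t x by rewrite gt0_powRB1// divfK// gt_eqF.
by rewrite barenblatt_pow//; ring.
Qed.

Lemma bar_const_gt0 t : 0 < t -> 0 < bar_const t.
Proof. by move=> t0; rewrite mulr_gt0// powR_gt0// theta0. Qed.

Lemma bar_slope_gt0 t : 0 < t -> 0 < bar_slope t.
Proof. by move=> t0; rewrite mulr_gt0// divr_gt0// mulr_gt0. Qed.

Lemma bar_constE t : 0 < t -> bar_const t = bar_const 1 * t `^ (2 * al - 1).
Proof.
move=> t0; rewrite /bar_const -mulrA -powRM ?ltW ?theta0//.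
by congr (_ * _ `^ _); rewrite /theta; ring.
Qed.

Lemma bar_slopeE t : 0 < t -> bar_slope t = bar_slope 1 / t.
Proof. by move=> t0; rewrite /bar_slope mulr1 invfM -!mulrA. Qed.

(** The left side is the coefficient of the moment in the differential inequality; this identity is
    the origin of the exponent [p = 2 alpha - 1]. *)
Lemma bar_slope_rate t : 0 < t ->
  2 * d%:R * D * m * bar_slope t = (2 * al - 1) / t.
Proof.
move=> t0; rewrite alpha_eq2 /bar_slope /c; field.
by rewrite !gt_eqF.
Qed.

Lemma barenblatt_scaling t x : 0 < t ->
  B t (t `^ al *: x) = ((t `^ al) ^+ d)^-1 * B 1 x.
Proof.
move=> t0; have ta0 : 0 < t `^ al by exact: powR_gt0.
have rE : rho t = t `^ al * rho 1.
  rewrite !rhoE -powRM ?ltW ?theta0//; congr (_ `^ _); rewrite /theta; ring.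
rewrite !BE rE exprMn invfM mulrA; congr (_ * _ `^ _).
rewrite /base normsqZ rE; congr (_ + _ * _).
rewrite invfM exprMn; field.
by rewrite !gt_eqF// rho0.
Qed.

(** Substitute [x = t^alpha y]. The identity is one of extended reals because the moment may be
    infinite, for instance when [d = 1] and [m <= 1/3]. *)
Lemma barenblatt_second_moment t : 0 < t ->
  second_moment (B t) = (second_moment (B 1%R) * (t `^ (2 * al))%:E)%E.
Proof.
move=> t0; have ta0 : 0 < t `^ al by exact: powR_gt0.
have mf s : 0 < s -> measurable_fun setT (fun x : 'rV[R]_d => (normsq x * B s x)%:E).
  move=> s0; apply/measurable_EFinP; apply: measurable_funM.
    exact: continuous_measurable_rV (@continuous_normsq R d).
  exact: barenblatt_measurable.
have f0 s x : 0 < s -> (0 <= (normsq x * B s x)%:E)%E.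
  by move=> s0; rewrite lee_fin mulr_ge0 ?normsq_ge0// ltW// barenblatt_gt0.
have E := @ge0_integral_affine R d (t `^ al) (0 : 'rV[R]_d)
  (fun x => (normsq x * B t x)%:E) ta0 (mf _ t0) (fun x => f0 t x t0).
rewrite /second_moment [LHS]E.
pose K := (t `^ al) ^+ 2 / (t `^ al) ^+ d.
have tad : 0 < (t `^ al) ^+ d by rewrite exprn_gt0.
have K0 : 0 <= K by rewrite divr_ge0 ?sqr_ge0// ltW.
have -> : (\int[lebesgue_rV d]_x
    (normsq ((t `^ al) *: x + 0) * B t ((t `^ al) *: x + 0))%:E =
    \int[lebesgue_rV d]_x (K%:E * (normsq x * B 1%R x)%:E))%E.
  apply: eq_integral => x _; rewrite addr0 barenblatt_scaling// normsqZ -EFinM.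
  by congr EFin; rewrite /K; ring.
rewrite ge0_integralZl_EFin//; last 2 first.
- by move=> x _; exact: f0.
- exact: mf.
rewrite muleA -EFinM muleC; congr (_ * _%:E)%E.
rewrite /K mulrCA divff ?gt_eqF// mulr1.
by rewrite -powR_mulrn ?powR_ge0// -powRrM mulrC.
Qed.

(** * Energy of the profile and the virial identity *)

Section energy.
Variables (M J1 : R).
Hypothesis hM : forall t, 0 < t -> (\int[lebesgue_rV d]_x (B t x)%:E = M%:E)%E.
Hypothesis hJ : (second_moment (B 1) = J1%:E).

Definition bar_moment t := J1 * t `^ (2 * al).

Lemma second_moment_bar t : 0 < t -> second_moment (B t) = (bar_moment t)%:E.
Proof. by move=> t0; rewrite barenblatt_second_moment// hJ. Qed.

Lemma rintegrable_bar t : 0 < t -> rintegrable (B t).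
Proof.
move=> t0; apply: (@rintegrable_ge0 R d _ M); last exact: hM.
  exact: barenblatt_measurable.
by move=> x; rewrite ltW// barenblatt_gt0.
Qed.

Lemma rint_bar t : 0 < t -> rint (B t) = M.
Proof. by move=> t0; rewrite /rint /Rintegral hM. Qed.

Lemma rintegrable_bar_moment t : 0 < t -> rintegrable (fun x => normsq x * B t x).
Proof.
move=> t0; apply: (@rintegrable_ge0 R d _ (bar_moment t)); last exact: second_moment_bar.
  apply: measurable_funM; first exact: continuous_measurable_rV (@continuous_normsq R d).
  exact: barenblatt_measurable.
by move=> x; rewrite mulr_ge0 ?normsq_ge0// ltW// barenblatt_gt0.
Qed.

Lemma rint_bar_moment t : 0 < t -> rint (fun x => normsq x * B t x) = bar_moment t.
Proof. by move=> t0; rewrite /rint /Rintegral [X in fine X]second_moment_bar. Qed.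

Definition bar_energy t := bar_const t * M + bar_slope t * bar_moment t.

Lemma rintegrable_bar_pow t : 0 < t -> rintegrable (fun x => B t x `^ m).
Proof.
move=> t0.
have := rintegrableD (rintegrableZ (bar_const t) (rintegrable_bar t0))
  (rintegrableZ (bar_slope t) (rintegrable_bar_moment t0)).
by apply: eq_integrable => // x _; rewrite /= barenblatt_powm.
Qed.

Lemma rint_bar_pow t : 0 < t -> rint (fun x => B t x `^ m) = bar_energy t.
Proof.
move=> t0; rewrite (eq_rint (fun x => barenblatt_powm x t0)).
have i1 := rintegrable_bar t0; have i2 := rintegrable_bar_moment t0.
rewrite (rintD (rintegrableZ (bar_const t) i1) (rintegrableZ (bar_slope t) i2)).
by rewrite (rintZ _ i1) (rintZ _ i2) rint_bar// rint_bar_moment.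
Qed.

Lemma bar_energyE t : 0 < t -> bar_energy t = bar_energy 1 * t `^ (2 * al - 1).
Proof.
move=> t0; rewrite /bar_energy bar_constE// bar_slopeE// /bar_moment powR1 mulr1.
rewrite gt0_powRB1//; field.
by rewrite gt_eqF.
Qed.

(* [B 1] maximizes [int f^m - m int B_1^(m-1) f] over [f >= 0]: compare with [f = B t]. *)
Lemma bar_energy_max t : 0 < t -> bar_energy 1 * t `^ (2 * al - 1) <=
  (1 - m) * bar_energy 1 + m * (bar_const 1 * M + bar_slope 1 * bar_moment t).
Proof.
move=> t0; rewrite -bar_energyE//.
exact: (rint_tangent m0 hm (fun x => ltW (barenblatt_gt0 x t0))
  (fun x => barenblatt_gt0 x ltr01) (fun x => barenblatt_pow x ltr01)
  (rintegrable_bar t0) (rintegrable_bar_moment t0) (rintegrable_bar_pow t0)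
  (rintegrable_bar_pow ltr01) (rint_bar t0) (rint_bar_moment t0)
  (rint_bar_pow t0) (rint_bar_pow ltr01)).
Qed.

(** The function [f], left side minus right side of [bar_energy_max], is nonpositive and vanishes at
    [t = 1], so its derivative there is 0. Cancelling [(1 - m) alpha] leaves the identity, without
    any boundary term at infinity. *)
Lemma bar_virial : d%:R * bar_energy 1 * D = al * J1.
Proof.
pose f (t : R) := bar_energy 1 * t `^ (2 * al - 1) -
  ((1 - m) * bar_energy 1 + m * (bar_const 1 * M + bar_slope 1 * (J1 * t `^ (2 * al)))).
have df (t : R) : 0 < t -> is_derive t 1 f (bar_energy 1 * ((2 * al - 1) * t `^ (2 * al - 1 - 1))
   - (0 + m * (0 + bar_slope 1 * (J1 * (2 * al * t `^ (2 * al - 1)))))).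
  move=> t0; exact: (is_derive1_sub (is_derive1_scale _ (is_derive1_powR _ t0))
    (is_derive1_add (is_derive1_cst _ t) (is_derive1_scale m (is_derive1_add
    (is_derive1_cst _ t) (is_derive1_scale _ (is_derive1_scale J1
    (is_derive1_powR _ t0))))))).
have h12 : 2^-1 <= 2 :> R by lra.
have fmax t : t \in `]2^-1, 2[ -> f t <= f 1.
  rewrite in_itv/= => /andP[t0 _].
  have tp : 0 < t by apply: lt_trans t0.
  have -> : f 1 = 0 by rewrite /f !powR1 /bar_energy /bar_moment powR1; ring.
  by rewrite subr_le0; exact: bar_energy_max.
have := @derive1_at_max R f 2^-1 2 1 h12 _ _ fmax.
case.
- move=> t; rewrite in_itv/= => /andP[t0 _].
  by have [] := df t (lt_trans _ t0).
- by rewrite in_itv/=; apply/andP; split; lra.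
move=> _; have [_ ->] := df 1 ltr01; rewrite !powR1 !mulr1 !add0r.
have -> : m * (bar_slope 1 * (J1 * (2 * al))) = (1 - m) * al ^+ 2 * J1 / D.
  by rewrite /bar_slope /c; field; rewrite !gt_eqF.
rewrite alpha_eq2 => /eqP; rewrite subr_eq0 => /eqP h.
have n0 : (1 - m) * al != 0 by rewrite mulf_neq0// gt_eqF// subr_gt0.
apply: (mulIf n0); have -> : d%:R * bar_energy 1 * D * ((1 - m) * al) =
  bar_energy 1 * (d%:R * (1 - m) * al) * D by ring.
by rewrite h; field; rewrite gt_eqF.
Qed.

(** Both sides scale as [t^(2 alpha - 1)], so the virial identity at time 1 suffices. *)
Lemma is_derive_bar_moment (t : R) : 0 < t ->
  is_derive t 1 bar_moment (2 * d%:R * D * bar_energy t).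
Proof.
move=> t0; have := is_derive1_scale J1 (is_derive1_powR (2 * al) t0) => h.
apply: is_derive_eq; rewrite bar_energyE//.
have := bar_virial; move: (t `^ _) (bar_energy 1) => u e E.
have -> : 2 * d%:R * D * (e * u) = 2 * u * (d%:R * e * D) by ring.
by rewrite E; ring.
Qed.

End energy.

End barenblatt_solution.

(** * Integrals over cubes and removal of the truncation *)

Section integral_limits.
Context {R : realType}.
Variable d : nat.
Implicit Types f g : 'rV[R]_d -> R.

(* Young's inequality against the constant [r^(-d)]. *)
Lemma rint_pow_cube (m r M : R) f : 0 < m -> m < 1 -> d%:R * (1 - m) < 1 -> 1 <= r ->
  rintegrable f -> (forall x, 0 <= f x) -> rint f = M ->
  rintegrable (fun x => f x `^ m * \1_(cube 0 r) x) /\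
  rint (fun x => f x `^ m * \1_(cube 0 r) x) / r ^+ 2 <= ((1 - m) * 2 ^+ d + m * M) / r.
Proof.
move=> m0 m1 dm r1 fi f0 fM.
have r0 : 0 < r by apply: lt_le_trans r1.
(* For this [b], [b^m r^d] and [b^(m-1)] both equal [r^(d(1-m))], so the two terms of the tangent
   inequality have the same order. *)
pose b := r `^ (- d%:R); have b0 : 0 < b by exact: powR_gt0.
pose k1 := (1 - m) * b `^ m; pose k2 := m * b `^ (m - 1).
have ic := @rintegrable_cube R d 0 r (ltW r0).
have i1 := rintegrableZ k1 ic; have i2 := rintegrableZ k2 fi.
have k10 : 0 <= k1 by rewrite mulr_ge0 ?powR_ge0// subr_ge0 ltW.
have k20 : 0 <= k2 by rewrite mulr_ge0 ?powR_ge0// ltW.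
have le1 x : f x `^ m * \1_(cube 0 r) x <= k1 * \1_(cube 0 r) x + k2 * f x.
  rewrite indicE; case: (_ \in _); rewrite ?mulr1 ?mulr0 ?add0r.
    exact: powR_le_tangent.
  exact: mulr_ge0.
have i3 : rintegrable (fun x => f x `^ m * \1_(cube 0 r) x).
  have mf : measurable_fun setT (fun x => f x `^ m * \1_(cube 0 r) x).
    apply: measurable_funM; last by apply: measurable_indic; exact: measurable_cube.
    apply: (measurableT_comp (measurable_powR m)).
    exact: rintegrable_measurable.
  apply: (rintegrable_le mf (rintegrableD i1 i2)) => y.
  by rewrite ger0_norm ?mulr_ge0 ?powR_ge0.
split=> //.
rewrite ler_pdivrMr ?exprn_gt0//.
apply: (le_trans (le_rint i3 (rintegrableD i1 i2) le1)).
rewrite (rintD i1 i2) (rintZ k1 ic) (rintZ k2 fi) fM rint_cube ?(ltW r0)//.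
rewrite exprMn; have -> : k1 * (2 ^+ d * r ^+ d) = (1 - m) * 2 ^+ d * r `^ (d%:R * (1 - m)).
  rewrite /k1 /b -powRrM -(powR_mulrn d (ltW r0)) [X in _ = _ * _ * _ `^ X](_ : _ = - d%:R * m + d%:R).
    by rewrite gt0_powRD//; ring.
  by ring.
have -> : k2 * M = m * M * r `^ (d%:R * (1 - m)).
  by rewrite /k2 /b -powRrM mulrAC; congr (_ * _ `^ _); ring.
rewrite -mulrDl.
have -> : ((1 - m) * 2 ^+ d + m * M) / r * r ^+ 2 = ((1 - m) * 2 ^+ d + m * M) * r.
  by field; rewrite gt_eqF.
have M0 : 0 <= M by rewrite -fM; exact: rint_ge0.
rewrite ler_wpM2l//.
  by rewrite addr_ge0// mulr_ge0// ?(ltW m0)// ?subr_ge0 ?(ltW m1)// exprn_ge0.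
(* Here [d (1 - m) < 1] enters: [r^(d(1-m)) <= r] for [r >= 1]. *)
by rewrite -[leRHS]powRr1 ?(ltW r0)// ler_powR// ltW.
Qed.

Lemma continuous_pos_cube f x0 c : continuous f -> c < f x0 ->
  exists2 r, 0 < r & forall x, cube x0 r x -> c < f x.
Proof.
move=> cf cx; have e0 : 0 < f x0 - c by rewrite subr_gt0.
have /cvg_ballP/(_ _ e0)/nbhs_ballP[r /= r0 hr] := cf x0.
exists (r / 2); first by rewrite divr_gt0.
move=> x hx; have : ball (f x0) (f x0 - c) (f x).
  apply: hr; split => // i j; rewrite ord1 /ball/= distrC.
  by apply: le_lt_trans (hx j) _; lra.
by rewrite /ball/= ltr_distlC => /andP[]; lra.
Qed.

Lemma rint0_continuous f : continuous f -> rintegrable f -> (forall x, 0 <= f x) ->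
  rint f <= 0 -> forall x, f x = 0.
Proof.
move=> cf fi f0 I0 x; apply/eqP; rewrite eq_le f0 andbT leNgt; apply/negP => fx.
have fx2 : f x / 2 < f x by lra.
have [r r0 hr] := continuous_pos_cube cf fx2.
have := @ge_rint_cube R d x r (f x / 2) f (ltW r0) fi f0 (fun y hy => ltW (hr y hy)).
move=> /le_trans /(_ I0); rewrite leNgt => /negP; apply.
by rewrite mulr_gt0 ?divr_gt0// exprn_gt0// mulr_gt0.
Qed.

Lemma normsq_bounded_cube (x0 : 'rV[R]_d) r :
  exists2 N, 0 <= N & forall x, cube x0 r x -> normsq x <= N.
Proof.
have [N N0 hN] := @continuous_bounded_cube R d _ x0 r (@continuous_normsq R d).
by exists N => // x hx; rewrite (le_trans (ler_norm _))// hN.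
Qed.

Lemma ramp_ge_half (r N s : R) : 0 < r -> 2 * N <= r ^+ 2 -> s <= N -> 2^-1 <= ramp (r ^+ 2) s.
Proof.
move=> r0 Nr sN; rewrite le_max; apply/orP; left.
have : s / r ^+ 2 <= 2^-1 by rewrite ler_pdivrMr ?exprn_gt0//; lra.
by lra.
Qed.

(* The choice [eps = 1/(n+1)], [r = (n+1)^2] makes [eps * r] tend to infinity, and the
   truncation error is of order [1 / (eps * r)]. *)
Lemma second_moment_le f (L c : R) : continuous f -> (forall x, 0 <= f x) ->
  (forall n, rintegrable (fun x => moment_test n.+1%:R^-1 (n.+1%:R ^+ 2) x * f x)) ->
  (\forall n \near \oo,
    rint (fun x => moment_test n.+1%:R^-1 (n.+1%:R ^+ 2) x * f x) <= L + c / n.+1%:R) ->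
  (second_moment f <= L%:E)%E.
Proof.
move=> cf f0 fi fL.
pose g (n : nat) (x : 'rV[R]_d) : R := moment_test n.+1%:R^-1 (n.+1%:R ^+ 2) x * f x.
have nV0 n : 0 < n.+1%:R^-1 :> R by rewrite invr_gt0.
have r0 n : 0 < n.+1%:R ^+ 2 :> R by rewrite exprn_gt0.
have g0 n x : 0 <= g n x.
  by rewrite mulr_ge0// (test_ge0 (moment_test_test d (nV0 n) (r0 n))).
have gc x : g n x @[n --> \oo] --> normsq x * f x.
  apply: cvgM; last exact: cvg_cst.
  have hV : (n.+1%:R^-1 : R) @[n --> \oo] --> (0 : R) by exact: cvg_harmonic.
  have hc (k : R) : k * n.+1%:R^-1 @[n --> \oo] --> (0 : R).
    by rewrite -[X in _ --> X](mulr0 k); apply: cvgM => //; exact: cvg_cst.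
  (* The limit is written as the approximating expression with [1 / (n + 1)] replaced by 0; the four
     factors stand for [r^-2 = (n + 1)^-4]. *)
  have -> : normsq x = normsq x / (1 + normsq x * 0) * Num.max (1 - normsq x * (0 * 0 * 0 * 0)) 0 ^+ 3.
    by rewrite !mulr0 addr0 subr0 max_l// expr1n divr1 mulr1.
  rewrite (_ : (fun n => _) = (fun n => normsq x / (1 + normsq x * n.+1%:R^-1) *
    Num.max (1 - normsq x * (n.+1%:R^-1 * n.+1%:R^-1 * n.+1%:R^-1 * n.+1%:R^-1)) 0 ^+ 3)); last first.
    apply/funext => n; rewrite /moment_test /ramp [normsq x * n.+1%:R^-1]mulrC.
    congr (_ * Num.max (1 - _ * _) 0 ^+ 3).
    by rewrite -exprM -exprVn; ring.
  apply: cvgM.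
    apply: cvgM; first exact: cvg_cst.
    apply: cvgV; first by rewrite mulr0 addr0 oner_neq0.
    apply: cvgD; first exact: cvg_cst.
    by apply: cvgM => //; exact: cvg_cst.
  have hn : 1 - normsq x * (n.+1%:R^-1 * n.+1%:R^-1 * n.+1%:R^-1 * n.+1%:R^-1)
      @[n --> \oo] --> (1 - normsq x * (0 * 0 * 0 * 0) : R).
    apply: cvgB; first exact: cvg_cst.
    apply: cvgM; first exact: cvg_cst.
    by do 3 apply: cvgM => //.
  exact: (cvg_comp _ _ hn (is_derive1_continuous (is_derive_maxX 1 _))).
have mg n : measurable_fun setT (fun x => (g n x)%:E).
  by apply/measurable_EFinP; exact: (rintegrable_measurable (fi n)).
(* Only an upper bound on the full moment is wanted, so Fatou's lemma is enough. *)
have := @fatou _ _ R (lebesgue_rV d) setT measurableT (fun n x => (g n x)%:E) mg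
  (fun n x _ => ltac:(by rewrite lee_fin)).
rewrite (_ : (\int[lebesgue_rV d]_(x in setT) limn_einf (fun n => (g n x)%:E))%E =
  second_moment f); last first.
  apply: eq_integral => x _.
  have gce : (g n x)%:E @[n --> \oo] --> (normsq x * f x)%:E.
    by apply: cvg_EFin; [exact: nearW|exact: gc].
  rewrite is_cvg_limn_einfE; last by apply/cvg_ex; exists (normsq x * f x)%:E.
  exact/cvg_lim.
move=> /le_trans; apply.
have bc : (L + c / n.+1%:R)%:E @[n --> \oo] --> L%:E.
  apply: cvg_EFin; first exact: nearW.
  rewrite -[X in _ --> X]addr0; apply: cvgD; first exact: cvg_cst.
  rewrite -[X in _ --> X](mulr0 c); apply: cvgM; first exact: cvg_cst.
  exact: cvg_harmonic.
rewrite limn_einf_lim -(cvg_lim _ bc)//.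
apply: lee_lim; [exact: is_cvg_einfs|by apply/cvg_ex; exists L%:E|].
near=> n; apply: (@le_trans _ _ (rint (g n))%:E).
  rewrite -EFin_rint; last exact: fi.
  by apply: ereal_inf_lbound; exists n => //=.
by rewrite lee_fin; near: n.
Unshelve. all: by end_near. Qed.

End integral_limits.

(** * Comparison of solutions and of second moments *)

Lemma rintegrable_laplacian (R : realType) (d : nat) (r : R) (phi f : 'rV[R]_d -> R) :
  0 <= r -> test_function r phi -> measurable_fun setT f -> bounded_cubes f ->
  rintegrable (fun x => f x * laplacian phi x).
Proof.
move=> r0 tphi mf bf; under [X in rintegrable X]eq_fun => x do rewrite mulr_sumr.
by apply: rintegrable_sum => i; exact: rintegrable_test2 tphi mf bf.
Qed.

Section comparison.
Context {R : realType}.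
Variable d : nat.
Variables (D m M : R) (v w : R -> 'rV[R]_d -> R).
Hypotheses (D0 : 0 < D) (m0 : 0 < m) (m1 : m < 1) (dm : d%:R * (1 - m) < 1).
Hypotheses (cv : classical_solution D m v) (cw : classical_solution D m w).
Hypothesis vi : forall t, 0 < t -> rintegrable (v t).
Hypothesis vM : forall t, 0 < t -> rint (v t) = M.

Let K := (1 - m) * 2 ^+ d + m * M.

(** Since the positive part of [v^m - w^m] is at most [v^m], the loss through the cutoff is
    controlled by the mass of [v]. *)
Lemma excess_flux r t : 1 <= r -> 0 < t ->
  D * rint (fun x =>
    Num.max (powf v m t x - powf w m t x) 0 * laplacian (cutoff r) x) <=
  D * (24 * (K / r)).
Proof.
move=> r1 t0; have r0 : 0 < r by apply: lt_le_trans r1.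
have v0 x := cls_ge0 cv x t0.
have w0 x := cls_ge0 cw x t0.
have [pi pl] := rint_pow_cube m0 m1 dm r1 (vi t0) v0 (vM t0).
rewrite ler_pM2l//; apply: le_trans (_ : 24 / r ^+ 2 * rint (fun x => v t x `^ m * \1_(cube 0 r) x) <= _).
  rewrite -(rintZ _ pi); apply: le_rint; last 1 first.
  - move=> x.
    have h1 : 0 <= Num.max (powf v m t x - powf w m t x) 0 by rewrite le_max lexx orbT.
    apply: (le_trans (ler_wpM2l h1 (@laplacian_cutoff_le R d r x r0))).
    rewrite mulrCA ler_wpM2l ?divr_ge0 ?exprn_ge0 ?(ltW r0)//.
    rewrite indicE; case: (_ \in _); rewrite ?mulr0// !mulr1.
    by rewrite /powf ge_max powR_ge0 andbT gerBl powR_ge0.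
  - have mw : measurable_fun setT (fun x => powf v m t x - powf w m t x).
      by apply: measurable_funB;
        [exact: (cls_pow_measurable cv t0)|exact: (cls_pow_measurable cw t0)].
    have bw : bounded_cubes (fun x => powf v m t x - powf w m t x).
      exact: (bounded_cubesB (cls_pow_bounded m0 cv t0) (cls_pow_bounded m0 cw t0)).
    apply: (rintegrable_laplacian (ltW r0) (cutoff_test d r0) (measurable_maxr0 mw)).
    by apply: bounded_cubes_le bw _ => x; exact: maxr0_le.
  - exact: rintegrableZ.
have -> : 24 / r ^+ 2 * rint (fun x => v t x `^ m * \1_(cube 0 r) x) =
  24 * (rint (fun x => v t x `^ m * \1_(cube 0 r) x) / r ^+ 2) by ring.
by rewrite ler_pM2l.
Qed.

Lemma excess_growth r s t : 1 <= r -> 0 < s -> s <= t ->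
  rint (fun x => cutoff r x * excess v w t x) <=
  rint (fun x => cutoff r x * excess v w s x) + D * (24 * (K / r)) * t.
Proof.
move=> r1 s0 st; have r0 : 0 < r by apply: lt_le_trans r1.
have tr := cutoff_test d r0.
have K0 : 0 <= D * (24 * (K / r)).
  have M0 : 0 <= M by rewrite -(vM s0); apply: rint_ge0 => x; exact: (cls_ge0 cv).
  rewrite mulr_ge0 ?(ltW D0)// mulr_ge0// divr_ge0 ?(ltW r0)//.
  by rewrite addr_ge0// mulr_ge0 ?(ltW m0)// ?exprn_ge0// subr_ge0 ltW.
have := @dini_le_bound R (fun t => rint (fun x => cutoff r x * excess v w t x)) s t
  (D * (24 * (K / r))) st _ _.
have h1 (u : R) : s < u -> u <= t ->
    dini_le (fun t => rint (fun x => cutoff r x * excess v w t x)) u (D * (24 * (K / r))).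
  move=> su _; have u0 : 0 < u by apply: lt_trans su.
  apply: dini_le_mono (kato_time D0 m0 cv cw (ltW r0) tr u0).
  exact: excess_flux.
have h2 (u : R) : s <= u -> u <= t ->
    {for u, continuous (fun t => rint (fun x => cutoff r x * excess v w t x))}.
  move=> su _; have u0 : 0 < u by apply: lt_le_trans su.
  exact: (excess_continuous cv cw (ltW r0) tr u0).
move=> /(_ h1 h2); rewrite lerBlDl => /le_trans; apply.
by rewrite lerD2l ler_wpM2l// gerBl ltW.
Qed.

(** If [v > w] at one point, the excess is bounded below on a cube around it, where the cutoff is at
    least 1/8 once [r] is large. The integral of the excess is however [O(1/r)], by its growth rate
    and its vanishing at time 0. *)
Lemma comparison : (forall r e, 1 <= r -> 0 < e -> exists s0, 0 < s0 /\
    forall s, 0 < s -> s < s0 -> rint (fun x => cutoff r x * excess v w s x) <= e) ->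
  forall t x, 0 < t -> v t x <= w t x.
Proof.
move=> init t x0 t0; rewrite leNgt; apply/negP => wv.
have bound r : 1 <= r -> rint (fun x => cutoff r x * excess v w t x) <= D * (24 * (K / r)) * t.
  move=> r1; apply/ler_addgt0Pr => e e0; have [s0 [s00 hs]] := init r e r1 e0.
  pose s := Num.min s0 t / 2.
  have mn0 : 0 < Num.min s0 t by rewrite lt_min s00.
  have [l1 l2] : Num.min s0 t <= s0 /\ Num.min s0 t <= t by rewrite !ge_min !lexx orbT.
  have sp : 0 < s by rewrite divr_gt0.
  have ss0 : s < s0 by rewrite /s; lra.
  have st : s <= t by rewrite /s; lra.
  by rewrite (le_trans (excess_growth r1 sp st))// addrC lerD2l hs.
have cu : continuous (fun x => v t x - w t x).
  move=> x; apply: (@continuous_at_add R _ _ (fun x => - w t x)).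
    exact: (cls_slice cv t0).
  have := continuous_at_scale (k := -1) (cls_slice cw t0 (x := x)).
  by under eq_fun do rewrite mulN1r.
pose c := (v t x0 - w t x0) / 2.
have c0 : 0 < c by rewrite divr_gt0// subr_gt0.
have cc : c < v t x0 - w t x0 by move: c0; rewrite /c; lra.
have [rho rho0 hrho] := continuous_pos_cube cu cc.
have [N N0 hN] := normsq_bounded_cube x0 rho.
have low r : 1 <= r -> 2 * N <= r -> c / 8 * (2 * rho) ^+ d <= D * (24 * (K / r)) * t.
  move=> r1 rN; have r0 : 0 < r by apply: lt_le_trans r1.
  apply: le_trans (bound r r1).
  apply: (ge_rint_cube (x0 := x0) (ltW rho0)).
  - exact: (rintegrable_excess cv cw (ltW r0) (cutoff_test d r0) t0).
  - move=> x; apply: mulr_ge0; first exact: (test_ge0 (cutoff_test d r0)).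
    by rewrite le_max lexx orbT.
  move=> x hx; rewrite mulrC; apply: ler_pM; rewrite ?invr_ge0 ?(ltW c0)//.
    have rN2 : 2 * N <= r ^+ 2 by rewrite (le_trans rN)// expr2 ler_peMr// ltW.
    have h := ramp_ge_half r0 rN2 (hN x hx).
    have -> : 8^-1 = 2^-1 ^+ 3 :> R by field.
    by rewrite /cutoff lerXn2r ?nnegrE ?invr_ge0// ramp_ge0.
  by rewrite le_max (ltW (hrho x hx)).
have lo0 : 0 < c / 8 * (2 * rho) ^+ d.
  apply: mulr_gt0; first by rewrite divr_gt0.
  by rewrite exprn_gt0// mulr_gt0.
pose lo := c / 8 * (2 * rho) ^+ d.
(* The summands ensure [1 <= r], [2 N <= r], and that [lo * r] exceeds [D * 24 * K * t]. *)
pose r := 1 + 2 * N + `|D * 24 * K * t| / lo.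
have q0 : 0 <= `|D * 24 * K * t| / lo by rewrite divr_ge0// ltW.
have r1 : 1 <= r by rewrite /r -addrA lerDl addr_ge0// mulr_ge0.
have r0 : 0 < r by apply: lt_le_trans r1.
have rN : 2 * N <= r by rewrite /r; lra.
have := low r r1 rN; rewrite leNgt => /negP; apply.
have -> : D * (24 * (K / r)) * t = D * 24 * K * t / r by ring.
rewrite -/lo ltr_pdivrMr//; apply: (le_lt_trans (ler_norm _)).
rewrite /r [ltRHS]mulrDr [lo * (_ / lo)]mulrCA divff ?gt_eqF// mulr1 ltrDr.
by rewrite mulr_gt0// ltr_wpDr// mulr_ge0.
Qed.

End comparison.

(** * The Gronwall argument for the second moment *)

Section moment_comparison.
Context {R : realType}.
Variable d : nat.
Variables (D m M p tau0 : R) (v w : R -> 'rV[R]_d -> R).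
Variables (A a J : R -> R) (v0 : 'rV[R]_d -> R).
Hypotheses (D0 : 0 < D) (m0 : 0 < m) (m1 : m < 1) (dm : d%:R * (1 - m) < 1).
Hypotheses (d1 : (1 <= d)%N) (p0 : 0 <= p) (tau00 : 0 < tau0).
Hypothesis cv : classical_solution D m v.
Hypothesis vi : forall t, 0 < t -> rintegrable (v t).
Hypothesis vM : forall t, 0 < t -> rint (v t) = M.
Hypothesis w_gt0 : forall t x, 0 < t -> 0 < w t x.
Hypothesis w_cont : continuous_pos_time w.
Hypothesis w_pow : forall t x, 0 < t -> w t x `^ (m - 1) = A t + a t * normsq x.
Hypotheses (A0 : forall t, 0 < t -> 0 <= A t) (a0 : forall t, 0 < t -> 0 <= a t).
Hypothesis w_int : forall t, 0 < t -> rintegrable (fun x => w t x `^ m).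
Hypothesis w_energy : forall t, 0 < t ->
  rint (fun x => w t x `^ m) = A t * M + a t * J t.
Hypothesis dJ : forall t : R, 0 < t ->
  is_derive t 1 J (2 * d%:R * D * (A t * M + a t * J t)).
Hypothesis a_rate : forall t, 0 < t -> 2 * d%:R * D * m * a t = p / (t + tau0).
Hypothesis v0_ge0 : forall x, 0 <= v0 x.
Hypothesis v0_int : rintegrable v0.
Hypothesis v0_moment : rintegrable (fun x => normsq x * v0 x).
Hypothesis J_ge : forall t, 0 < t -> rint (fun x => normsq x * v0 x) <= J t.
Hypothesis v_L1 : forall e, 0 < e -> exists s0, 0 < s0 /\ forall s, 0 < s -> s < s0 ->
  rint (fun x => `|v s x - v0 x|) <= e.

Let K := (1 - m) * 2 ^+ d + m * M.
Let gp t x := gap m (v t x) (w t x).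
(** The integrating factor of [z' <= p z / (t + tau0)]; it is nonincreasing because [p >= 0]. *)
Let q (t : R) := (t + tau0) `^ (- p).

Let q0 t : 0 <= t -> 0 < q t.
Proof. by move=> t0; rewrite powR_gt0// ltr_wpDl. Qed.

Let q_le s t : 0 <= s -> s <= t -> q t <= q s.
Proof.
move=> s0 st; have h1 : 0 < s + tau0 by rewrite ltr_wpDl.
have h2 : 0 < t + tau0 by rewrite ltr_wpDl// (le_trans s0).
rewrite /q !powRN lef_pV2 ?posrE ?powR_gt0//.
by apply: ge0_ler_powR; rewrite ?nnegrE ?(ltW h1) ?(ltW h2)// lerD2r.
Qed.

Let dq (t : R) : 0 < t -> is_derive t 1 q (- (p / (t + tau0)) * q t).
Proof.
move=> t0; have tt : 0 < t + tau0 by rewrite addr_gt0.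
have h1 : is_derive t 1 (fun t => t + tau0) (1 + 0).
  exact: (is_derive1_add (is_derive1_id t) (is_derive1_cst tau0 t)).
have h := is_derive1_chain (f := fun y => y `^ (- p)) (g := fun t => t + tau0)
  (is_derive1_powR (- p) tt) h1.
apply: is_derive_eq; rewrite addr0 mulr1 gt0_powRB1// /q; ring.
Qed.

Section fixed_test.
Variables (eps r : R).
Hypotheses (eps0 : 0 < eps) (r1 : 1 <= r).

Let r0 : 0 < r. Proof. exact: lt_le_trans r1. Qed.
Let phi := moment_test eps r : 'rV[R]_d -> R.
Let tphi : test_function r phi := moment_test_test d eps0 r0.
Let th := moment_weight eps r : 'rV[R]_d -> R.

Lemma rintegrable_truncated f : rintegrable f -> (forall x, 0 <= f x) ->
  rintegrable (fun x => phi x * f x).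
Proof.
move=> fi f0.
have mf : measurable_fun setT (fun x => phi x * f x).
  apply: measurable_funM; last exact: rintegrable_measurable.
  exact: continuous_measurable_rV (test_continuous tphi).
apply: (rintegrable_le mf (rintegrableZ eps^-1 fi)) => x.
rewrite ger0_norm; last by rewrite mulr_ge0// (test_ge0 tphi).
by rewrite ler_wpM2r// moment_test_bound.
Qed.

Let cz := classical_solution0 d D m0.
(** The truncated moment of [v], written as an excess over the zero solution so that Kato's
    inequality and the continuity of excess integrals apply to it directly. *)
Let X t := rint (fun x => phi x * excess v (fun _ _ => 0) t x).

(** [24 D / (eps r^2)] from the Laplacian of the test, times the bound [K r] on the integral of
    [v^m] over the cube. *)
Let err := D * 24 * K / (eps * r).

Let M0 : 0 <= M.
Proof. by rewrite -(vM ltr01); apply: rint_ge0 => x; exact: (cls_ge0 cv). Qed.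

Let K0 : 0 <= K.
Proof. by rewrite addr_ge0// mulr_ge0 ?(ltW m0)// ?exprn_ge0// subr_ge0 ltW. Qed.

Let err0 : 0 <= err.
Proof.
by rewrite divr_ge0 ?mulr_ge0// ?(ltW D0)// ltW// mulr_gt0.
Qed.

Let excess0 t x : 0 < t -> excess v (fun _ _ => 0) t x = v t x.
Proof. by move=> t0; rewrite /excess subr0 max_l// (cls_ge0 cv). Qed.

Let XE t : 0 < t -> X t = rint (fun x => phi x * v t x).
Proof. by move=> t0; apply: eq_rint => x; rewrite excess0. Qed.

Let iX t : 0 < t -> rintegrable (fun x => phi x * v t x).
Proof.
move=> t0; have := rintegrable_excess cv cz (ltW r0) tphi t0.
by apply: eq_integrable => // x _; rewrite /= excess0.
Qed.

Let gp_ge0 t x : 0 < t -> 0 <= gp t x.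
Proof. by move=> t0; apply: gap_ge0 => //; [exact: (cls_ge0 cv)|exact: w_gt0]. Qed.

Let th0 x : 0 <= th x. Proof. exact: moment_weight_ge0. Qed.
Let th1 x : th x <= 1. Proof. exact: moment_weight_le1. Qed.

Let gpE t x : 0 < t ->
  v t x `^ m = (1 - m) * w t x `^ m + m * (A t + a t * normsq x) * v t x - gp t x.
Proof. by move=> t0; rewrite /gp /gap w_pow//; ring. Qed.

(** No integrability of [v^m] is at hand. But [th * v^m >= 0], so [th * gp] lies between 0 and the
    weighted tangent, which is dominated by integrable multiples of [w^m], [v] and [phi * v]. *)
Lemma rintegrable_gap t : 0 < t -> rintegrable (fun x => th x * gp t x).
Proof.
move=> t0.
have mv : measurable_fun setT (v t) by exact: (cls_measurable cv).
have mn := continuous_measurable_rV (@continuous_normsq R d).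
have mgp : measurable_fun setT (gp t).
  apply: measurable_funB; last exact: (measurableT_comp (measurable_powR m)).
  apply: measurable_funD.
    by apply: measurable_funM => //; exact: rintegrable_measurable (w_int t0).
  under eq_fun => x do rewrite w_pow//.
  apply: measurable_funM => //; apply: measurable_funM => //.
  by apply: measurable_funD => //; apply: measurable_funM.
have mth : measurable_fun setT th.
  rewrite /th /moment_weight.
  have -> : (fun x : 'rV[R]_d => moment_weight eps r x) =
     fun x => cutoff r x * (1 + eps * normsq x)^-1 ^+ 2.
    by apply/funext => x; rewrite /moment_weight /cutoff exprVn.
  apply: measurable_funM.
    exact: continuous_measurable_rV (test_continuous (cutoff_test d r0)).
  apply: continuous_measurable_rV => x.
  apply: continuous_at_exp; apply: (continuous_at_comp (h := GRing.inv)).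
    by apply: inv_continuous; rewrite gt_eqF// ltr_pwDl// mulr_ge0 ?normsq_ge0// ltW.
  apply: continuous_at_add; first exact: continuous_at_cst.
  by apply: continuous_at_scale; exact: continuous_normsq.
have i1 := rintegrableZ (1 - m) (w_int t0).
have i2 := rintegrableZ (m * A t) (vi t0).
have i3 := rintegrableZ (m * a t) (iX t0).
apply: (rintegrable_le (measurable_funM mth mgp) (rintegrableD (rintegrableD i1 i2) i3)).
move=> x; have hg : 0 <= th x * gp t x by rewrite mulr_ge0// gp_ge0.
rewrite -[X in `|X|]/(th x * gp t x) ger0_norm//.
have vx := cls_ge0 cv x t0.
have h1 : th x * ((1 - m) * w t x `^ m) <= (1 - m) * w t x `^ m.
  by rewrite ler_piMl// mulr_ge0 ?powR_ge0// subr_ge0 ltW.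
have mA : 0 <= m * A t * v t x by rewrite !mulr_ge0 ?A0 ?(ltW m0).
have h2 : th x * (m * A t * v t x) <= m * A t * v t x by rewrite ler_piMl.
have h3 : th x * normsq x * (m * a t * v t x) <= phi x * (m * a t * v t x).
  by rewrite ler_wpM2r ?moment_weight_normsq// !mulr_ge0 ?a0 ?(ltW m0).
have h4 : 0 <= th x * v t x `^ m by rewrite mulr_ge0 ?powR_ge0.
rewrite (gpE _ t0) in h4.
by move: (gp t x) h1 h2 h3 h4 => g h1 h2 h3 h4; lra.
Qed.

(** Write [v^m] as tangent minus gap. The weight is bounded by 1 in the terms in [w^m] and [A v],
    and by [th |x|^2 <= phi] in the term in [a], which reproduces [X t]; the weighted gap is
    kept. *)
Lemma moment_flux t : 0 < t ->
  D * rint (fun x => Num.max (powf v m t x - powf (fun _ _ => 0) m t x) 0 *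
    laplacian phi x) <=
  2 * d%:R * D * ((1 - m) * (A t * M + a t * J t) + m * A t * M + m * a t * X t
    - rint (fun x => th x * gp t x)) + err.
Proof.
move=> t0.
have vx x := cls_ge0 cv x t0.
have [pi pl] := rint_pow_cube m0 m1 dm r1 (vi t0) vx (vM t0).
have i1 := rintegrableZ (1 - m) (w_int t0).
have i2 := rintegrableZ (m * A t) (vi t0).
have i3 := rintegrableZ (m * a t) (iX t0).
have i12 := rintegrableD i1 i2; have i123 := rintegrableD i12 i3.
have i4 := rintegrableB i123 (rintegrable_gap t0).
have i5 := rintegrableZ (2 * d%:R) i4.
have i6 := rintegrableZ (24 / (eps * r ^+ 2)) pi.
have i7 := rintegrableD i5 i6.
have pE x : Num.max (powf v m t x - powf (fun _ (_ : 'rV[R]_d) => 0) m t x) 0 = v t x `^ m.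
  by rewrite /powf powR0 ?gt_eqF// subr0 max_l// powR_ge0.
have i0 : rintegrable (fun x => Num.max (powf v m t x - powf (fun _ _ => 0) m t x) 0 *
    laplacian phi x).
  under [X in rintegrable X]eq_fun => x do rewrite pE.
  apply: (rintegrable_laplacian (ltW r0) tphi); first exact: (cls_pow_measurable cv t0).
  exact: (cls_pow_bounded m0 cv t0).
have le x : Num.max (powf v m t x - powf (fun _ (_ : 'rV[R]_d) => 0) m t x) 0 *
    laplacian phi x <=
    2 * d%:R * ((1 - m) * w t x `^ m + m * A t * v t x + m * a t * (phi x * v t x)
       - th x * gp t x) + 24 / (eps * r ^+ 2) * (v t x `^ m * \1_(cube 0 r) x).
  rewrite pE; have vm0 : 0 <= v t x `^ m by exact: powR_ge0.
  apply: (le_trans (ler_wpM2l vm0 (@laplacian_moment_le R d eps r eps0 r0 x))).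
  rewrite mulrDr; apply: lerD; last by rewrite mulrCA.
  rewrite mulrCA -mulrA [leRHS]mulrA ler_wpM2l ?mulr_ge0 ?ler0n//.
  rewrite mulrC -/(th x) {1}gpE//.
  have h1 : th x * ((1 - m) * w t x `^ m) <= (1 - m) * w t x `^ m.
    by rewrite ler_piMl// mulr_ge0 ?powR_ge0// subr_ge0 ltW.
  have mA : 0 <= m * A t * v t x by rewrite !mulr_ge0 ?A0 ?(ltW m0).
  have h2 : th x * (m * A t * v t x) <= m * A t * v t x by rewrite ler_piMl.
  have h3 : th x * normsq x * (m * a t * v t x) <= phi x * (m * a t * v t x).
    by rewrite ler_wpM2r ?moment_weight_normsq// !mulr_ge0 ?a0 ?(ltW m0).
  by move: h1 h2 h3; lra.
have := le_rint i0 i7 le.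
rewrite (rintD i5 i6) (rintZ _ i4) (rintB i123 (rintegrable_gap t0)) (rintD i12 i3) (rintD i1 i2).
rewrite (rintZ _ (w_int t0)) (rintZ _ (vi t0)) (rintZ _ (iX t0)) (rintZ _ pi).
rewrite w_energy// vM// -XE// => /(ler_wpM2l (ltW D0))/le_trans; apply.
set P := rint (fun x => v t x `^ m * _) in pl *.
have pl2 : D * (24 / (eps * r ^+ 2) * P) <= err.
  have -> : D * (24 / (eps * r ^+ 2) * P) = D * 24 / eps * (P / r ^+ 2).
    by rewrite invfM; ring.
  have -> : err = D * 24 / eps * (K / r) by rewrite /err invfM; ring.
  by rewrite ler_wpM2l// divr_ge0 ?mulr_ge0 ?(ltW D0)// ltW.
rewrite mulrDr; apply: lerD => //.
by rewrite le_eqVlt; apply/orP; left; apply/eqP; ring.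
Qed.

Let Z t := q t * (X t - J t).

Let Xcont (t : R) : 0 < t -> {for t, continuous X}.
Proof. by move=> t0; exact: (excess_continuous cv cz (ltW r0) tphi t0). Qed.

Let XJcont (t : R) : 0 < t -> continuous_at t (fun t => X t - J t).
Proof.
move=> t0; apply: (@continuous_at_add R _ X (fun t => - J t)); first exact: Xcont.
have := continuous_at_scale (k := -1) (is_derive1_continuous (dJ t0)).
by under eq_fun do rewrite mulN1r.
Qed.

Let Zcont (t : R) : 0 < t -> {for t, continuous Z}.
Proof.
move=> t0; apply: continuous_at_mul; last exact: XJcont.
exact: is_derive1_continuous (dq t0).
Qed.

(** Subtracting [J'] leaves [2 d D m a (X - J)], which [a_rate] identifies with
    [p (X - J) / (t + tau0)]; the derivative of [q] cancels it. What remains is the truncation error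
    minus the weighted gap. *)
Let Zdini (t : R) : 0 < t -> dini_le Z t
  (q t * (err - 2 * d%:R * D * rint (fun x => th x * gp t x))).
Proof.
move=> t0.
have h1 := dini_le_mono (moment_flux t0) (kato_time D0 m0 cv cz (ltW r0) tphi t0).
have h2 := dini_leB h1 (dJ t0).
have := dini_leM h2 (dq t0) (XJcont t0) (ltW (q0 (ltW t0))).
apply: dini_le_mono; rewrite le_eqVlt; apply/orP; left; apply/eqP.
rewrite /= -/(X t) -a_rate//.
by move: (X t) (J t) (q t) (A t) (a t) (rint _) err => *; ring.
Qed.

(** As [q] is nonincreasing, the error is weighted by its largest value [q 0] and the gain by its
    smallest value [q t]. *)
Let Zstep s t k : 0 < s -> s <= t -> 0 <= k ->
  (forall u, s < u -> u <= t -> k <= rint (fun x => th x * gp u x)) ->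
  Z t - Z s <= (q 0 * err - q t * (2 * d%:R * D * k)) * (t - s).
Proof.
move=> s0 st k0 hk; apply: dini_le_bound => // u su ut.
  have u0 : 0 < u by apply: lt_trans su.
  apply: dini_le_mono (Zdini u0); rewrite mulrBr; apply: lerB.
    by rewrite ler_wpM2r// q_le// ltW.
  have dD : 0 <= 2 * d%:R * D by rewrite !mulr_ge0 ?ler0n// ltW.
  have qt := ltW (q0 (le_trans (ltW s0) st)).
  have h1 : q t <= q u by rewrite q_le// ltW.
  have h2 : 2 * d%:R * D * k <= 2 * d%:R * D * rint (fun x => th x * gp u x).
    by rewrite ler_wpM2l// hk.
  by apply: ler_pM => //; exact: mulr_ge0.
by apply: Zcont; apply: lt_le_trans su.
Qed.

Let Zweak s t : 0 < s -> s <= t -> Z t - Z s <= q 0 * err * (t - s).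
Proof.
move=> s0 st; have := @Zstep s t 0 s0 st (lexx 0).
rewrite !mulr0 subr0; apply => u su _; apply: rint_ge0 => x.
by rewrite mulr_ge0// gp_ge0// (lt_trans s0).
Qed.

Let phi_v0 : rint (fun x => phi x * v0 x) <= rint (fun x => normsq x * v0 x).
Proof.
apply: le_rint => //; first exact: rintegrable_truncated.
by move=> x; rewrite ler_wpM2r// moment_test_le.
Qed.

(** Since [phi <= eps^-1], convergence in L^1 brings [X s] below the truncated moment of [v0] up to
    a small error; that moment is at most the full one, hence at most [J s]. *)
Let Zinit e : 0 < e -> exists s0, 0 < s0 /\ forall s, 0 < s -> s < s0 -> Z s <= e.
Proof.
move=> e0; pose e' := e * eps / q 0.
have e'0 : 0 < e' by rewrite divr_gt0 ?mulr_gt0 ?q0.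
have [s0 [s00 hs]] := v_L1 e'0; exists s0; split => // s sp ss0.
have iv := rintegrableB (vi sp) v0_int.
have iN : rintegrable (fun x => `|v s x - v0 x|) by exact: (integrable_norm iv).
have i1 := rintegrable_truncated v0_int v0_ge0.
have i2 := rintegrableZ eps^-1 iN.
have hX : X s <= rint (fun x => phi x * v0 x) + eps^-1 * e'.
  rewrite XE//; apply: (@le_trans _ _ (rint (fun x => phi x * v0 x) +
     eps^-1 * rint (fun x => `|v s x - v0 x|))); last first.
    by rewrite lerD2l ler_wpM2l ?hs// invr_ge0 ltW.
  rewrite -(rintZ _ iN) -(rintD i1 i2).
  apply: (le_rint (iX sp) (rintegrableD i1 i2)) => x.
  have px := test_ge0 tphi x.
  rewrite -[v s x](subrK (v0 x)) mulrDr addrC lerD2l subrK.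
  by apply: (le_trans (ler_wpM2l px (ler_norm _))); rewrite ler_wpM2r// moment_test_bound.
have eE : eps^-1 * e' = e / q 0.
  by rewrite /e'; field; rewrite !gt_eqF// q0.
rewrite eE in hX.
have hY : X s - J s <= e / q 0 by move: hX phi_v0 (J_ge sp); lra.
have eq0 : 0 <= e / q 0 by rewrite divr_ge0 ?ltW// q0.
have qs := ltW (q0 (ltW sp)).
apply: (@le_trans _ _ (q s * (e / q 0))); first by rewrite ler_wpM2l.
apply: (@le_trans _ _ (q 0 * (e / q 0))); first by rewrite ler_wpM2r// q_le// ltW.
by rewrite mulrC divfK// gt_eqF// q0.
Qed.

(** The time interval is cut at [s1] and [s2]. Only the middle piece records the gain from the gap;
    the outer two use [gp >= 0], and the starting time tends to 0. *)
Lemma truncated_moment_le s1 s2 T k : 0 < s1 -> s1 <= s2 -> s2 <= T -> 0 <= k ->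
  (forall u, s1 < u -> u <= s2 -> k <= rint (fun x => th x * gp u x)) ->
  rint (fun x => phi x * v T x) <=
    J T + q 0 * err * T / q T - 2 * d%:R * D * k * (s2 - s1).
Proof.
move=> s10 s12 s2T k0 hk.
have s20 : 0 < s2 by apply: lt_le_trans s12.
have T0 : 0 < T by apply: lt_le_trans s2T.
have qT := q0 (ltW T0).
have E : Z T <= q 0 * err * T - q T * (2 * d%:R * D * k) * (s2 - s1).
  apply/ler_addgt0Pr => e e0; have [s0 [s00 hs]] := Zinit e0.
  pose s := Num.min s0 s1 / 2.
  have mn0 : 0 < Num.min s0 s1 by rewrite lt_min s00.
  have [l1 l2] : Num.min s0 s1 <= s0 /\ Num.min s0 s1 <= s1 by rewrite !ge_min !lexx orbT.
  have sp : 0 < s by rewrite divr_gt0.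
  have ss0 : s < s0 by rewrite /s; lra.
  have ss1 : s <= s1 by rewrite /s; lra.
  have z1 := Zweak s20 s2T; have z2 := Zstep s10 s12 k0 hk; have z3 := Zweak sp ss1.
  have z4 := hs s sp ss0.
  have q2 : q T * (2 * d%:R * D * k) * (s2 - s1) <= q s2 * (2 * d%:R * D * k) * (s2 - s1).
    rewrite ler_wpM2r ?subr_ge0// ler_wpM2r ?q_le ?(ltW s20)//.
    by rewrite !mulr_ge0 ?ler0n ?(ltW D0).
  have z5 : 0 <= q 0 * err * s.
    exact: mulr_ge0 (mulr_ge0 (ltW (q0 (lexx 0))) err0) (ltW sp).
  by move: z1 z2 z3 z4 q2 z5; rewrite mulrBl; lra.
have h : X T - J T <= q 0 * err * T / q T - 2 * d%:R * D * k * (s2 - s1).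
  rewrite -(ler_pM2l qT); apply: (le_trans E).
  by rewrite le_eqVlt; apply/orP; left; apply/eqP; field; rewrite gt_eqF.
by rewrite -XE//; move: h; lra.
Qed.

End fixed_test.

(** Replacing [v^m] by its tangent at a fixed [b > 0], which lies above it, bounds the gap below by
    an expression affine in [v]. This [G] is jointly continuous also where [v = 0], and [b] is
    chosen to make it positive at [(s, x)]. *)
Let gap_lower s x : 0 < s -> v s x <> w s x ->
  exists2 dl, 0 < dl & exists2 k, 0 < k & forall t y, `|t - s| < dl -> cube x dl y ->
    0 < t -> k <= gp t y.
Proof.
move=> s0 vw.
have v0x := cls_ge0 cv x s0; have w0x := w_gt0 x s0.
pose H b (vv ww : R) := (1 - m) * ww `^ m + m * ww `^ (m - 1) * vv -
  ((1 - m) * b `^ m + m * b `^ (m - 1) * vv).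
have [b b0 Hb] : exists2 b, 0 < b & 0 < H b (v s x) (w s x).
  have [vz|vn] := eqVneq (v s x) 0.
    (* At [v = 0] the expression is [(1 - m) (w^m - b^m)], positive for any [b] below [w]. *)
    exists (w s x / 2); first by rewrite divr_gt0.
    rewrite /H vz !mulr0 !addr0 -mulrBr mulr_gt0 ?subr_gt0//.
    by apply: gt0_ltr_powR; rewrite ?nnegrE ?divr_ge0 ?ltW//; lra.
  exists (v s x); first by rewrite lt_neqAle eq_sym vn.
  have vp : 0 < v s x by rewrite lt_neqAle eq_sym vn.
  have -> : H (v s x) (v s x) (w s x) = gap m (v s x) (w s x).
    rewrite /H /gap; congr (_ - _); rewrite gt0_powRB1//.
    by field; rewrite gt_eqF.
  by apply: gap_gt0 => //; apply/eqP.
pose G t y := H b (v t y) (w t y).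
have GH t y : 0 < t -> G t y <= gp t y.
  move=> t0; rewrite /G /H /gp /gap lerD2l lerN2.
  by apply: powR_le_tangent => //; exact: (cls_ge0 cv).
have cG : {for (s, x), continuous (fun p : R * 'rV[R]_d => G p.1 p.2)}.
  have c1 := @cls_continuous _ _ _ _ _ cv s x s0.
  have c2 := @w_cont s x s0.
  have cp e : continuous_at (s, x) (fun p : R * 'rV[R]_d => w p.1 p.2 `^ e).
    apply: (continuous_at_comp (h := fun y => y `^ e)) => //.
    exact: is_derive1_continuous (is_derive1_powR e w0x).
  have c3 : continuous_at (s, x) (fun p : R * 'rV[R]_d =>
      -1 * ((1 - m) * b `^ m + m * b `^ (m - 1) * v p.1 p.2)).
    apply: continuous_at_scale; apply: continuous_at_add; first exact: continuous_at_cst.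
    exact: continuous_at_scale.
  have c4 : continuous_at (s, x) (fun p : R * 'rV[R]_d =>
      (1 - m) * w p.1 p.2 `^ m + m * w p.1 p.2 `^ (m - 1) * v p.1 p.2).
    apply: continuous_at_add; first exact: continuous_at_scale.
    by apply: continuous_at_mul => //; exact: continuous_at_scale.
  have := continuous_at_add c4 c3.
  by under eq_fun do rewrite mulN1r.
have g0 : 0 < G s x / 2 by rewrite divr_gt0.
have [|dl dl0 hdl] := @compact_unif R d G s [set x] (G s x / 2) (@compact_set1 _ x) _ g0.
  by move=> y ->.
exists (dl / 2); first by rewrite divr_gt0.
exists (G s x / 2) => // t y ts hy t0.
have dl2 : dl / 2 < dl by lra.
apply: le_trans (GH t y t0).
have := hdl x erefl t y (lt_trans ts dl2) (fun i => le_lt_trans (hy i) dl2).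
by rewrite ltr_norml => /andP[]; lra.
Qed.

Let K1 := D * 24 * K.

(** A point with [v <> w] yields a gain [g > 0] over the time window [[s - h, s]], the same for all
    truncations, while the error decays as [1 / (n + 1)]. In the limit the moment is at most
    [J T - g]. *)
Lemma second_moment_comparison_lt s x T : 0 < s -> s < T -> v s x <> w s x ->
  (second_moment (v T) < (J T)%:E)%E.
Proof.
move=> s0 sT vw; have T0 : 0 < T by apply: lt_trans sT.
have [dl dl0 [k k0 hk]] := gap_lower s0 vw.
pose h := Num.min dl s / 2.
have mn0 : 0 < Num.min dl s by rewrite lt_min dl0.
have [l1 l2] : Num.min dl s <= dl /\ Num.min dl s <= s by rewrite !ge_min !lexx orbT.
have h0 : 0 < h by rewrite divr_gt0.
have s10 : 0 < s - h by rewrite /h; lra.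
have s12 : s - h <= s by rewrite gerBl ltW.
have [N N0 hN] := normsq_bounded_cube x dl.
(* On the cube of volume [(2 dl)^d] the weight is at least 1/32: [(1/2)^3] from the ramp and
   [(1/2)^2] from [1 + eps |x|^2 <= 2]. *)
pose k' := k / 32 * (2 * dl) ^+ d.
have k'0 : 0 < k'.
  by apply: mulr_gt0; rewrite ?divr_gt0// exprn_gt0// mulr_gt0.
have n1 n : 1 <= n.+1%:R ^+ 2 :> R by rewrite exprn_ege1// ler1n.
have nV n : 0 < n.+1%:R^-1 :> R by rewrite invr_gt0.
pose g := 2 * d%:R * D * k' * (s - (s - h)).
have g0 : 0 < g.
  have e : s - (s - h) = h by ring.
  have dR : 0 < d%:R :> R by rewrite ltr0n.
  by rewrite /g e; do !apply: mulr_gt0 => //.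
apply: (@le_lt_trans _ _ (J T - g)%:E); last by rewrite lte_fin gtrBl.
apply: (@second_moment_le R d _ _ (q 0 * K1 * T / q T)).
- exact: (cls_slice cv T0).
- by move=> y; exact: (cls_ge0 cv).
- by move=> n; exact: (rintegrable_truncated (nV n) (n1 n) (vi T0) (fun x => cls_ge0 cv x T0)).
near=> n.
have nN : 2 * N <= n.+1%:R.
  apply: (@le_trans _ _ n%:R); last by rewrite ler_nat.
  by near: n; exact: nbhs_infty_ger.
have n0 : 0 < n.+1%:R :> R by [].
have := @truncated_moment_le n.+1%:R^-1 (n.+1%:R ^+ 2) (nV n) (n1 n) (s - h) s T k' s10
  s12 (ltW sT) (ltW k'0).
move=> /(_ _)/le_trans; apply; last first.
  (* For these parameters [eps r = n + 1], so the accumulated error is exactly a constant over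
     [n + 1]. *)
  rewrite -/g [leRHS]addrAC lerD2r lerD2l le_eqVlt.
  apply/orP; left; apply/eqP; rewrite /K1.
  have Nn : n.+1%:R != 0 :> R by [].
  have qn : q T != 0 by rewrite gt_eqF// q0// ltW.
  by move: (n.+1%:R) Nn => N' Nn; field; rewrite qn Nn.
move=> u u1 u2; have u0 : 0 < u by apply: lt_trans u1.
have us : `|u - s| < dl by rewrite ltr_distl; apply/andP; split; rewrite /h in u1; lra.
apply: (ge_rint_cube (x0 := x) (ltW dl0)).
- by have := rintegrable_gap (nV n) (n1 n) u0; apply.
- move=> y; apply: mulr_ge0; first exact: moment_weight_ge0.
  by apply: gap_ge0 => //; [exact: (cls_ge0 cv)|exact: w_gt0].
move=> y hy; rewrite mulrC; apply: ler_pM; rewrite ?invr_ge0 ?(ltW k0)//; last exact: hk.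
have r0 : 0 < n.+1%:R ^+ 2 :> R by rewrite exprn_gt0.
have rN : 2 * N <= (n.+1%:R ^+ 2) ^+ 2.
  by rewrite (le_trans nN)// -exprM ler_eXnr// ler1n.
have hr := ramp_ge_half r0 rN (hN y hy).
have -> : 32^-1 = 2^-1 ^+ 3 * 2^-1 ^+ 2 :> R by field.
rewrite /moment_weight; apply: ler_pM; rewrite ?exprn_ge0 ?invr_ge0//.
  by rewrite lerXn2r ?nnegrE ?invr_ge0// ramp_ge0.
have y0 := normsq_ge0 y; have yN := hN y hy.
have b0 : 0 < 1 + n.+1%:R^-1 * normsq y by rewrite ltr_pwDl// mulr_ge0// ltW.
rewrite exprVn lef_pV2 ?posrE ?exprn_gt0// lerXn2r ?nnegrE ?(ltW b0)//.
rewrite -[leRHS]/(1 + 1) lerD2l mulrC ler_pdivrMr// mul1r.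
by rewrite (le_trans yN)// (le_trans _ nN)// ler_peMl// ler1n.
Unshelve. all: by end_near. Qed.

End moment_comparison.

(** * Initial trace and the equality case *)

Section initial_trace.
Context {R : realType}.
Variable d : nat.
Variables (D m M C tau0 : R) (v : R -> 'rV[R]_d -> R) (v0 : 'rV[R]_d -> R).
Hypotheses (d1 : (1 <= d)%N) (D0 : 0 < D) (hm1 : m_one R d < m) (hm : m < 1).
Hypotheses (C0 : 0 < C) (tau00 : 0 < tau0).
Hypothesis hv : fde_solution D m v0 v.
Hypothesis v0_int : rintegrable v0.
Hypothesis v_int : forall t, 0 < t -> rintegrable (v t).
Hypothesis v_mass : forall t, 0 < t -> rint (v t) = M.

Notation B := (barenblatt D m C : R -> 'rV[R]_d -> R).
Hypothesis B_int : forall t, 0 < t -> rintegrable (B t).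
Hypothesis B_mass : forall t, 0 < t -> rint (B t) = M.

Let cv := fde_classical hv.
Let w t := B (t + tau0).
Let cw : classical_solution D m w := barenblatt_classical d1 D0 hm1 hm C0 (ltW tau00).
Let m0 := m_gt0 d1 hm1.

Lemma integrable_dist s : 0 < s -> rintegrable (fun x => `|v s x - v0 x|).
Proof. by move=> s0; exact: (integrable_norm (rintegrableB (v_int s0) v0_int)). Qed.

Lemma initial_L1 e : 0 < e -> exists s0, 0 < s0 /\ forall s, 0 < s -> s < s0 ->
  rint (fun x => `|v s x - v0 x|) <= e.
Proof.
move=> e0; have /fine_cvgP[_ /cvg_ballP/(_ _ e0)] := fde_initial_L1 hv.
move=> H; have /nbhs_ballP[s0 /= s00 hs] : nbhs (0 : R) (fun s => 0 < s ->
  ball (0 : R) e (fine (\int[lebesgue_rV d]_x `|v s x - v0 x|%:E)%E)) by exact: H.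
exists s0; split => // s sp ss0.
have := hs s; rewrite /ball/= !sub0r !normrN (ger0_norm (ltW sp)) => /(_ ss0 sp).
by rewrite ltr_norml => /andP[_] /ltW.
Qed.

Lemma barenblatt_init_unif r e : 0 < e -> exists s0, 0 < s0 /\
  forall s, 0 < s -> s < s0 -> forall x, cube 0 r x -> `|B tau0 x - w s x| <= e.
Proof.
move=> e0.
have [dl dl0 hdl] := compact_unif (@compact_cube R d 0 r)
  (fun x _ => @barenblatt_continuous R d D m C d1 D0 hm1 hm C0 tau0 x tau00) e0.
exists dl; split => // s s0 sdl x hx; rewrite distrC ltW//.
apply: hdl => // [|i]; last by rewrite subrr normr0.
by rewrite addrK ger0_norm// ltW.
Qed.

(** The initial excess is at most [|v s - v0| + |v0 - B tau0| + |B tau0 - w s|]: the first term is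
    small in L^1, the second has integral 0, the third is small uniformly on the cube. *)
Lemma barenblatt_start_le : {ae lebesgue_rV d, forall x, v0 x = B tau0 x} ->
  forall t x, 0 < t -> v t x <= w t x.
Proof.
move=> v0B.
have i0 : rintegrable (fun x => v0 x - B tau0 x) by exact: (rintegrableB v0_int (B_int tau00)).
have iN : rintegrable (fun x => `|v0 x - B tau0 x|) by exact: (integrable_norm i0).
have z : rint (fun x => `|v0 x - B tau0 x|) = 0.
  have mf : measurable_fun setT (EFin \o (fun x => v0 x - B tau0 x)).
    by apply/measurable_EFinP; exact: rintegrable_measurable i0.
  have [_ h] := ae_eq_integral_abs (lebesgue_rV d) measurableT mf.
  have -> // : rint (fun x => `|v0 x - B tau0 x|) = fine 0%E.
  rewrite /rint /Rintegral -h//.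
  by apply: filterS v0B => x hx _; rewrite /= hx subrr.
apply: (comparison D0 m0 hm (dm_lt1 d1 hm1) cv cw v_int v_mass) => r e r1 e0.
have r0 : 0 < r by apply: lt_le_trans r1.
have e20 : 0 < e / 2 by rewrite divr_gt0.
set V : R := (2 * r) ^+ d.
have V0 : 0 < V by rewrite exprn_gt0// mulr_gt0.
have [s1 [s10 h1]] := initial_L1 e20.
have [s2 [s20 h2]] := barenblatt_init_unif r (divr_gt0 e20 V0).
exists (Num.min s1 s2); split; first by rewrite lt_min s10.
move=> s s0; rewrite lt_min => /andP[ss1 ss2].
have tr := cutoff_test d r0.
have i1 := integrable_dist s0.
have ic := @rintegrable_cube R d 0 r (ltW r0).
have i3 := rintegrableZ (e / 2 / V) ic.
have i2 := rintegrableD i1 iN.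
have := le_rint (rintegrable_excess cv cw (ltW r0) tr s0) (rintegrableD i2 i3) _.
rewrite (rintD i2 i3) (rintD i1 iN) (rintZ _ ic) z addr0 rint_cube ?(ltW r0)//.
rewrite -/V divfK ?gt_eqF// => H; apply: (le_trans (H _)).
  move=> x; have [hx|hx] := pselect (cube 0 r x); last first.
    rewrite (test_vanish tr)// mul0r !addr_ge0//.
    by rewrite indicE mulr_ge0// divr_ge0// ltW.
  rewrite indicE mem_set// mulr1.
  have c0 := test_ge0 tr x; have c1 := cutoff_le1 x r0.
  have ex0 : 0 <= excess v w s x by rewrite le_max lexx orbT.
  apply: (@le_trans _ _ (excess v w s x)); first by rewrite ler_piMl.
  have hB := h2 s s0 ss2 x hx.
  rewrite /excess ge_max; apply/andP; split; last first.
    by rewrite !addr_ge0// divr_ge0// ltW.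
  have -> : v s x - w s x = (v s x - v0 x) + (v0 x - B tau0 x) + (B tau0 x - w s x) by ring.
  by rewrite !lerD ?ler_norm// (le_trans (ler_norm _)).
rewrite [leRHS](splitr e) lerD2r; exact: h1.
Qed.

(** One-sided comparison is enough: [w - v] is continuous, nonnegative, and of integral 0 because
    the masses agree. *)
Lemma barenblatt_start t : {ae lebesgue_rV d, forall x, v0 x = B tau0 x} ->
  0 < t -> v t = w t.
Proof.
move=> v0B t0; have tt : 0 < t + tau0 by rewrite addr_gt0.
have i := rintegrableB (B_int tt) (v_int t0).
have cd : continuous (fun x => w t x - v t x).
  move=> x; apply: (@continuous_at_add R _ (w t) (fun x => - v t x)).
    exact: (cls_slice cw t0).
  have := continuous_at_scale (k := -1) (cls_slice cv t0 (x := x)).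
  by under eq_fun do rewrite mulN1r.
have h := rint0_continuous cd i.
apply/funext => x; apply/eqP; rewrite eq_sym -subr_eq0; apply/eqP; apply: h => [y|].
  by rewrite subr_ge0; exact: barenblatt_start_le.
by rewrite (rintB (B_int tt) (v_int t0)) B_mass// v_mass// subrr.
Qed.

(** Both [v s] and [w s] have a trace at time 0, namely [v0] in L^1 and [B tau0] locally uniformly.
    If they agree at small times, the traces agree almost everywhere. *)
Lemma barenblatt_start_conv T : 0 < T ->
  (forall s x, 0 < s -> s < T -> v s x = w s x) ->
  {ae lebesgue_rV d, forall x, v0 x = B tau0 x}.
Proof.
move=> T0 vw.
have i0 : rintegrable (fun x => v0 x - B tau0 x) by exact: (rintegrableB v0_int (B_int tau00)).
have iN : rintegrable (fun x => `|v0 x - B tau0 x|) by exact: (integrable_norm i0).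
have m0B := rintegrable_measurable i0.
(* The trace of [w] is taken uniformly on cubes only, so the identity is proved on each cube of
   integer radius and the null sets are united. *)
suff H n : {ae lebesgue_rV d, forall x, cube 0 n%:R x -> v0 x = B tau0 x}.
  have := ae_foralln H; apply: filterS => x hx.
  have [N N0 hN] : exists2 N : R, 0 <= N & forall i, `|x ord0 i| <= N.
    exists (\sum_i `|x ord0 i|); first exact: sumr_ge0.
    by move=> i; rewrite (bigD1 i)//= lerDl sumr_ge0.
  apply: (hx (Num.trunc N).+1) => i; rewrite mxE subr0 (le_trans (hN i))//.
  by rewrite ltW// truncnS_gt.
pose f (x : 'rV[R]_d) := (v0 x - B tau0 x) * \1_(cube 0 n%:R) x.
have mc := @measurable_cube R d 0 n%:R.
have mf : measurable_fun setT f by apply: measurable_funM => //; exact: measurable_indic.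
have n0 : 0 <= n%:R :> R by [].
have fN x : `|f x| <= `|v0 x - B tau0 x|.
  rewrite /f normrM indicE; case: (_ \in _); first by rewrite normr1 mulr1.
  by rewrite normr0 mulr0.
have jf : rintegrable f by apply: (rintegrable_le mf iN).
have jfN : rintegrable (fun x => `|f x|) by exact: (integrable_norm jf).
have f0 : rint (fun x => `|f x|) = 0.
  apply/eqP; rewrite eq_le rint_ge0// andbT; apply/ler_addgt0Pr => e e0.
  have e20 : 0 < e / 2 by rewrite divr_gt0.
  pose V : R := (2 * n%:R) ^+ d.
  have V0 : 0 <= V by rewrite exprn_ge0// mulr_ge0.
  have V1 : 0 < V + 1 by rewrite ltr_wpDl.
  have [s1 [s10 h1]] := initial_L1 e20.
  have [s2 [s20 h2]] := barenblatt_init_unif n%:R (divr_gt0 e20 V1).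
  pose s := Num.min (Num.min s1 s2) T / 2.
  have mn0 : 0 < Num.min (Num.min s1 s2) T by rewrite !lt_min s10 s20.
  have [l1 l2 l3] : [/\ Num.min (Num.min s1 s2) T <= s1, Num.min (Num.min s1 s2) T <= s2 &
    Num.min (Num.min s1 s2) T <= T] by rewrite !ge_min !lexx !orbT.
  have s0 : 0 < s by rewrite divr_gt0.
  have ss1 : s < s1 by rewrite /s; lra.
  have ss2 : s < s2 by rewrite /s; lra.
  have sT : s < T by rewrite /s; lra.
  have i1 := integrable_dist s0.
  have ic := @rintegrable_cube R d 0 n%:R n0.
  have i3 := rintegrableZ (e / 2 / (V + 1)) ic.
  have := le_rint jfN (rintegrableD i1 i3) _.
  rewrite (rintD i1 i3) (rintZ _ ic) rint_cube// -/V add0r => h; apply: (le_trans (h _)).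
    move=> x; rewrite /f indicE; have [hx|hx] := pselect (cube 0 n%:R x); last first.
      by rewrite memNset// !mulr0 normr0 addr0.
    rewrite mem_set// !mulr1.
    have hB := h2 s s0 ss2 x hx.
    have -> : v0 x - B tau0 x = - (v s x - v0 x) - (B tau0 x - w s x).
      by rewrite -(vw s x s0 sT); ring.
    by rewrite (le_trans (ler_normB _ _))// normrN lerD2l.
  rewrite [leRHS](splitr e); apply: lerD; first exact: h1.
  by rewrite mulrAC ler_pdivrMr// ler_wpM2l ?(ltW e20)// lerDl.
have mfE : measurable_fun setT (EFin \o f) by exact/measurable_EFinP.
have [h _] := ae_eq_integral_abs (lebesgue_rV d) measurableT mfE.
have /h : (\int[lebesgue_rV d]_(x in setT) `|(EFin \o f) x| = 0)%E.
  by rewrite -[RHS]/(0%:E) -f0 -EFin_rint.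
apply: filterS => x /(_ I) /= [] hf hx; move: hf.
by rewrite /f indicE mem_set// mulr1 => /eqP; rewrite subr_eq0 => /eqP.
Qed.

End initial_trace.

(** * The theorem *)

Lemma fin_num_of_mule (R : realType) (x : \bar R) (b c : R) : (0 <= x)%E -> 0 < c ->
  b%:E = (x * c%:E)%E -> exists r, x = r%:E.
Proof.
case: x => [r _ _ _|_ c0|//]; first by exists r.
by rewrite gt0_mulye ?lte_fin.
Qed.

Theorem mainTheorem2 (R : realType) (d : nat) (D m : R)
    (v0 : 'rV[R]_d -> R) (M : R) (v : R -> 'rV[R]_d -> R) (C : R)
    (hd : (1 <= d)%N) (hD : 0 < D) (hm1 : m_one R d < m) (hm : m < 1)
    (v0_ge0 : forall x, 0 <= v0 x)
    (v0_int : (lebesgue_rV d).-integrable setT (fun x => (v0 x)%:E))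
    (v0_mass : (\int[lebesgue_rV d]_x (v0 x)%:E = M%:E)%E) (hM : 0 < M)
    (v0_moment :
      (lebesgue_rV d).-integrable setT (fun x => (normsq x * v0 x)%:E))
    (v0_pow : (lebesgue_rV d).-integrable setT (fun x => (v0 x `^ m)%:E))
    (hv : fde_solution D m v0 v)
    (hC : 0 < C)
    (hCM : forall tau : R, 0 < tau ->
      (\int[lebesgue_rV d]_x (barenblatt D m C tau x)%:E = M%:E)%E) :
  let v_inf := barenblatt D m C in
  let I tau := second_moment (v tau) in
  let J tau := second_moment (v_inf tau) in
  (forall tau : R, 0 < tau -> J tau = (J 1%R * (tau `^ (2 * alpha R d m))%:E)%E) /\
  forall tau0 : R, 0 < tau0 -> I 0 = J tau0 ->
    ({ae lebesgue_rV d, forall x, v0 x = v_inf tau0 x} ->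
       forall tau : R, 0 < tau -> I tau = J (tau + tau0)%R) /\
    (~ {ae lebesgue_rV d, forall x, v0 x = v_inf tau0 x} ->
       forall tau : R, 0 < tau -> (I tau < J (tau + tau0)%R)%E).
Proof.
move=> v_inf I J.
have m0 := m_gt0 hd hm1; have dm := dm_lt1 hd hm1; have al0 := alpha_gt0 hd hm1.
have cv := fde_classical hv.
have Jscale tau (t0 : 0 < tau) := @barenblatt_second_moment R d D m C hd hD hm1 hm hC tau t0.
split; first by move=> tau t0; exact: (Jscale tau t0).
move=> tau0 tau00 IJ.
have v_eq t : 0 < t -> (\int[lebesgue_rV d]_x (v t x)%:E = M%:E)%E.
  by move=> t0; rewrite (fde_mass hv) ?ltW.
have vi t : 0 < t -> rintegrable (v t).
  move=> t0; apply: (rintegrable_ge0 (cls_measurable cv t0) _ (v_eq t t0)) => x.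
  exact: (cls_ge0 cv).
have vM t : 0 < t -> rint (v t) = M by move=> t0; rewrite /rint /Rintegral v_eq.
have Bi t : 0 < t -> rintegrable (v_inf t).
  exact: (@rintegrable_bar R d D m C hd hD hm1 hm hC M hCM t).
have BM t : 0 < t -> rint (v_inf t) = M by exact: (rint_bar hCM).
have B_gt0 t x : 0 < t -> 0 < v_inf t x by exact: (barenblatt_gt0 hd hD hm1 hm hC).
(* In the equality case [v tau] and the shifted profile coincide as functions, and so do their
   moments. *)
split=> [v0B tau t0|v0B tau t0].
  exact: (congr1 (@second_moment R d)
    (barenblatt_start hd hD hm1 hm hC tau00 hv v0_int vi vM Bi BM v0B t0)).
have I0 : I 0 = (rint (fun x => normsq x * v0 x))%:E.
  by rewrite /I /second_moment (fde_initial hv) EFin_rint.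
(* Finiteness of [J 1] comes from the data: [I 0] is finite and equals [J 1] times a positive power
   of [tau0]. *)
have [J1 hJ1] : exists J1, second_moment (v_inf 1) = J1%:E.
  have pos : (0 <= second_moment (v_inf 1%R))%E.
    apply: integral_ge0 => x _; rewrite lee_fin mulr_ge0 ?normsq_ge0//.
    exact/ltW/B_gt0.
  have p0 : 0 < tau0 `^ (2 * alpha R d m) by exact: powR_gt0.
  exact: (fin_num_of_mule pos p0 (etrans (esym I0) (etrans IJ (Jscale tau0 tau00)))).
pose Jr := bar_moment d m J1.
have JE t : 0 < t -> J t = (Jr t)%:E.
  exact: (second_moment_bar hd hD hm1 hm hC hJ1).
have J10 : 0 <= J1.
  rewrite -lee_fin -hJ1; apply: integral_ge0 => x _; rewrite lee_fin mulr_ge0 ?normsq_ge0//.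
  exact/ltW/B_gt0.
have J0 : rint (fun x => normsq x * v0 x) = Jr tau0.
  have := etrans (esym I0) (etrans IJ (JE tau0 tau00)).
  by move=> -[].
have tt t : 0 < t -> 0 < t + tau0 by move=> ?; rewrite addr_gt0.
(* Either the two solutions differ at some point before [tau], which gives the strict inequality, or
   they agree on [(0, tau)], which forces the excluded initial datum. *)
have [[s [x [s0 st vw]]]|nvw] :=
    pselect (exists s x, [/\ 0 < s, s < tau & v s x <> v_inf (s + tau0) x]); last first.
  exfalso; apply: v0B.
  apply: (barenblatt_start_conv hd hD hm1 hm hC tau00 hv v0_int vi Bi t0) => s x s0 st.
  by apply: contrapT => vw; apply: nvw; exists s, x.
rewrite (JE (tau + tau0) (tt tau t0)).
pose w t := v_inf (t + tau0); pose A t := bar_const d D m C (t + tau0).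
pose a t := bar_slope d D m (t + tau0); pose Js t := Jr (t + tau0).
have pp : 0 <= 2 * alpha R d m - 1.
  rewrite (alpha_eq2 hd hm1); apply: mulr_ge0; last exact: ltW.
  by rewrite mulr_ge0 ?ler0n// subr_ge0 ltW.
have w_gt0 t y : 0 < t -> 0 < w t y by move=> t1; exact: (B_gt0 _ _ (tt t t1)).
have w_cont : continuous_pos_time w.
  exact: (cls_continuous (barenblatt_classical hd hD hm1 hm hC (ltW tau00))).
have w_pow t y : 0 < t -> w t y `^ (m - 1) = A t + a t * normsq y.
  by move=> t1; exact: (barenblatt_pow hd hD hm1 hm hC y (tt t t1)).
have A0 t : 0 < t -> 0 <= A t.
  by move=> t1; exact: ltW (bar_const_gt0 hd hD hm1 hC (tt t t1)).
have a0 t : 0 < t -> 0 <= a t.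
  by move=> t1; exact: ltW (bar_slope_gt0 hd hD hm1 hm (tt t t1)).
have w_int t : 0 < t -> rintegrable (fun y => w t y `^ m).
  by move=> t1; exact: (rintegrable_bar_pow hd hD hm1 hm hC hCM hJ1 (tt t t1)).
have w_energy t : 0 < t -> rint (fun y => w t y `^ m) = A t * M + a t * Js t.
  by move=> t1; exact: (rint_bar_pow hd hD hm1 hm hC hCM hJ1 (tt t t1)).
have dJ (t : R) : 0 < t -> is_derive t 1 Js (2 * d%:R * D * (A t * M + a t * Js t)).
  move=> t1; rewrite [Js](_ : _ = fun t => Jr (tau0 + t)); last first.
    by apply/funext => u; rewrite /Js addrC.
  apply: is_derive1_shift; rewrite addrC.
  exact: (is_derive_bar_moment hd hD hm1 hm hC hCM hJ1 (tt t t1)).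
have rate t : 0 < t -> 2 * d%:R * D * m * a t = (2 * alpha R d m - 1) / (t + tau0).
  by move=> t1; exact: (bar_slope_rate hd hD hm1 (tt t t1)).
have Jge t : 0 < t -> rint (fun x => normsq x * v0 x) <= Js t.
  (* [J] is nondecreasing and the shifted clock starts at [J(tau0) = I(0)]. *)
  move=> t1; rewrite J0 /Js /Jr /bar_moment; apply: ler_wpM2l => //.
  apply: ge0_ler_powR; rewrite ?nnegrE ?mulr_ge0 ?(ltW al0) ?(ltW tau00) ?(ltW (tt t t1))//.
  by rewrite lerDr ltW.
have vL1 e (e0 : 0 < e) := initial_L1 hv e0.
exact: (second_moment_comparison_lt hD m0 hm dm hd pp tau00 cv vi vM w_gt0 w_cont
  w_pow A0 a0 w_int w_energy dJ rate v0_ge0 v0_int v0_moment Jge vL1 s0 st vw).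
Qed.
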